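(* Let $n\ge 7$ and $\{n-1,n\}\subseteq I\subseteq\{2,3,\ldots,n\}$. Then: (a) if $n$ is even, then the second largest eigenvalue of $\mathrm{Cay}(S_n,C(n,I))$ can only be attained by $(1^n)$, $(n-2,1^2)$ or $(2,1^{n-2})$; (b) if $n$ is odd, then the second largest eigenvalue of $\mathrm{Cay}(S_n,C(n,I))$ can only be attained by $(1^n)$, $(n-2,1^2)$, $(3,1^{n-3})$ or $(2^2,1^{n-4})$.
   Context: $C(n,I)$ is the set of all cycles in $S_n$ whose length lies in $I$, and $\mathrm{Cay}(S_n,C(n,I))$ is the Cayley graph with vertex set $S_n$ and edges $\{g,gs\}$, $s\in C(n,I)$. For $\zeta\vdash n$, let $\chi_\zeta$ be the irreducible character of the Specht module for $\zeta$ and $\tilde\chi_\zeta=\chi_\zeta/\chi_\zeta(\mathbf 1)$; the eigenvalue corresponding to $\zeta$ is $\lambda^I_\zeta=\sum_{k\in I}\binom nk(k-1)!\,\tilde\chi_\zeta((k,1^{n-k}))$, and these are all the adjacency eigenvalues of the graph. An eigenvalue is ''attained by $\zeta$'' if it equals $\lambda^I_\zeta$. *)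

(* Defs.v *)
From HB Require Import structures.
From mathcomp Require Import all_boot all_order all_fingroup all_algebra.
From mathcomp Require Import all_solvable all_field all_character.

Set Implicit Arguments.
Unset Strict Implicit.
Unset Printing Implicit Defensive.

Import Order.TTheory GroupScope GRing.Theory Num.Theory.
Local Open Scope ring_scope.

Definition is_partition (n : nat) (z : seq nat) : bool :=
  [&& sorted geq z, 0%N \notin z & sumn z == n].

(* A tableau of shape z is a permutation t : 'S_n; the cells of the diagram   *)
(* are numbered 0, .., n-1 row by row, and t p is the entry in cell p.        *)
(* S_n acts on the right: (t * g) p = g (t p).                                *)
Definition entry_row (n : nat) (z : seq nat) (t : 'S_n) (i : 'I_n) : nat :=
  reshape_index z (t^-1%g i).

Definition entry_col (n : nat) (z : seq nat) (t : 'S_n) (i : 'I_n) : nat :=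
  reshape_offset z (t^-1%g i).

Definition row_stab (n : nat) (z : seq nat) (t : 'S_n) : {set 'S_n} :=
  [set s : 'S_n | [forall i, entry_row z t (s i) == entry_row z t i]].

Definition col_stab (n : nat) (z : seq nat) (t : 'S_n) : {set 'S_n} :=
  [set s : 'S_n | [forall i, entry_col z t (s i) == entry_col z t i]].

(* The row-equivalence class of t, i.e., all t * s with s \in row_stab z t.   *)
Definition tabloid (n : nat) (z : seq nat) (t : 'S_n) : {set 'S_n} :=
  (t *: row_stab z t)%g.

(* The permutation representation of S_n on formal linear combinations of     *)
(* sets of tableaux. The span of the tabloids of shape z in it is the usual   *)
(* permutation module M^z, which contains the Specht module.                  *)
Definition set_mx (n : nat) (g : 'S_n) : 'M[algC]_#|{set 'S_n}| :=
  \matrix_(i, j) (enum_val j == (enum_val i :* g)%g)%:R.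

Definition set_vec (n : nat) (A : {set 'S_n}) : 'rV[algC]_#|{set 'S_n}| :=
  delta_mx 0 (enum_rank A).

Lemma set_vecM (n : nat) (A : {set 'S_n}) (g : 'S_n) :
  set_vec A *m set_mx g = set_vec (A :* g)%g.
Proof.
rewrite -rowE; apply/rowP=> j; rewrite !mxE enum_rankK eqxx /=.
by rewrite (can2_eq (@enum_valK _) (@enum_rankK _)).
Qed.

Lemma set_mx_repr (n : nat) : mx_repr [set: 'S_n] (@set_mx n).
Proof.
split=> [|g h _ _]; apply/row_matrixP=> i.
  by rewrite !rowE -[i]enum_valK set_vecM rcoset1 mulmx1.
by rewrite !rowE mulmxA -[i]enum_valK !set_vecM rcosetM.
Qed.

Definition set_repr (n : nat) : mx_representation algC [set: 'S_n] _ :=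
  MxRepresentation (@set_mx_repr n).

Definition polytabloid (n : nat) (z : seq nat) (t : 'S_n) :
    'rV[algC]_#|{set 'S_n}| :=
  \sum_(s in col_stab z t) (-1) ^+ s *: set_vec (tabloid z (t * s)%g).

Definition specht_mx (n : nat) (z : seq nat) : 'M[algC]_#|{set 'S_n}| :=
  (\sum_(t : 'S_n) <<polytabloid z t>>)%MS.

Lemma entry_rowM (n : nat) (z : seq nat) (t g : 'S_n) (i : 'I_n) :
  entry_row z (t * g)%g (g i) = entry_row z t i.
Proof. by rewrite /entry_row invMg permM permK. Qed.

Lemma entry_colM (n : nat) (z : seq nat) (t g : 'S_n) (i : 'I_n) :
  entry_col z (t * g)%g (g i) = entry_col z t i.
Proof. by rewrite /entry_col invMg permM permK. Qed.

Lemma row_stabJ (n : nat) (z : seq nat) (t g s : 'S_n) :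
  ((s ^ g)%g \in row_stab z (t * g)%g) = (s \in row_stab z t).
Proof.
rewrite !inE; apply/forallP/forallP=> H i.
  by have := H (g i); rewrite permJ !entry_rowM.
by rewrite -[i](permKV g) permJ !entry_rowM.
Qed.

Lemma col_stabJ (n : nat) (z : seq nat) (t g s : 'S_n) :
  ((s ^ g)%g \in col_stab z (t * g)%g) = (s \in col_stab z t).
Proof.
rewrite !inE; apply/forallP/forallP=> H i.
  by have := H (g i); rewrite permJ !entry_colM.
by rewrite -[i](permKV g) permJ !entry_colM.
Qed.

Lemma tabloidM (n : nat) (z : seq nat) (t g : 'S_n) :
  tabloid z (t * g)%g = (tabloid z t :* g)%g.
Proof.
apply/setP=> u; rewrite mem_rcoset !mem_lcoset -(row_stabJ z t g).
by rewrite invMg conjgE !mulgA mulgKV.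
Qed.

Lemma polytabloidM (n : nat) (z : seq nat) (t g : 'S_n) :
  polytabloid z t *m set_mx g = polytabloid z (t * g)%g.
Proof.
rewrite /polytabloid mulmx_suml [RHS](reindex_inj (@conjg_inj _ g)) /=.
apply: eq_big => [s|s _]; first by rewrite col_stabJ.
by rewrite -scalemxAl set_vecM -tabloidM odd_permJ conjgE !mulgA mulgK.
Qed.

Lemma specht_module (n : nat) (z : seq nat) :
  mxmodule (set_repr n) (specht_mx n z).
Proof.
apply/mxmoduleP=> g _; rewrite /specht_mx sumsmxMr; apply/sumsmx_subP=> t _.
rewrite (eqmxMr _ (genmxE _)) [_ *m _]polytabloidM.
by rewrite (sumsmx_sup (t * g)%g) // genmxE.
Qed.

Definition specht_repr (n : nat) (z : seq nat) :
    mx_representation algC [set: 'S_n] (\rank (specht_mx n z)) :=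
  submod_repr (specht_module n z).

Definition specht_char (n : nat) (z : seq nat) : 'CF([set: 'S_n]) :=
  cfRepr (specht_repr n z).

(* Intended for k >= 2: some orbit of size k contains all points moved by s.  *)
Definition is_cycle (n k : nat) (s : 'S_n) : bool :=
  [exists x, (#|porbit s x| == k) && perm_on (porbit s x) s].

Definition cycles (n k : nat) : {set 'S_n} := [set s | is_cycle k s].

Definition cycles_in (n : nat) (I : {pred nat}) : {set 'S_n} :=
  [set s : 'S_n | [exists k : 'I_n.+1, (nat_of_ord k \in I) && is_cycle k s]].

(* The normalized character at cycle type (k, 1^(n-k)): repr picks a member   *)
(* of the conjugacy class of k-cycles, for 2 <= k <= n.                       *)
Definition normalized_char_cycle (n k : nat) (z : seq nat) : algC :=
  specht_char n z (repr (cycles n k)) / specht_char n z 1%g.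

Definition lambda (n : nat) (I : {pred nat}) (z : seq nat) : algC :=
  \sum_(0 <= k < n.+1 | k \in I)
     ('C(n, k) * (k.-1)`!)%:R * normalized_char_cycle n k z.

Definition cayley (gT : finGroupType) (S : {set gT}) : rel gT :=
  [rel g h | [exists s in S, (h == g * s)%g || (g == h * s)%g]].

Definition adjacency_mx (T : finType) (e : rel T) : 'M[algC]_#|T| :=
  \matrix_(i, j) (e (enum_val i) (enum_val j))%:R.

(* The eigenvalues with multiplicity, in nonincreasing order. The order of    *)
(* algC is total only on real numbers, so this is meaningful for matrices     *)
(* with real eigenvalues, such as adjacency matrices of undirected graphs.    *)
Definition eigenvalues (m : nat) (A : 'M[algC]_m) : seq algC :=
  sort >=%R (sval (closed_field_poly_normal (char_poly A))).

Definition second_largest_eigenvalue (T : finType) (e : rel T) : algC :=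
  (eigenvalues (adjacency_mx e))`_1.

(* Main.v *)
Require Import Defs.
From HB Require Import structures.
From mathcomp Require Import all_boot all_order all_fingroup all_algebra.
From mathcomp Require Import all_solvable all_field all_character.
From mathcomp Require Import spectral sesquilinear.
From mathcomp Require Import zify ring lra.

Set Implicit Arguments.
Unset Strict Implicit.
Unset Printing Implicit Defensive.

Import Order.TTheory GroupScope GRing.Theory Num.Theory.
Local Open Scope ring_scope.

(* The adjacency matrix is a class sum in the regular representation, so its
   eigenvalues are the normalised class sums lambda_chi of the irreducible
   characters chi of S_n, and the largest one comes from chi = 1 only. The
   hooks (n-m,1^m) and the shapes (n-m-1,2,1^(m-1)), called [near] hooks, are
   built by hand from signed permutation characters and induction; the hooks
   are the only irreducible characters that do not vanish at an n-cycle, and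
   apart from the trivial character and the sign the near hooks are the only
   ones that do not vanish at an (n-1)-cycle.

   The reference value is B = lambda_(n-2,1,1). A [deep] character is one that
   is not among the eight hooks and near hooks of depth at most 2 and their
   sign twists. It vanishes or has tiny normalised value at the two longest
   cycles, and the averages of its restrictions to smaller symmetric groups
   bound its values at the shorter cycles well enough to give lambda < B. For
   the other nontrivial characters the values are explicit: those outside the
   list of the theorem satisfy lambda <= B, with equality only for (n-1,1) (and
   its sign twist when n is odd) and I = {2,..,n}, in which case the sign twist
   of (n-1,1) (n even) or the sign (n odd) has a strictly larger eigenvalue.

   Finally, if z has fewer than j rows (columns), then the Specht module of z
   contains no vector on which S_j acts by the sign (trivially); this excludes
   the exceptional characters from the Specht modules of the other shapes, and
   lambda_z is an average of the lambda_chi over the constituents. No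
   irreducibility of Specht modules is used. *)

(** Since [I] is arbitrary below n-1, no cancellation between short lengths can be counted on, so
    lambda_chi and B are compared one cycle length at a time. The normalised value of (n-2,1,1) is 0
    at (n-1)- and (n-2)-cycles and positive at n-cycles, which contribute 2 (n-3)! to B. A deep
    character vanishing at the two longest cycles thus starts 2 (n-3)! behind, and this is the whole
    budget: at lengths below n-4 it never exceeds (n-2,1,1), and at lengths n-4, n-3 and n-2 its
    surplus is bounded by explicit multiples of (n-3)!, which have to add up to less than 2. They
    do, except for the character (2,2,1,1,1) of S_7 when n = 8, where the bound is exactly 2; a
    separate argument shows that no deep character of S_8 restricts to a multiple of it. These
    bounds are proved in S_(n-1), where the restriction of a deep character avoids the trivial and
    standard characters and their sign twists, the ones with large normalised values at short
    cycles. *)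

Lemma perm_extends (T : finType) (A : {set T}) (s s' : seq T) :
  uniq s -> uniq s' -> size s = size s' ->
  {subset s <= A} -> {subset s' <= A} ->
  exists2 g, g \in perm.Sym A & map g s = s'.
Proof.
elim/last_ind: s s' => [|s x IHs] s'.
  by case: s' => // _ _ _ _ _; exists 1%g; rewrite ?group1.
case/lastP: s' => [|s' x']; first by rewrite size_rcons.
rewrite !rcons_uniq !size_rcons => /andP[xs us] /andP[xs' us'] [Es] sA s'A.
have sAx y : y \in s -> y \in A by move=> ys; apply: sA; rewrite mem_rcons inE ys orbT.
have s'Ax y : y \in s' -> y \in A by move=> ys; apply: s'A; rewrite mem_rcons inE ys orbT.
have [g gA Eg] := IHs s' us us' Es sAx s'Ax.
have xA : x \in A by apply: sA; rewrite mem_rcons mem_head.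
have x'A : x' \in A by apply: s'A; rewrite mem_rcons mem_head.
have gxA : g x \in A by move: gA; rewrite inE => /perm_closed->.
exists (g * tperm (g x) x')%g.
  rewrite groupM // inE; apply/subsetP=> y; rewrite inE.
  by case: tpermP => [->|->|_ _]; rewrite ?gxA ?x'A ?eqxx.
rewrite map_rcons permM tpermL; congr (rcons _ _).
rewrite -Eg; apply/eq_in_map=> y ys; rewrite permM tpermD //.
  by rewrite (inj_eq perm_inj); apply: contraNneq xs => ->.
by apply: contraNneq xs' => ->; rewrite -Eg map_f.
Qed.

(** * Exterior powers of the permutation module *)

(** The sign character of Sym(C), inflated to the stabiliser of [C] and extended by zero: the
    diagonal entry of [g] at the basis vector of the exterior power indexed by [C]. *)
Definition sgnset (T : finType) (C : {set T}) (g : {perm T}) : algC :=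
  (-1) ^+ restr_perm C g *+ (g \in 'N(C | 'P)).

Lemma astabsE (T : finType) (C : {set T}) (g : {perm T}) :
  g \in 'N(C | 'P) -> forall x, (g x \in C) = (x \in C).
Proof. by move/astabsP. Qed.

Lemma astabsJ (T : finType) (C : {set T}) (g y : {perm T}) :
  ((g ^ y)%g \in 'N(y @: C | 'P)) = (g \in 'N(C | 'P)).
Proof.
apply/astabsP/astabsP=> H x /=.
  have := H (y x); rewrite /= /aperm permJ !mem_imset //; exact: perm_inj.
rewrite /= /aperm -[x](permKV y) permJ !mem_imset //; try exact: perm_inj.
exact: H.
Qed.

Lemma restr_permJ (T : finType) (C : {set T}) (g y : {perm T}) :
  g \in 'N(C | 'P) ->
  restr_perm (y @: C) (g ^ y)%g = (restr_perm C g ^ y)%g.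
Proof.
move=> gC; apply/permP=> x; rewrite -[x](permKV y) permJ.
have [xC|xC] := boolP ((y^-1)%g x \in C).
  by rewrite !restr_permE ?astabsJ ?imset_f // permJ.
rewrite !(out_perm (restr_perm_on _ _)) //.
by rewrite mem_imset //; exact: perm_inj.
Qed.

Lemma sgnsetJ (T : finType) (C : {set T}) (g y : {perm T}) :
  sgnset (y @: C) (g ^ y)%g = sgnset C g.
Proof.
rewrite /sgnset astabsJ; case gC: (g \in _) => //.
by rewrite restr_permJ // odd_permJ.
Qed.

Lemma sgnsetM (T : finType) (C : {set T}) (g h : {perm T}) :
  g \in 'N(C | 'P) -> sgnset C (g * h)%g = sgnset C g * sgnset C h.
Proof.
move=> gC; rewrite /sgnset groupMl // gC; case: (boolP (h \in _)) => hC.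
  by rewrite /= morphM // odd_permM signr_addb.
by rewrite mulr0.
Qed.

Lemma sgnset_real (T : finType) (C : {set T}) (g : {perm T}) :
  (sgnset C g)^* = sgnset C g.
Proof. by rewrite /sgnset rmorphMn rmorphXn rmorphN rmorph1. Qed.

Lemma tperm_astabs (T : finType) (C : {set T}) (x y : T) :
  (x \in C) = (y \in C) -> tperm x y \in 'N(C | 'P).
Proof.
by move=> xy; apply/astabsP=> z /=; rewrite /aperm; case: tpermP => [->|->|].
Qed.

Lemma sgnset_tperm_in (T : finType) (C : {set T}) (x y : T) :
  x \in C -> y \in C -> x != y -> sgnset C (tperm x y) = -1.
Proof.
move=> xC yC xy; rewrite /sgnset tperm_astabs ?xC ?yC //.
suff ->: restr_perm C (tperm x y) = tperm x y by rewrite odd_tperm xy.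
apply/permP=> z; have [zC|zC] := boolP (z \in C).
  by rewrite restr_permE // tperm_astabs ?xC ?yC.
rewrite (out_perm (restr_perm_on _ _)) // tpermD //.
  by apply: contraNneq zC => <-.
by apply: contraNneq zC => <-.
Qed.

Lemma sgnset_tperm_out (T : finType) (C : {set T}) (x y : T) :
  x \notin C -> y \notin C -> sgnset C (tperm x y) = 1.
Proof.
move=> xC yC; rewrite /sgnset tperm_astabs ?(negPf xC) ?(negPf yC) //.
suff ->: restr_perm C (tperm x y) = 1%g by rewrite odd_perm1.
apply/permP=> z; rewrite perm1; have [zC|zC] := boolP (z \in C).
  rewrite restr_permE ?tperm_astabs ?(negPf xC) ?(negPf yC) // tpermD //.
    by apply: contraNneq xC => ->.
  by apply: contraNneq yC => ->.
by rewrite (out_perm (restr_perm_on _ _)).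
Qed.

(** A transposition inside [C] and outside [D] flips the first sign and keeps the second, so
    translating by it negates the sum. *)
Lemma sgnset_sum_tperm (T : finType) (G : {group {perm T}}) (C D : {set T}) x y :
  tperm x y \in G -> x \in C :\: D -> y \in C :\: D -> x != y ->
  \sum_(g in G) sgnset C g * sgnset D g = 0.
Proof.
move=> tG; rewrite !inE => /andP[xD xC] /andP[yD yC] xy.
have E : \sum_(g in G) sgnset C g * sgnset D g
       = - \sum_(g in G) sgnset C g * sgnset D g.
  rewrite [LHS](reindex_inj (mulgI (tperm x y))) -sumrN /=.
  apply: eq_big => [g|g _]; first by rewrite groupMl.
  rewrite !sgnsetM ?tperm_astabs ?xC ?yC ?(negPf xD) ?(negPf yD) //.
  by rewrite sgnset_tperm_in // sgnset_tperm_out // mul1r mulN1r mulNr.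
by move/eqP: E; rewrite -subr_eq0 opprK -mulr2n mulrn_eq0 => /eqP.
Qed.

Lemma restr_permU1 (T : finType) (C : {set T}) (x : T) (g : {perm T}) :
  x \notin C -> g \in 'N(C | 'P) -> g \in 'N(x |: C | 'P) ->
  restr_perm (x |: C) g = restr_perm C g.
Proof.
move=> xC gC gxC; have gx : g x = x.
  have := astabsE gxC x; rewrite !inE eqxx /= (astabsE gC) (negPf xC) orbF.
  by move/eqP.
apply/permP=> z; have [zC|zC] := boolP (z \in C).
  by rewrite !restr_permE // !inE zC orbT.
rewrite [RHS](out_perm (restr_perm_on _ _)) //.
have [->|zx] := eqVneq z x; first by rewrite restr_permE // inE set11.
by rewrite (out_perm (restr_perm_on _ _)) // !inE (negPf zx).
Qed.

Lemma sgnset_mulU1 (T : finType) (C : {set T}) (x : T) (g : {perm T}) :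
  x \notin C -> sgnset C g * sgnset (x |: C) g =
  ((g \in 'N(C | 'P)) && (g \in 'N(x |: C | 'P)))%:R.
Proof.
move=> xC; rewrite /sgnset.
case: (boolP (g \in 'N(C | 'P))) => gC; last by rewrite mul0r.
case: (boolP (g \in 'N(_ | 'P))) => gxC /=; last by rewrite mulr0.
by rewrite restr_permU1 // !mulr1n -signr_addb addbb.
Qed.

(** Stabilising both sets means stabilising [E] and fixing both extra points, so both signs equal
    the sign on [E]. *)
Lemma sgnset_mul_swap (T : finType) (E : {set T}) (x y : T) (g : {perm T}) :
  x \notin E -> y \notin E -> x != y ->
  sgnset (x |: E) g * sgnset (y |: E) g =
  ((g \in 'N(x |: E | 'P)) && (g \in 'N(y |: E | 'P)))%:R.
Proof.
move=> xE yE xy; rewrite /sgnset.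
case: (boolP (g \in 'N(x |: E | 'P))) => gx; last by rewrite mul0r.
case: (boolP (g \in 'N(y |: E | 'P))) => gy /=; last by rewrite mulr0.
have gE : g \in 'N(E | 'P).
  have ->: E = (x |: E) :&: (y |: E).
    apply/setP=> z; rewrite !inE; case zE: (z \in E); rewrite ?orbT ?orbF //.
    by apply/esym/negbTE; apply: contra xy => /andP[/eqP<- /eqP<-].
  by apply/astabsP=> z; rewrite inE (astabsP gx) (astabsP gy) !inE.
by rewrite !restr_permU1 // !mulr1n -signr_addb addbb.
Qed.

Lemma Sym_im_sub (T : finType) (A C : {set T}) (y : {perm T}) :
  y \in perm.Sym A -> (y @: C \subset A) = (C \subset A).
Proof.
rewrite inE => yA; have yi : injective y by exact: perm_inj.
rewrite -{1}(im_perm_on yA); apply/idP/idP=> [sC|]; last exact: imsetS.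
apply/subsetP=> x xC; have := subsetP sC _ (imset_f y xC).
by rewrite mem_imset.
Qed.

Fact ecf_subproof (T : finType) (A : {set T}) (m : nat) :
  is_class_fun <<perm.Sym A>>
    [ffun g => if g \in perm.Sym A then
       \sum_(C : {set T} | (C \subset A) && (#|C| == m)) sgnset C g else 0].
Proof.
rewrite genGid; apply: intro_class_fun => [x y Gx Gy | x /negPf-> //].
rewrite Gx groupJ // (reindex_inj (imset_inj (@perm_inj _ y))) /=.
apply: eq_big => [C|C _]; last exact: sgnsetJ.
by rewrite Sym_im_sub // card_imset //; exact: perm_inj.
Qed.
(** The character of the m-th exterior power of the permutation module on [A]. *)
Definition ecf (T : finType) (A : {set T}) (m : nat) : 'CF(perm.Sym A) :=
  Cfun 1 (ecf_subproof A m).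

Lemma ecfE (T : finType) (A : {set T}) (m : nat) g : g \in perm.Sym A ->
  ecf A m g = \sum_(C : {set T} | (C \subset A) && (#|C| == m)) sgnset C g.
Proof. by move=> gA; rewrite cfunElock gA. Qed.

Lemma sgnset_repr_subproof (T : finType) (A C : {set T}) :
  mx_repr 'N_(perm.Sym A)(C | 'P) (fun g => (sgnset C g)%:M : 'M[algC]_1).
Proof.
split=> [|g h /setIP[_ gC] _]; last by rewrite sgnsetM // scalar_mxM.
by rewrite /sgnset group1 morph1 odd_perm1.
Qed.
Definition sgnset_repr (T : finType) (A C : {set T}) :=
  MxRepresentation (@sgnset_repr_subproof T A C).

(** The subsets of a given size form one orbit, each reached by a coset of the stabiliser. This
    makes [ecf] a character and gives access to Frobenius reciprocity. *)
Lemma ecf_Ind (T : finType) (A C0 : {set T}) : C0 \subset A ->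
  ecf A #|C0| = 'Ind[perm.Sym_group A] (cfRepr (sgnset_repr A C0)).
Proof.
move=> C0A; apply/cfun_inP=> g gA; rewrite ecfE // cfIndE ?subsetIl //.
set K := ('N_(_)(_ | _))%G.
have orbE (C : {set T}) : ((C \subset A) && (#|C| == #|C0|)) = (C \in orbit 'P^* (perm.Sym A) C0).
  apply/andP/orbitP=> [[CA /eqP Cm]|[y yA <-]] /=; last first.
    by rewrite setactE /= Sym_im_sub // C0A card_imset //; exact: perm_inj.
  have [|||||y yA Ey] := @perm_extends T A (enum C0) (enum C); rewrite ?enum_uniq //.
  - by rewrite -!cardE.
  - by move=> x; rewrite mem_enum; apply/subsetP.
  - by move=> x; rewrite mem_enum; apply/subsetP.
  exists y => //; apply/setP=> x; rewrite -[in RHS]mem_enum -Ey.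
  by apply/imsetP/mapP=> [][z zC ->]; exists z; rewrite // ?mem_enum // -mem_enum.
rewrite (eq_bigl _ _ orbE).
have -> : \sum_(y in perm.Sym_group A) cfRepr (sgnset_repr A C0) (g ^ y)%g
        = \sum_(y in perm.Sym_group A) sgnset (('P^*)%act C0 y) g.
  rewrite (reindex_inj invg_inj) /=; apply: eq_big => [y|y]; first by rewrite groupV.
  rewrite groupV => yA; rewrite cfunE setactE.
  have -> : [set aperm x y | x in C0] = y @: C0 by [].
  have E : sgnset (y @: C0) g = sgnset C0 (g ^ y^-1)%g.
    by rewrite -(sgnsetJ C0 _ y) -conjgM mulVg conjg1.
  rewrite E mxtrace_scalar mulr1n inE groupJ ?groupV //=.
  by rewrite /sgnset; case: (_ \in 'N(_|_)).
rewrite (partition_big (fun y => ('P^*)%act C0 y) (mem (orbit 'P^* (perm.Sym A) C0))) /=;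
  last by move=> y yA; exact: mem_orbit.
rewrite mulr_sumr; apply: eq_bigr => C /orbitP[a aA <-].
rewrite (eq_bigr (fun=> sgnset (('P^*)%act C0 a) g)); last by move=> y /andP[_ /eqP->].
rewrite sumr_const.
have -> : #|[pred y | (y \in perm.Sym A) & ('P^*)%act C0 y == ('P^*)%act C0 a]| = #|K|.
  rewrite -(card_rcoset K a); apply: eq_card => y.
  rewrite -[K :* a]/('N_(perm.Sym A)(C0 | 'P) :* a) -astab1_set.
  by rewrite -amove_act ?subsetT // in_set.
by rewrite -[X in _ * X]mulr_natl mulKf // pnatr_eq0 -lt0n cardG_gt0.
Qed.

Lemma sum_card_stab_orbit (T : finType) (K : {group {perm T}}) (D1 : {set T}) :
  (\sum_(D in orbit 'P^* K D1) #|'N_K(D | 'P)| = #|K|)%N.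
Proof.
rewrite (eq_bigr (fun=> #|'N_K(D1 | 'P)|)) => [|D DO].
  by rewrite sum_nat_const -astab1_set card_orbit_stab.
rewrite -!astab1_set.
have E := card_orbit_stab 'P^* K D; have E1 := card_orbit_stab 'P^* K D1.
have OE : orbit 'P^* K D = orbit 'P^* K D1 by apply/orbit_eqP.
move: E; rewrite OE -E1 => /eqP; rewrite eqn_pmul2l ?orbit_refl //; first by move/eqP.
by apply/card_gt0P; exists D1; exact: orbit_refl.
Qed.

Lemma setactPE (T : finType) (C : {set T}) (g : {perm T}) :
  ('P^*)%act C g = g @: C.
Proof. by []. Qed.

Lemma im_astabs (T : finType) (C : {set T}) (g : {perm T}) :
  g \in 'N(C | 'P) -> g @: C = C.
Proof. by move/(astabs_setact). Qed.

Lemma tperm_Sym (T : finType) (A : {set T}) x y :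
  x \in A -> y \in A -> tperm x y \in perm.Sym A.
Proof.
move=> xA yA; rewrite inE; apply/subsetP=> z; rewrite inE.
by case: tpermP => [->|->|_ _]; rewrite ?xA ?yA ?eqxx.
Qed.

Lemma ecf_dot (T : finType) (A C0 : {set T}) (j : nat) : C0 \subset A ->
  '[ecf A #|C0|, ecf A j] = #|'N_(perm.Sym A)(C0 | 'P)|%:R^-1 *
   \sum_(D : {set T} | (D \subset A) && (#|D| == j))
     \sum_(g in 'N_(perm.Sym A)(C0 | 'P)) sgnset C0 g * sgnset D g.
Proof.
move=> C0A; rewrite ecf_Ind // -cfdot_Res_r cfdotE exchange_big /=.
congr (_ * _); apply: eq_bigr => g gK; have /setIP[gA gC] := gK.
rewrite cfunE gK mxtrace_scalar !mulr1n cfResE ?subsetIl // ecfE //.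
by rewrite rmorph_sum mulr_sumr; apply: eq_bigr => D _; rewrite -[in RHS](sgnset_real D).
Qed.

Lemma sgnset_sum_far (T : finType) (A C D : {set T}) :
  C \subset A -> D \subset A -> (1 < #|C :\: D|)%N || (1 < #|D :\: C|)%N ->
  \sum_(g in 'N_(perm.Sym A)(C | 'P)) sgnset C g * sgnset D g = 0.
Proof.
move=> CA DA /orP[]/card_gt1P[x [y [xCD yCD xy]]].
  apply: (sgnset_sum_tperm _ xCD yCD xy).
  have /setDP[xC _] := xCD; have /setDP[yC _] := yCD.
  apply/setIP; split; first by rewrite tperm_Sym ?(subsetP CA).
  by rewrite tperm_astabs ?xC ?yC.
rewrite (eq_bigr (fun g => sgnset D g * sgnset C g)) => [|g _]; last by rewrite mulrC.
apply: (sgnset_sum_tperm _ xCD yCD xy).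
have /setDP[xD xC] := xCD; have /setDP[yD yC] := yCD.
apply/setIP; split; first by rewrite tperm_Sym ?(subsetP DA).
by rewrite tperm_astabs ?(negPf xC) ?(negPf yC).
Qed.

Lemma sum_nat_stab (T : finType) (K : {group {perm T}}) (D : {set T}) :
  \sum_(g in K) (g \in 'N(D | 'P))%:R = #|'N_K(D | 'P)|%:R :> algC.
Proof.
rewrite -sumr_const big_mkcond [RHS]big_mkcond; apply: eq_bigr => g _ /=.
by rewrite [in RHS]in_setI; case: (g \in K) => //; case: (g \in _).
Qed.

Lemma ecf_dot_succ (T : finType) (A : {set T}) (m : nat) : (m < #|A|)%N ->
  '[ecf A m, ecf A m.+1] = 1.
Proof.
move=> mA; have [C0 /andP[C0A /eqP C0m]] : exists C0 : {set T}, (C0 \subset A) && (#|C0| == m).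
  have [s [us sA ss]] : exists s, [/\ uniq s, {subset s <= A} & size s = m].
    exists (take m (enum A)); split; first exact/take_uniq/enum_uniq.
      by move=> x /mem_take; rewrite mem_enum.
    by rewrite size_takel // -cardE ltnW.
  exists [set x in s]; rewrite cardsE (card_uniqP us) ss eqxx andbT.
  by apply/subsetP=> x; rewrite inE; exact: sA.
rewrite -{1}C0m ecf_dot //.
set K := 'N_(perm.Sym A)(C0 | 'P).
have [y yA yC] : exists2 y, y \in A & y \notin C0.
  have /subsetPn[y] : ~~ (A \subset C0).
    by apply: contraL mA => /subset_leq_card; rewrite C0m -leqNgt.
  by exists y.
have Knat : #|K|%:R != 0 :> algC by rewrite pnatr_eq0 -lt0n cardG_gt0.
apply: (mulfI Knat); rewrite mulVKf // mulr1.
(* The sets that survive are [C0] with one more point. They form a single orbit of [K], and the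
   product of signs is the indicator of the stabiliser of [D], so orbit counting yields #|K|. *)
rewrite (bigID (fun D => D \in orbit 'P^* K (y |: C0))) /= [X in _ + X]big1 ?addr0.
  rewrite -(sum_card_stab_orbit K (y |: C0)) natr_sum.
  apply: eq_big => D.
    rewrite andb_idl // => /orbitP[g /setIP[gA gC] <-].
    rewrite setactPE Sym_im_sub // card_imset ?cardsU1 ?yC ?C0m ?eqxx ?andbT //; last exact: perm_inj.
    by rewrite subUset sub1set yA.
  case/andP=> _ /orbitP[g /setIP[gA gC] <-]; rewrite setactPE imsetU1 im_astabs //.
  have gyC : g y \notin C0 by rewrite (astabsE gC).
  rewrite -sum_nat_stab; apply: eq_bigr => h /setIP[_ hC].
  by rewrite sgnset_mulU1 // hC.
move=> D /andP[/andP[DA /eqP Dm] DO]; apply: sgnset_sum_far => //.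
rewrite -implyNb -leqNgt; apply/implyP=> C1; apply: contraR DO; rewrite -leqNgt => D1.
have cI := cardsID C0 D; have cI' := cardsID D C0; rewrite setIC in cI'.
have C0D : C0 \subset D by rewrite -setD_eq0 -cards_eq0; lia.
have /eqP/cards1P[z Ez] : #|D :\: C0| = 1%N by lia.
have : z \in D :\: C0 by rewrite Ez set11.
rewrite inE => /andP[zC zD]; have zA := subsetP DA _ zD.
apply/orbitP; exists (tperm y z).
  by rewrite inE tperm_Sym // tperm_astabs // (negPf yC) (negPf zC).
have gC : tperm y z \in 'N(C0 | 'P) by rewrite tperm_astabs // (negPf yC) (negPf zC).
rewrite setactPE imsetU1 tpermL im_astabs //.
by rewrite -Ez setUC -{1}(setIidPr C0D) setID.
Qed.

Lemma exists_subset_card (T : finType) (A : {set T}) (m : nat) : (m <= #|A|)%N ->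
  exists2 C : {set T}, C \subset A & #|C| = m.
Proof.
move=> mA; exists [set x in take m (enum A)].
  by apply/subsetP=> x; rewrite inE => /mem_take; rewrite mem_enum.
rewrite cardsE (card_uniqP _) ?size_takel -?cardE //.
exact/take_uniq/enum_uniq.
Qed.

Lemma ecf_dot_far (T : finType) (A : {set T}) (m j : nat) :
  (m <= #|A|)%N -> (m.+1 < j)%N -> '[ecf A m, ecf A j] = 0.
Proof.
move=> mA mj; have [C0 C0A C0m] := exists_subset_card mA.
rewrite -C0m ecf_dot // big1 ?mulr0 // => D /andP[DA /eqP Dj].
apply: sgnset_sum_far => //; apply/orP; right.
have := cardsID C0 D; have := subset_leq_card (subsetIr D C0); lia.
Qed.

Lemma ecf_norm (T : finType) (A : {set T}) (m : nat) : (m <= #|A|)%N ->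
  '[ecf A m, ecf A m] = 1 + (0 < m < #|A|)%N%:R.
Proof.
move=> mA; have [C0 C0A C0m] := exists_subset_card mA.
rewrite -{1}C0m ecf_dot //; set K := 'N_(perm.Sym A)(C0 | 'P).
have Knat : #|K|%:R != 0 :> algC by rewrite pnatr_eq0 -lt0n cardG_gt0.
apply: (mulfI Knat); rewrite mulVKf // mulrDr mulr1.
rewrite (bigD1 C0) ?C0A ?C0m //=; congr (_ + _).
  rewrite -sumr_const; apply: eq_bigr => g /setIP[_ gC].
  by rewrite /sgnset gC -signr_addb addbb.
(* Besides [C0], the sets obtained from it by exchanging one point survive. They again form one
   orbit of [K] and account for the second 1. *)
pose near (D : {set T}) := [exists x in C0, exists y in A :\: C0, D == y |: (C0 :\ x)].
rewrite (bigID near) /= [X in _ + X]big1 ?addr0; last first.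
  move=> D /andP[/andP[/andP[DA /eqP Dm] DC]] nD; apply: sgnset_sum_far => //.
  rewrite -implyNb -leqNgt; apply/implyP=> C1; apply: contraR nD; rewrite -leqNgt => D1.
  have cI := cardsID C0 D; have cI' := cardsID D C0; rewrite setIC in cI'.
  have /eqP/cards1P[x Ex] : #|C0 :\: D| = 1%N.
    apply/eqP; rewrite eqn_leq C1 lt0n cards_eq0 setD_eq0.
    apply: contra DC => sCD; rewrite eq_sym eqEcard sCD; lia.
  have /eqP/cards1P[y Ey] : #|D :\: C0| = 1%N by have := cards1 x; rewrite -Ex; lia.
  have : x \in C0 :\: D by rewrite Ex set11.
  have : y \in D :\: C0 by rewrite Ey set11.
  rewrite !inE => /andP[yC yD] /andP[xD xC].
  apply/exists_inP; exists x => //; apply/exists_inP; exists y.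
    by rewrite !inE yC (subsetP DA).
  apply/eqP; rewrite -Ey -Ex setDDr setDv set0U setIC setUC.
  by rewrite setIC -[LHS](setID D C0) setIC.
have [/andP[m0 mA']|mA'] := boolP (0 < m < #|A|)%N; last first.
  rewrite mulr0 big1 // => D /andP[_ /exists_inP[x xC /exists_inP[y]]].
  rewrite !inE => /andP[yC yA] _; case/negP: mA'; rewrite -C0m.
  apply/andP; split; first by apply/card_gt0P; exists x.
  by apply: proper_card; apply/properP; split=> //; exists y.
have [x xC] : exists x, x \in C0 by apply/card_gt0P; rewrite C0m.
have [y yA yC] : exists2 y, y \in A & y \notin C0.
  have /subsetPn[y] : ~~ (A \subset C0).
    by apply: contraL mA' => /subset_leq_card; rewrite C0m -leqNgt.
  by exists y.
rewrite mulr1 -(sum_card_stab_orbit K (y |: (C0 :\ x))) natr_sum.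
have im_swap (g : {perm T}) : g \in K ->
    ('P^*)%act (y |: (C0 :\ x)) g = g y |: (C0 :\ g x).
  case/setIP=> gA gC; rewrite setactPE imsetU1.
  congr (_ |: _); apply/setP=> z; rewrite -[z](permKV g) mem_imset; last exact: perm_inj.
  by rewrite !inE (astabsE gC) (inj_eq perm_inj).
have xy : x != y by apply: contraTneq xC => ->.
apply: eq_big => D.
  apply/idP/orbitP=> [/andP[_ /exists_inP[x' x'C /exists_inP[y']]]|[g gK <-]].
    rewrite !inE => /andP[y'C y'A] /eqP->.
    have gK : (tperm x x' * tperm y y')%g \in K.
      have [xA x'A] : x \in A /\ x' \in A by split; apply: (subsetP C0A).
      apply/setIP; split; first by rewrite groupM ?tperm_Sym.
      by rewrite groupM ?tperm_astabs ?xC ?x'C // (negPf yC) (negPf y'C).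
    exists (tperm x x' * tperm y y')%g; rewrite // im_swap // !permM tpermL.
    rewrite [tperm x x' y]tpermD // ?tpermL; last by apply: contraTneq x'C => ->.
    by rewrite tpermD //; [apply: contraTneq x'C => <- | apply: contraTneq x'C => <-].
  rewrite im_swap //; have /setIP[gA gC] := gK.
  have gyC : g y \notin C0 by rewrite (astabsE gC).
  have gxC : g x \in C0 by rewrite (astabsE gC).
  have gyA : g y \in A by move: gA; rewrite inE => /perm_closed->.
  have gy' : g y \notin C0 :\ g x by rewrite !inE (negPf gyC) andbF.
  rewrite cardsU1 gy' (cardsD1 (g x) C0) gxC /= in C0m *.
  rewrite C0m eqxx andbT subUset sub1set gyA (subset_trans (subsetDl _ _)) //=.
  apply/andP; split.
    by apply: contraNneq gyC => <-; rewrite !inE eqxx.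
  apply/exists_inP; exists (g x) => //; apply/exists_inP; exists (g y) => //.
  by rewrite !inE gyC.
case/andP=> _ /exists_inP[x' x'C /exists_inP[y']]; rewrite !inE => /andP[y'C y'A] /eqP->.
have x'y' : x' != y' by apply: contraNneq y'C => <-.
rewrite -sum_nat_stab; apply: eq_bigr => h /setIP[_ hC].
rewrite -{1}(setD1K x'C) sgnset_mul_swap ?setD1K ?hC //; rewrite !inE ?eqxx //.
by rewrite (negPf y'C) andbF.
Qed.

Lemma ecf0 (T : finType) (A : {set T}) : ecf A 0 = 1.
Proof.
apply/cfun_inP=> g gA; rewrite ecfE // cfun1E gA (big_pred1 set0) => [|C]; last first.
  by rewrite cards_eq0 andb_idl // => /eqP->; exact: sub0set.
have g0 : g \in 'N(set0 | 'P) by apply/astabsP=> x; rewrite !inE.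
rewrite /sgnset g0; suff -> : restr_perm set0 g = 1%g by rewrite odd_perm1.
by apply/permP=> x; rewrite perm1 (out_perm (restr_perm_on _ _)) // inE.
Qed.

Lemma ecf_char (T : finType) (A : {set T}) m : ecf A m \is a character.
Proof.
have [mA|mA] := leqP m #|A|.
  have [C CA <-] := exists_subset_card mA.
  by rewrite ecf_Ind // cfInd_char // cfRepr_char.
suff -> : ecf A m = 0 by exact: rpred0.
apply/cfun_inP=> g gA; rewrite ecfE // !cfunE big_pred0 // => C.
apply/negbTE/negP=> /andP[/subset_leq_card CA /eqP Cm].
by move: CA; rewrite Cm leqNgt mA.
Qed.

Lemma ecf_dotE (T : finType) (A : {set T}) (m j : nat) :
  (m <= #|A|)%N -> (j <= #|A|)%N ->
  '[ecf A m, ecf A j] =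
    ((m == j) + ((m == j) && (0 < m < #|A|)) + (j == m.+1) + (m == j.+1))%N%:R.
Proof.
move=> mA jA; have [mj|jm|<-] := ltngtP m j; last first.
- by rewrite ecf_norm // -[1]/(1%:R) -natrD; congr (_%:R); lia.
- rewrite cfdotC; have [E|jm'] := eqVneq m j.+1.
    rewrite E ecf_dot_succ ?conjC1 -?E //; transitivity (1%:R : algC) => //.
    by congr (_%:R); lia.
  rewrite ecf_dot_far ?conjC0 //; last by lia.
  by transitivity (0%:R : algC) => //; congr (_%:R); lia.
have [E|jm'] := eqVneq j m.+1.
  rewrite E ecf_dot_succ -?E //; transitivity (1%:R : algC) => //.
  by congr (_%:R); lia.
rewrite ecf_dot_far //; last by lia.
by transitivity (0%:R : algC) => //; congr (_%:R); lia.
Qed.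

(** * Hook characters *)

(** An exterior power of trivial + standard is the sum of two consecutive exterior powers of the
    standard module. The alternating sum inverts this relation, so this is the m-th exterior power
    of the standard module, of shape (N-m,1^m) for N = #|A|. *)
Definition hook_cf (T : finType) (A : {set T}) (m : nat) : 'CF(perm.Sym A) :=
  \sum_(i < m.+1) (-1) ^+ (m - i) *: ecf A i.

Lemma hook_cf0 (T : finType) (A : {set T}) : hook_cf A 0 = 1.
Proof. by rewrite /hook_cf big_ord1 subnn scale1r ecf0. Qed.

Lemma hook_cfS (T : finType) (A : {set T}) m :
  hook_cf A m.+1 = ecf A m.+1 - hook_cf A m.
Proof.
rewrite /hook_cf big_ord_recr /= subnn scale1r addrC; congr (_ + _).
rewrite -sumrN; apply: eq_bigr => i _.
have im : (i <= m)%N by rewrite -ltnS.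
by rewrite (subSn im) exprS mulN1r scaleNr.
Qed.

Lemma hook_cf_dot_ecf (T : finType) (A : {set T}) (m j : nat) :
  (m < #|A|)%N -> (j <= #|A|)%N ->
  '[hook_cf A m, ecf A j] = ((j == m) + (j == m.+1))%N%:R.
Proof.
elim: m j => [|m IHm] j mA jA.
  rewrite hook_cf0 -(ecf0 A) ecf_dotE //; congr (_%:R); lia.
rewrite hook_cfS cfdotBl ecf_dotE ?(ltnW mA) // IHm ?(ltnW mA) //.
by apply/eqP; rewrite subr_eq -natrD eqC_nat; apply/eqP; lia.
Qed.

Lemma hook_cf_orthonormal (T : finType) (A : {set T}) (m j : nat) :
  (m < #|A|)%N -> (j < #|A|)%N -> '[hook_cf A m, hook_cf A j] = (m == j)%:R.
Proof.
move=> mA; elim: j => [|j IHj] jA.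
  by rewrite hook_cf0 -(ecf0 A) hook_cf_dot_ecf // addn0 eq_sym.
rewrite hook_cfS cfdotBr IHj ?(ltnW jA) // hook_cf_dot_ecf ?(ltnW jA) //.
by apply/eqP; rewrite subr_eq -natrD eqC_nat; apply/eqP; lia.
Qed.

Lemma hook_cf_vchar (T : finType) (A : {set T}) m :
  hook_cf A m \in 'Z[irr (perm.Sym A)].
Proof.
elim: m => [|m IHm]; first by rewrite hook_cf0 -(ecf0 A) char_vchar ?ecf_char.
by rewrite hook_cfS rpredB // char_vchar ?ecf_char.
Qed.

Lemma sgnsetU1_fix (T : finType) (C : {set T}) (x : T) (g : {perm T}) :
  x \notin C -> g x = x -> sgnset (x |: C) g = sgnset C g.
Proof.
move=> xC gx; rewrite /sgnset.
have -> : (g \in 'N(x |: C | 'P)) = (g \in 'N(C | 'P)).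
  apply/idP/idP=> gN; apply/astabsP=> z /=; rewrite /aperm.
    have := astabsE gN z; rewrite !inE -{1}gx (inj_eq perm_inj).
    by have [->|//] := eqVneq z x; rewrite gx.
  by rewrite !inE (astabsE gN) -{1}gx (inj_eq perm_inj).
case gC: (g \in _) => //; rewrite restr_permU1 //.
apply/astabsP=> z /=; rewrite /aperm.
by rewrite !inE (astabsE gC) -{1}gx (inj_eq perm_inj).
Qed.

(** Split the subsets according to whether they contain the new fixed point [a]. *)
Lemma ecf_branching (T : finType) (A : {set T}) (a : T) m g : a \notin A ->
  g \in perm.Sym A -> ecf (a |: A) m.+1 g = ecf A m.+1 g + ecf A m g.
Proof.
move=> aA gA; have ga : g a = a by apply: out_perm aA; move: gA; rewrite inE.
have gaA : g \in perm.Sym (a |: A).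
  by move: gA; rewrite !inE => gA; apply: subset_trans gA (subsetUr _ _).
rewrite !ecfE // (bigID (fun C : {set T} => a \in C)) /= addrC; congr (_ + _).
  apply: eq_bigl => C; rewrite andbAC; congr (_ && _).
  apply/andP/idP=> [[CaA aC]|CA]; last first.
    by split; [apply: subset_trans CA (subsetUr _ _)|apply: contra aA; apply/subsetP].
  apply/subsetP=> x xC; move/subsetP/(_ x xC): CaA; rewrite !inE.
  by case/orP=> // /eqP xa; rewrite -xa xC in aC.
rewrite (reindex_onto (fun C => a |: C) (fun C => C :\ a)) /=; last first.
  by move=> C /andP[_ aC]; rewrite setD1K.
apply: eq_big => C.
  apply/idP/idP=> [/andP[/andP[/andP[CA Cm] _] /eqP aC]|/andP[CA Cm]].
    have aC' : a \notin C by rewrite -aC !inE eqxx.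
    rewrite cardsU1 aC' in Cm; rewrite (eqP (_ : #|C| == m)) ?eqxx ?andbT //.
    apply/subsetP=> x xC; have : x \in a |: C by rewrite !inE xC orbT.
    by move/(subsetP CA); rewrite !inE; case/orP=> // /eqP xa; rewrite -xa xC in aC'.
  have aC : a \notin C by apply: contra aA; apply/subsetP.
  rewrite cardsU1 aC (eqP Cm) eqxx andbT setU11 andbT setUS //=.
  by rewrite setU1K.
case/andP=> _ /eqP aC.
by rewrite sgnsetU1_fix // -aC !inE eqxx.
Qed.

(** * The chain of symmetric groups, and hook values at cycles *)

Definition low (n N : nat) : {set 'I_n} := [set i : 'I_n | (i < N)%N].
(** All groups of the chain are subgroups of one ['S_n], fixing the points from [N] on, so that
    restriction and induction need no embeddings. *)
Definition SN (n N : nat) : {group 'S_n} := perm.Sym_group (low n N).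

Lemma card_low n N : (N <= n)%N -> #|low n N| = N.
Proof.
move=> Nn; have inj : injective (widen_ord Nn).
  by move=> i j /(congr1 val)/= /val_inj.
rewrite -[RHS]card_ord -cardsT -(card_imset _ inj); apply: eq_card => i.
rewrite inE; apply/idP/imsetP=> [iN|[j _ ->]]; last by rewrite /= ltn_ord.
by exists (Ordinal iN) => //; apply: val_inj.
Qed.

Lemma low_succ n N (Nn : (N < n)%N) : low n N.+1 = Ordinal Nn |: low n N.
Proof.
by apply/setP=> i; rewrite !inE ltnS leq_eqVlt -val_eqE.
Qed.

Lemma SN_sub n N M : (N <= M)%N -> SN n N \subset SN n M.
Proof.
move=> NM; apply/subsetP=> g; rewrite !inE => gN; apply: subset_trans gN _.
by apply/subsetP=> i; rewrite !inE => /leq_trans->.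
Qed.

Lemma SNT n : SN n n = [set: 'S_n] :> {set 'S_n}.
Proof.
apply/setP=> g; rewrite !inE; apply/subsetP=> i _.
by rewrite inE ltn_ord.
Qed.

Definition hook (n N m : nat) : 'CF(SN n N) := hook_cf (low n N) m.

(** The standard module of S_(N+1) restricts to the permutation module on [N] points; take exterior
    powers. *)
Lemma Res_hook n N m : (N < n)%N ->
  'Res[SN n N] (hook n N.+1 m) = ecf (low n N) m.
Proof.
move=> Nn; have sub := SN_sub n (leqnSn N).
have eB j g : g \in SN n N ->
    ecf (low n N.+1) j.+1 g = ecf (low n N) j.+1 g + ecf (low n N) j g.
  move=> gN; have aN : Ordinal Nn \notin low n N by rewrite inE ltnn.
  have := ecf_branching j aN gN; rewrite -(low_succ Nn); exact.
apply/cfun_inP=> g gN; rewrite cfResE // /hook.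
elim: m => [|m IHm]; first by rewrite hook_cf0 ecf0 !cfun1E gN (subsetP sub).
by rewrite hook_cfS !cfunE IHm eB // addrK.
Qed.

Definition adj_tperm (n k : nat) : 'S_n :=
  if (insub k.-1 : option 'I_n, insub k : option 'I_n) is (Some a, Some b)
  then tperm a b else 1%g.

(* [cyc n k] is the cycle 0 -> 1 -> ... -> k-1 -> 0; [cyc n 1] is the identity. *)
Fixpoint cyc (n k : nat) : 'S_n :=
  if k is k'.+1 then (adj_tperm n k' * cyc n k')%g else 1%g.

Lemma adj_tpermE n k (kn : (k < n)%N) (kn' : (k.-1 < n)%N) :
  adj_tperm n k = tperm (Ordinal kn') (Ordinal kn).
Proof. by rewrite /adj_tperm !insubT. Qed.

Lemma cycE n k (i : 'I_n) : (k <= n)%N ->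
  cyc n k i = (if i.+1 < k then i.+1 else if i.+1 == k then 0 else i)%N :> nat.
Proof.
elim: k i => [|k IHk] i kn; first by rewrite perm1.
have kn' : (k.-1 < n)%N by lia.
rewrite [cyc n k.+1]/= permM (adj_tpermE kn kn') IHk ?(ltnW kn) //.
case: tpermP => [->|->|/eqP + /eqP]; rewrite -?(inj_eq val_inj) /=; do !case: ifP; lia.
Qed.

Lemma odd_cyc n k : (0 < k <= n)%N -> odd_perm (cyc n k) = odd k.-1.
Proof.
case: k => // k; elim: k => [|k IHk] kn.
  by rewrite /= mulg1 (adj_tpermE kn kn) odd_tperm eqxx.
rewrite [cyc n k.+2]/= -/(cyc n k.+1) odd_permM IHk ?(ltnW kn) //=.
have kn' : (k < n)%N by lia.
by rewrite (@adj_tpermE n k.+1 kn kn') odd_tperm -val_eqE /= ltn_eqF.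
Qed.

Lemma cyc1 n : cyc n 1 = 1%g.
Proof.
rewrite /= mulg1 /adj_tperm; case: insubP => // a _ Ea.
by apply/permP=> x; rewrite perm1; case: tpermP.
Qed.

Lemma cyc_SN n k N : (k <= N)%N -> (k <= n)%N -> cyc n k \in SN n N.
Proof.
move=> kN kn; rewrite inE; apply/subsetP=> i; rewrite !inE -val_eqE /= cycE //.
by do !case: ifP; lia.
Qed.

Lemma cyc_astabs n k (C : {set 'I_n}) : (0 < k <= n)%N ->
  C \subset low n k -> cyc n k \in 'N(C | 'P) -> C = set0 \/ C = low n k.
Proof.
move=> /andP[k0 kn] Ck cC; have [->|[x xC]] := set_0Vmem C; [by left|right].
have xk : (x < k)%N by have := subsetP Ck _ xC; rewrite inE.
have step (i j : 'I_n) : j = (if i.+1 < k then i.+1 else 0)%N :> nat -> i \in C -> j \in C.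
  move=> E iC; have ik : (i < k)%N by have := subsetP Ck _ iC; rewrite inE.
  have -> : j = cyc n k i by apply/val_inj; rewrite /= cycE // E; do !case: ifP; lia.
  by rewrite (astabsE cC).
have up (d : nat) (i j : 'I_n) : j = (i + d)%N :> nat -> (j < k)%N -> i \in C -> j \in C.
  elim: d i j => [|d IHd] i j E jk iC.
    by rewrite (_ : j = i) //; apply: val_inj; rewrite /= E addn0.
  have i1 : (i.+1 < n)%N by lia.
  apply: (IHd (Ordinal i1)) => //=; first by rewrite E addSnnS.
  by apply: step iC => /=; rewrite ifT //; lia.
have n0 : (0 < n)%N by lia.
have kn1 : (k.-1 < n)%N by lia.
have C0 : Ordinal n0 \in C.
  apply: (step (Ordinal kn1)) => /=; first by rewrite ifF //; lia.
  by apply: (up (k.-1 - x)%N x) => //=; lia.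
apply/eqP; rewrite eqEsubset Ck; apply/subsetP=> j; rewrite inE => jk.
by apply: (up j (Ordinal n0)) => //=.
Qed.

Lemma restr_perm_Sym (T : finType) (A : {set T}) (g : {perm T}) :
  g \in perm.Sym A -> restr_perm A g = g /\ g \in 'N(A | 'P).
Proof.
rewrite inE => gA; have gN : g \in 'N(A | 'P).
  by apply/astabsP=> x /=; rewrite /aperm perm_closed.
split=> //; apply/permP=> x; have [xA|xA] := boolP (x \in A).
  by rewrite restr_permE.
by rewrite !(out_perm _ xA) // restr_perm_on.
Qed.

Lemma ecf_long_cyc n k m : (0 < k <= n)%N ->
  ecf (low n k) m (cyc n k) = (m == 0%N)%:R + (-1) ^+ k.-1 *+ (m == k).
Proof.
move=> /andP[k0 kn]; rewrite ecfE ?cyc_SN //.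
have ck := card_low kn; have [->|m0] := eqVneq m 0%N.
  rewrite -(ecfE 0%N (cyc_SN (leqnn k) kn)) ecf0 cfun1E cyc_SN //.
  by rewrite eq_sym (gtn_eqF k0) addr0.
have cS := cyc_SN (leqnn k) kn.
rewrite add0r; have [->|mk] := eqVneq m k.
  rewrite (bigD1 (low n k)) ?subxx ?ck ?eqxx //= big1 ?addr0 => [|C].
    have [cE cN] := restr_perm_Sym cS.
    by rewrite /sgnset cN cE odd_cyc ?k0 // signr_odd.
  case/andP=> /andP[CA /eqP Ck] Clow; case/negP: Clow.
  by rewrite eqEcard CA ck Ck leqnn.
rewrite big1 // => C /andP[CA /eqP Cm]; rewrite /sgnset.
case: (boolP (_ \in _)) => // cC.
have [|C0|C1] := cyc_astabs _ CA cC; rewrite ?k0 //.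
  by rewrite -Cm C0 cards0 in m0.
by rewrite -Cm C1 ck eqxx in mk.
Qed.

(** A stable m-set consists of fixed points, possibly together with the whole cycle, which
    contributes its sign. The induction on the number [f] of fixed points is by branching. *)
Lemma ecf_cyc n k f m : (0 < k)%N -> (k + f <= n)%N ->
  ecf (low n (k + f)) m (cyc n k) =
  'C(f, m)%:R + (-1) ^+ k.-1 *+ ((k <= m) * 'C(f, m - k))%N.
Proof.
move=> k0; elim: f m => [|f IHf] m kf.
  rewrite addn0 in kf *; rewrite ecf_long_cyc ?k0 // bin0n; congr (_ + _ *+ _).
  rewrite bin0n; lia.
rewrite addnS in kf *; have cN : cyc n k \in SN n (k + f) by rewrite cyc_SN //; lia.
case: m => [|m].
  rewrite ecf0 cfun1E cyc_SN ?bin0 ?leqn0 ?[k == _]gtn_eqF ?addr0 //; lia.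
have aN : Ordinal kf \notin low n (k + f) by rewrite inE ltnn.
have := ecf_branching m aN cN; rewrite -(low_succ kf) => ->.
rewrite !IHf ?(ltnW kf) // binS natrD addrACA; congr (_ + _).
rewrite -mulrnDr; congr (_ *+ _).
have [km|mk|<-] := ltngtP m.+1 k.
- by rewrite leqNgt (ltnW km).
- by rewrite (_ : (k <= m)%N) // subSn // binS !mul1n.
by rewrite ltnn subnn !bin0 mul0n.
Qed.

(** The cycle has f+1 fixed points here; restricting the hook to an exterior power uses up one of
    them. *)
Lemma hook_cyc n k f m : (0 < k)%N -> (k + f < n)%N ->
  hook n (k + f).+1 m (cyc n k) =
  'C(f, m)%:R + (-1) ^+ k.-1 *+ ((k <= m) * 'C(f, m - k))%N.
Proof.
move=> k0 kf; rewrite -(@ecf_cyc n k f) ?(ltnW kf) // -(Res_hook _ kf) cfResE //.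
  exact: SN_sub.
by rewrite cyc_SN //; lia.
Qed.

Lemma hook_long_cyc n N m : (m < N <= n)%N -> hook n N m (cyc n N) = (-1) ^+ m.
Proof.
move=> /andP[mN Nn]; elim: m mN => [|m IHm] mN.
  by rewrite /hook hook_cf0 cfun1E cyc_SN.
rewrite /hook hook_cfS !cfunE IHm ?(ltnW mN) // ecf_long_cyc; last by lia.
by rewrite (ltn_eqF mN) addr0 add0r exprS mulN1r.
Qed.

Lemma hook1 n N m : (m < N <= n)%N -> hook n N m 1%g = 'C(N.-1, m)%:R.
Proof.
case: N => [|[|N]] /andP[mN Nn] //.
  by rewrite -(cyc1 n) hook_long_cyc; case: m mN.
rewrite -(cyc1 n) -[N.+2]/((1 + N).+1) hook_cyc //= expr0.
case: m {mN} => [|m]; first by rewrite !bin0 addr0.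
by rewrite mul1n subn1 /= binS natrD.
Qed.

Lemma irr_norm1 (gT : finGroupType) (G : {group gT}) (phi : 'CF(G)) :
  phi \in 'Z[irr G] -> '[phi] = 1 -> 0 < phi 1%g -> phi \in irr G.
Proof.
move=> Zphi n1 p1; have [[] [i Ei]] := vchar_norm1P Zphi n1; rewrite Ei in p1 *.
  by move: p1; rewrite expr1 scaleN1r cfunE oppr_gt0 lt_gtF // irr1_gt0.
by rewrite expr0 scale1r mem_irr.
Qed.

Lemma hook_irr n N m : (m < N <= n)%N -> hook n N m \in irr (SN n N).
Proof.
move=> /[dup] /andP[mN Nn] H; apply: irr_norm1; first exact: hook_cf_vchar.
  by rewrite hook_cf_orthonormal ?eqxx ?card_low.
by rewrite hook1 // ltr0n bin_gt0; lia.
Qed.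

Lemma index_SN n N : (N < n)%N -> #|SN n N.+1 : SN n N| = N.+1.
Proof.
move=> Nn; have := Lagrange (SN_sub n (leqnSn N)).
rewrite !perm.card_Sym !card_low ?(ltnW Nn) // factS mulnC => /eqP.
by rewrite eqn_pmul2r ?fact_gt0 // => /eqP.
Qed.

Lemma hook_dot n N m j : (m < N)%N -> (j < N)%N -> (N <= n)%N ->
  '[hook n N m, hook n N j] = (m == j)%:R.
Proof. by move=> mN jN Nn; rewrite hook_cf_orthonormal ?card_low. Qed.

Lemma hook0 n N : hook n N 0 = 1.
Proof. exact: hook_cf0. Qed.

Lemma ecf_hook n N m : ecf (low n N) m.+1 = hook n N m.+1 + hook n N m.
Proof. by rewrite /hook hook_cfS subrK. Qed.

Lemma Ind_hook_dot_hook n N m j : (m < N)%N -> (j <= N)%N -> (N < n)%N ->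
  '['Ind[SN n N.+1] (hook n N m), hook n N.+1 j] = ((j == m) + (j == m.+1))%N%:R.
Proof.
move=> mN jN Nn; rewrite -cfdot_Res_r Res_hook //.
by rewrite hook_cf_dot_ecf ?card_low ?(ltnW Nn).
Qed.

Lemma char_subr_irr (gT : finGroupType) (G : {group gT}) (phi chi : 'CF(G)) :
  phi \is a character -> chi \in irr G -> '[phi, chi] != 0 ->
  phi - chi \is a character.
Proof.
move=> Nphi /irrP[i ->] phi_i.
have /(constt_charP i Nphi)[psi Npsi ->] : i \in irr_constt phi by rewrite irr_consttE.
by rewrite addrC addKr.
Qed.

(** Frobenius reciprocity finds two constituents, and the degree N+1 leaves no room for more. *)
Lemma Ind_cfun1_SN n N : (0 < N)%N -> (N < n)%N ->
  'Ind[SN n N.+1] (1 : 'CF(SN n N)) = ecf (low n N.+1) 1.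
Proof.
move=> N0 Nn; rewrite ecf_hook; pose pi := 'Ind[SN n N.+1] (1 : 'CF(SN n N)).
have Npi : pi \is a character by rewrite cfInd_char ?cfun1_char.
have p1 : '[pi, hook n N.+1 1] = 1.
  by rewrite /pi -(hook0 n N) Ind_hook_dot_hook.
have p0 : '[pi, hook n N.+1 0] = 1.
  by rewrite /pi -(hook0 n N) Ind_hook_dot_hook.
have h1 : hook n N.+1 1 \in irr (SN n N.+1) by rewrite hook_irr // Nn andbT.
have h0 : hook n N.+1 0 \in irr (SN n N.+1) by rewrite hook_irr.
have N1 : pi - hook n N.+1 1 \is a character.
  by rewrite char_subr_irr // p1 oner_eq0.
have N2 : pi - hook n N.+1 1 - hook n N.+1 0 \is a character.
  by rewrite char_subr_irr // cfdotBl p0 hook_dot // subr0 oner_eq0.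
apply/eqP; rewrite -subr_eq0 opprD addrA -/pi -char1_eq0 //.
rewrite !cfunE cfInd1 ?SN_sub // index_SN // cfun11 mulr1 hook0 cfun11.
have -> : hook n N.+1 1 1%g = N%:R by rewrite hook1 /= ?bin1 //; lia.
by rewrite -natr1 -addrA -opprD subrr.
Qed.

(** Hooks extend virtually to the next group, which turns inducing them into multiplying by the
    permutation character. *)
Lemma hook_Res n N m : (N < n)%N ->
  hook n N m = 'Res (\sum_(i < m.+1) (-1) ^+ (m - i) *: hook n N.+1 i).
Proof.
move=> Nn; rewrite linear_sum; apply: eq_bigr => i _ /=.
by rewrite linearZ /= Res_hook.
Qed.

(* Mackey's formula for S_N in S_{N+1}, for class functions that extend. *)
Lemma Ind_dot_Ind n N (phi : 'CF(SN n N.+1)) (psi : 'CF(SN n N.+2)) :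
  (0 < N)%N -> (N.+1 < n)%N ->
  '['Ind[SN n N.+2] phi, 'Ind[SN n N.+2] ('Res[SN n N.+1] psi)] =
  '[phi, 'Res psi] + '['Res[SN n N] phi, 'Res[SN n N] ('Res[SN n N.+1] psi)].
Proof.
move=> N0 Nn; have sub M : SN n M \subset SN n M.+1 by exact: SN_sub.
have -> : 'Ind[SN n N.+2] ('Res[SN n N.+1] psi) = ecf (low n N.+2) 1 * psi.
  by rewrite -(Ind_cfun1_SN _ Nn) // -cfIndM // mul1r.
rewrite -cfdot_Res_r rmorphM /=.
rewrite ecf_hook linearD /= !Res_hook // ecf0 mulrDl mul1r addrC cfdotDr; congr (_ + _).
by rewrite -Ind_cfun1_SN ?(ltnW Nn) // -cfIndM // mul1r -cfdot_Res_l.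
Qed.

Lemma Ind_hook_dot n N m j : (0 < N)%N -> (N.+1 < n)%N -> (m <= N)%N -> (j <= N)%N ->
  '['Ind[SN n N.+2] (hook n N.+1 m), 'Ind[SN n N.+2] (hook n N.+1 j)] =
  ((m == j) + ((m == j) + ((m == j) && (0 < m < N)) + (j == m.+1) + (m == j.+1)))%N%:R.
Proof.
move=> N0 Nn mN jN; rewrite [in LHS](hook_Res j Nn) Ind_dot_Ind // -hook_Res //.
by rewrite hook_dot ?(ltnW Nn) // !Res_hook ?(ltnW Nn) // ecf_dotE ?card_low ?natrD //; lia.
Qed.

(** * Near hooks: norms, degrees, irreducibility *)

(** By the branching rule an induced hook is the sum of two hooks and of the shape with a cell added
    in the inner corner, (N-m-1,2,1^(m-1)); the latter is what remains. *)
Definition near (n N m : nat) : 'CF(SN n N) :=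
  'Ind[SN n N] (hook n N.-1 m) - hook n N m - hook n N m.+1.

Lemma near_dot_hook n N m j : (m < N)%N -> (j <= N)%N -> (N < n)%N ->
  '[near n N.+1 m, hook n N.+1 j] = 0.
Proof.
move=> mN jN Nn; rewrite !cfdotBl Ind_hook_dot_hook // !hook_dot ?(ltnW Nn) //; try lia.
by apply/eqP; rewrite subr_eq add0r subr_eq -natrD eqC_nat; apply/eqP; lia.
Qed.

Lemma near_dot n N m j : (0 < N)%N -> (N.+1 < n)%N -> (m <= N)%N -> (j <= N)%N ->
  '[near n N.+2 m, near n N.+2 j] = ((m == j) && (0 < m < N)%N)%:R.
Proof.
move=> N0 Nn mN jN; rewrite {2}/near !cfdotBr !near_dot_hook ?subr0 //; try lia.
rewrite !cfdotBl Ind_hook_dot // ![ '[hook _ _ _, 'Ind[_] _]]cfdotC.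
rewrite !Ind_hook_dot_hook ?conjC_nat //; try lia.
by apply/eqP; rewrite subr_eq subr_eq -!natrD eqC_nat; apply/eqP; lia.
Qed.

(** The degree of the induced hook minus C(N-1,m) + C(N-1,m+1) = C(N,m+1). *)
Definition near_deg (N m : nat) : int :=
  N%:Z * 'C(N.-2, m)%:Z - 'C(N, m.+1)%:Z.

(** The branching rule in numbers: removing a cell leaves two near hooks and a hook. *)
Lemma near_degS N m :
  near_deg N.+3 m.+1 = near_deg N.+2 m.+1 + near_deg N.+2 m + 'C(N.+1, m.+1)%:Z.
Proof.
rewrite /near_deg /= !binS; lia.
Qed.

Lemma near_deg1 N : 2 * near_deg N.+2 1 = N.+2%:Z * (N%:Z - 1).
Proof.
have := mul_bin_diag N.+2 1; rewrite bin1 /near_deg /= bin1; lia.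
Qed.

Lemma near_deg_sym N m : (m <= N)%N -> near_deg N.+2 (N - m) = near_deg N.+2 m.
Proof.
move=> mN; rewrite /near_deg /= bin_sub //; congr (_ - _%:Z).
by rewrite -[RHS]bin_sub; [congr 'C(_, _) | ]; lia.
Qed.

(** The bound is the degree at both ends m = 1 and m = N-1; in between, the recurrence adds up two
    degrees that obey the previous bound. *)
Lemma near_deg_ge N m : (0 < m)%N -> (m < N)%N ->
  N.+2%:Z * (N%:Z - 1) <= 2 * near_deg N.+2 m.
Proof.
elim: N m => // N IHN m m0 mN.
have [->|m1] := eqVneq m 1%N; first by rewrite near_deg1.
have [->|mN'] := eqVneq m N.
  by have := @near_deg_sym N.+1 1 isT; rewrite subn1 /= => ->; rewrite near_deg1.
case: m m0 m1 mN mN' => // m _ m1 mN mN'.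
have H1 := IHN m.+1 isT; have H2 := IHN m.
rewrite near_degS; nia.
Qed.

Lemma near_deg2 N : 3 * near_deg N.+2 2 = N.+2%:Z * N%:Z * (N%:Z - 2).
Proof.
have := mul_bin_diag N.+2 2; have := mul_bin_diag N.+1 1.
have := mul_bin_diag N 1; rewrite !bin1 /near_deg /=.
case: N => [|N] /=; nia.
Qed.

(** Away from the ends the degree is at least cubic in [N], with the bound attained at m = 2. This
    is what makes the middle near hooks harmless later. *)
Lemma near_deg_mid_ge N m : (1 < m)%N -> (m.+1 < N)%N ->
  N.+2%:Z * N%:Z * (N%:Z - 2) <= 3 * near_deg N.+2 m.
Proof.
elim: N m => // N IHN m m1 mN.
have [->|m2] := eqVneq m 2%N; first by rewrite near_deg2.
have [E|mN'] := eqVneq m.+1 N.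
  have -> : m = (N.+1 - 2)%N by lia.
  by rewrite near_deg_sym ?near_deg2 //; lia.
case: m m1 m2 mN mN' => // m m1 m2 mN mN'.
have H1 := IHN m.+1; have H2 := IHN m.
have HN : (5 <= N)%N by lia.
have B : 0 <= 'C(N.+1, m.+1)%:Z by [].
rewrite near_degS; have /H1 {}H1 : (1 < m.+1)%N by lia.
have /H2 {}H2 : (1 < m)%N by lia.
have {}H1 := H1 ltac:(lia); have {}H2 := H2 ltac:(lia).
have : N.+3%:Z * N.+1%:Z * (N.+1%:Z - 2) <= 2 * (N.+2%:Z * N%:Z * (N%:Z - 2)) by nia.
lia.
Qed.

Lemma near1 n N m : (m < N)%N -> (N < n)%N ->
  near n N.+1 m 1%g = (near_deg N.+1 m)%:~R.
Proof.
move=> mN Nn; rewrite !cfunE cfInd1 ?SN_sub // index_SN // !hook1 //=; try lia.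
rewrite /near_deg /= binS -addrA -opprD rmorphB rmorphM /= -!pmulrn.
by rewrite -natrD [(_ + _)%N]addnC.
Qed.

Lemma near_irr n N m : (0 < m)%N -> (m.+2 < N)%N -> (N <= n)%N ->
  near n N m \in irr (SN n N).
Proof.
case: N => [|[|N]] // m0 mN Nn; apply: irr_norm1.
- rewrite /near !rpredB ?hook_cf_vchar // cfInd_vchar ?hook_cf_vchar //.
- by rewrite near_dot //; [rewrite eqxx /= (_ : (0 < m < N)%N) //|..]; lia.
rewrite near1 //; last by lia.
rewrite ltr0z; have := @near_deg_ge N m; nia.
Qed.

(** For these [m] the induced hook is a single row or column, which has no inner corner to fill. *)
Lemma near_vanish n N m : (0 < N)%N -> (N.+1 < n)%N -> (m == 0)%N || (m == N) ->
  near n N.+2 m = 0.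
Proof.
move=> N0 Nn mE; apply/eqP; rewrite -cfnorm_eq0 near_dot //; try lia.
by case/orP: mE => /eqP->; rewrite ?ltnn ?andbF.
Qed.

Lemma Ind_hookE n N m :
  'Ind[SN n N.+1] (hook n N m) = near n N.+1 m + hook n N.+1 m + hook n N.+1 m.+1.
Proof. by rewrite /near addrAC !subrK. Qed.

(** As the hook extends, inducing multiplies it by the permutation character, whose value is the
    number [N.+1 - k] of fixed points. *)
Lemma Ind_hook_cyc n N k m : (1 < k <= N)%N -> (N < n)%N ->
  'Ind[SN n N.+1] (hook n N m) (cyc n k) = (N.+1 - k)%:R * hook n N m (cyc n k).
Proof.
move=> /andP[k1 kN] Nn; have sub := SN_sub n (leqnSn N).
rewrite (hook_Res m Nn) -['Res _]mul1r cfIndM // Ind_cfun1_SN //; last by lia.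
rewrite cfunE mul1r [X in _ = _ * X]cfResE // ?cyc_SN //; last by lia.
congr (_ * _); have -> : N.+1 = (k + (N.+1 - k))%N by lia.
rewrite ecf_cyc ?bin1 ?[(k <= 1)%N]leqNgt ?k1 ?addr0 ?addKn //; lia.
Qed.

(** * Characters that do not vanish at the two longest cycles *)

(** Commuting with the cycle propagates the image of 0 to the whole support. At most one further
    point below [N] remains, and injectivity decides it. *)
Lemma fix_cyc_cent n k N (g h : 'S_n) (i0 : 'I_n) :
  (N <= k.+1)%N -> (k <= N)%N -> (N <= n)%N -> i0 = 0%N :> nat -> (0 < k)%N ->
  g \in 'C_(SN n N)[cyc n k] -> h \in 'C_(SN n N)[cyc n k] -> g i0 = h i0 -> g = h.
Proof.
move=> Nk kN Nn i00 k0 /setIP[gN /cent1P gC] /setIP[hN /cent1P hC] E.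
have eq_low (i : 'I_n) : (i < k)%N -> g i = h i.
  case: i => i; elim: i => [|i IHi] /= ltin ik.
    by rewrite (_ : Ordinal ltin = i0) //; apply: val_inj; rewrite /= i00.
  have lt' : (i < n)%N by lia.
  have -> : Ordinal ltin = cyc n k (Ordinal lt').
    by apply: val_inj; rewrite /= cycE /= ?ik //; lia.
  by rewrite -!permM -gC -hC !permM IHi //=; lia.
have eq_high (i : 'I_n) : (N <= i)%N -> g i = h i.
  move=> Ni; move: gN hN; rewrite !inE => gN hN.
  by rewrite !(@out_perm _ (low n N)) // inE -leqNgt.
apply/permP=> i; have [ik|ki] := ltnP i k; first exact: eq_low.
have [Ni|iN] := leqP N i; first exact: eq_high.
have ne (j : 'I_n) : j != i -> g j = h j.
  move=> ji; have [|kj] := ltnP j k; first exact: eq_low.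
  apply: eq_high; have : (j != i :> nat) by []. lia.
apply/eqP; apply: contraT => gh.
have : (h^-1)%g (g i) != i by rewrite (can2_eq (permKV h) (permK h)) || rewrite -(inj_eq (@perm_inj _ h)) permKV.
move/ne; rewrite permKV => /perm_inj Eh.
by case/negP: gh; apply/eqP; rewrite -{2}Eh permKV.
Qed.

(** The image of 0 determines the permutation and has to lie below [k]. *)
Lemma card_cent_cyc n k N : (N <= k.+1)%N -> (k <= N)%N -> (N <= n)%N -> (0 < k)%N ->
  (1 < k)%N || (N == k) -> (#|'C_(SN n N)[cyc n k]| <= k)%N.
Proof.
move=> Nk kN Nn k0 k1; have n0 : (0 < n)%N by lia.
have kn : (k <= n)%N by lia.
pose i0 := Ordinal n0; rewrite -{2}(card_low kn).
have inj : {in 'C_(SN n N)[cyc n k] &, injective (fun g : 'S_n => g i0)}.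
  by move=> g h gC hC /= E; apply: (fix_cyc_cent Nk kN Nn _ k0 gC hC E).
rewrite -(card_in_imset inj); apply: subset_leq_card; apply/subsetP=> y /imsetP[g].
case/setIP=> gN /cent1P gC ->; have gi0N : (g i0 < N)%N.
  have : g i0 \in low n N by move: gN; rewrite inE => /perm_closed->; rewrite inE /=; lia.
  by rewrite inE.
rewrite inE; case/orP: k1 => [k1|/eqP Ek]; last by rewrite -Ek.
rewrite ltn_neqAle -ltnS (leq_trans gi0N Nk) andbT; apply: contraTneq isT => gk.
have : cyc n k (g i0) = g i0.
  by apply: val_inj; rewrite /= cycE // gk; do !case: ifP; lia.
rewrite -permM gC permM => /perm_inj/(congr1 val) /=.
by rewrite cycE //= k1.
Qed.

(** Column orthogonality: the squared absolute values at [x] add up to the order of the centraliser,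
    and the characters in [s] already exhaust it. *)
Lemma irr_support (gT : finGroupType) (G : {group gT}) (x : gT) (s : seq 'CF(G)) :
  x \in G -> uniq s -> {subset s <= irr G} -> (#|'C_G[x]| <= size s)%N ->
  (forall phi, phi \in s -> `|phi x| = 1) ->
  forall i : Iirr G, 'chi_i x != 0 -> 'chi_i \in s.
Proof.
move=> Gx us sirr sz s1 i; apply: contraNT => nis.
have := second_orthogonality_relation x Gx; rewrite class_refl mulr1n => E.
have {}E : \sum_(j : Iirr G) `|'chi_j x| ^+ 2 = #|'C_G[x]|%:R.
  by rewrite -E; apply: eq_bigr => j _; rewrite normCK.
have Es : \sum_(j : Iirr G | 'chi_j \in s) `|'chi_j x| ^+ 2 = (size s)%:R.
  rewrite -(size_map (@cfIirr _ G)); set t := map _ _.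
  have ut : uniq t.
    rewrite map_inj_in_uniq // => a b /sirr/irrP[j ->] /sirr/irrP[j' ->].
    by rewrite !irrK => ->.
  have Et j : ('chi_j \in s) = (j \in t).
    apply/idP/mapP=> [js|[phi ps ->]]; first by exists 'chi_j; rewrite ?irrK.
    by rewrite cfIirrE // sirr.
  rewrite (eq_bigl _ _ Et) -big_uniq //= (eq_big_seq (fun=> 1)).
    by rewrite big_const_seq count_predT iter_addr_0.
  by move=> j; rewrite -Et => /s1->; rewrite expr1n.
move: E; rewrite (bigID (fun j => 'chi_j \in s)) /= Es (bigD1 i) //= => E.
have r0 : 0 <= \sum_(j | ('chi_j \notin s) && (j != i)) `|'chi_j x| ^+ 2.
  by apply: sumr_ge0 => j _; rewrite exprn_ge0.
have : `|'chi_i x| ^+ 2 <= 0.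
  have : (size s)%:R + `|'chi_i x| ^+ 2 <= (size s)%:R :> algC.
    apply: (le_trans _ (_ : #|'C_G[x]|%:R <= _)); last by rewrite ler_nat.
    by rewrite -E lerD2l lerDl.
  by rewrite gerDl.
by move=> le0; rewrite -normr_eq0 -sqrf_eq0 eq_le le0 exprn_ge0.
Qed.

Lemma irr_long_cyc n N (i : Iirr (SN n N)) : (0 < N <= n)%N ->
  'chi_i (cyc n N) != 0 -> exists2 m, (m < N)%N & 'chi_i = hook n N m.
Proof.
move=> /andP[N0 Nn] nz; pose s := [seq hook n N m | m <- iota 0 N].
suff : 'chi_i \in s.
  by case/mapP=> m; rewrite mem_iota => /andP[_ mN] ->; exists m.
apply: irr_support nz; rewrite ?cyc_SN //.
- rewrite map_inj_in_uniq ?iota_uniq // => a b; rewrite !mem_iota add0n /= => aN bN E.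
  apply/eqP; have := hook_dot aN bN Nn; rewrite E hook_dot // eqxx.
  by case: eqP => // _ /eqP; rewrite oner_eq0.
- by move=> _ /mapP[m + ->]; rewrite mem_iota => mN; rewrite hook_irr //; lia.
- by rewrite size_map size_iota card_cent_cyc // ?eqxx ?orbT.
move=> _ /mapP[m + ->]; rewrite mem_iota => mN; rewrite hook_long_cyc ?normr_sign ?normrX ?normrN1 ?expr1n //; lia.
Qed.

Lemma near_cyc_pred n N m : (0 < m)%N -> (m.+2 < N)%N -> (N <= n)%N ->
  near n N m (cyc n N.-1) = (-1) ^+ m.
Proof.
case: N => // k m0 mN Nn /=; rewrite /near /= !cfunE Ind_hook_cyc //; last by lia.
rewrite subSnn mul1r hook_long_cyc; last by lia.
have H j : (0 < j < k)%N -> hook n k.+1 j (cyc n k) = 0.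
  move=> /andP[j0 jk]; have := @hook_cyc n k 0 j; rewrite addn0 => ->; try lia.
  by rewrite bin0n (gtn_eqF j0) leqNgt jk addr0.
by rewrite !H ?subr0 //; lia.
Qed.

Lemma irr_pred_cyc n N (i : Iirr (SN n N)) : (3 < N <= n)%N ->
  'chi_i (cyc n N.-1) != 0 ->
  ('chi_i = hook n N 0 \/ 'chi_i = hook n N N.-1) \/
  exists2 m, (0 < m)%N && (m.+2 < N)%N & 'chi_i = near n N m.
Proof.
case: N i => [|[|N]] // i /andP[N0 Nn] nz /=.
(* These are [N.+1] characters, as many as the centraliser of an (N+1)-cycle can have elements. *)
pose s := [:: hook n N.+2 0, hook n N.+2 N.+1 & [seq near n N.+2 m | m <- iota 1 N.-1]].
suff : 'chi_i \in s.
  rewrite !inE => /or3P[/eqP->|/eqP->|]; [by left; left | by left; right|].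
  by case/mapP=> m; rewrite mem_iota => mN ->; right; exists m => //; lia.
apply: irr_support nz; rewrite ?cyc_SN //; try lia.
- have hh : hook n N.+2 0 != hook n N.+2 N.+1.
    apply/eqP=> E; have := @hook_dot n N.+2 0 N.+1 isT (leqnn _) Nn.
    by rewrite -E hook_dot // => /eqP; rewrite oner_eq0.
  have hn j : (j <= N.+1)%N -> hook n N.+2 j \notin [seq near n N.+2 m | m <- iota 1 N.-1].
    move=> jN; apply/mapP=> -[m]; rewrite mem_iota => mN E.
    have := @near_dot_hook n N.+1 m j; rewrite -E hook_dot // eqxx.
    by move=> /(_ ltac:(lia) jN Nn)/eqP; rewrite oner_eq0.
  rewrite /= inE negb_or hh !hn //=.
  rewrite map_inj_in_uniq ?iota_uniq // => a b; rewrite !mem_iota => aN bN E.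
  apply/eqP; have := @near_dot n N a b; rewrite E near_dot ?eqxx //=; try lia.
  move=> /(_ ltac:(lia) Nn ltac:(lia) ltac:(lia)); case: eqP => // _.
  by rewrite (_ : (0 < b < N)%N) //=; [move/eqP; rewrite oner_eq0|lia].
- move=> phi; rewrite !inE => /or3P[/eqP->|/eqP->|]; rewrite ?hook_irr //; try lia.
  by case/mapP=> m; rewrite mem_iota => mN ->; rewrite near_irr //; lia.
- by apply: leq_trans (@card_cent_cyc n N.+1 N.+2 _ _ _ _ _) _; rewrite /= ?size_map ?size_iota; lia.
move=> phi; rewrite !inE => /or3P[/eqP->|/eqP->|].
- by rewrite hook0 cfun1E cyc_SN ?normr1 //; lia.
- have := @hook_cyc n N.+1 0 N.+1 isT; rewrite addn0 => -> //; rewrite bin0n add0r leqnn subnn bin0 normr_sign //.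
case/mapP=> m; rewrite mem_iota => mN ->; rewrite near_cyc_pred ?normr_sign //; lia.
Qed.

(** Restrict to the symmetric group on the [k] points of the cycle, whose irreducible characters
    take the values 0 and signs there. *)
Lemma char_cyc_int n N k (phi : 'CF(SN n N)) : (0 < k)%N -> (k <= N)%N -> (N <= n)%N ->
  phi \is a character -> phi (cyc n k) \in Num.int.
Proof.
move=> k0 kN Nn Nphi; have kn : (k <= n)%N by lia.
rewrite -(cfResE phi (SN_sub n kN)) ?cyc_SN //.
have /char_sum_irr[r ->] := cfRes_char (SN n k) Nphi.
rewrite sum_cfunE rpred_sum // => i _; have [->|nz] := eqVneq ('chi_i (cyc n k)) 0.
  exact: rpred0.
have [|m mk ->] := @irr_long_cyc n k i _ nz; first by rewrite k0.
by rewrite hook_long_cyc ?mk // rpredX ?rpredN1.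
Qed.

(** * Rational character values at cycles *)

(** The values are integers, so the floor loses nothing, and working in [rat] opens them to
    arithmetic tactics. At [k = 1] this is the degree, as [cyc n 1] is the identity. *)
HB.lock Definition zv (n N : nat) (phi : 'CF(SN n N)) (k : nat) : rat :=
  (Num.floor (phi (cyc n k)))%:~R.

Lemma ratr_zv n N k (phi : 'CF(SN n N)) : (0 < k)%N -> (k <= N)%N -> (N <= n)%N ->
  phi \is a character -> ratr (zv phi k) = phi (cyc n k).
Proof.
move=> k0 kN Nn Nphi; have /intrP[z Ez] := char_cyc_int k0 kN Nn Nphi.
by rewrite zv.unlock Ez intrKfloor ratr_int.
Qed.

Lemma zv_eq n N k (phi : 'CF(SN n N)) (q : rat) :
  (0 < k)%N -> (k <= N)%N -> (N <= n)%N ->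
  phi \in irr (SN n N) -> phi (cyc n k) = ratr q -> zv phi k = q.
Proof.
move=> k0 kN Nn /irrP[i ->]; rewrite -ratr_zv ?irr_char //; exact: fmorph_inj.
Qed.

(** The value at a k-cycle of the m-th exterior power of the permutation module on k+f points, hence
    of the hook [hook n (k + f).+1 m]. *)
Definition hv (k f m : nat) : rat :=
  'C(f, m)%:R + (-1) ^+ k.-1 * ((k <= m) * 'C(f, m - k))%N%:R.

Lemma ratr_hv k f m : ratr (hv k f m) =
  'C(f, m)%:R + (-1) ^+ k.-1 *+ ((k <= m) * 'C(f, m - k))%N :> algC.
Proof. by rewrite /hv rmorphD rmorphM rmorphXn rmorphN1 !rmorph_nat mulr_natr. Qed.

Lemma zv_hook n k f m : (0 < k)%N -> (m <= k + f)%N -> (k + f < n)%N ->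
  zv (hook n (k + f).+1 m) k = hv k f m.
Proof.
move=> k0 mN Nn; apply: zv_eq => //; [lia|by apply: hook_irr; lia|].
by rewrite hook_cyc // ratr_hv.
Qed.

Lemma zv_hook_long n N m : (m < N <= n)%N -> zv (hook n N m) N = (-1) ^+ m.
Proof.
move=> mN; apply: zv_eq; try lia; first by apply: hook_irr.
by rewrite hook_long_cyc // rmorphXn rmorphN1.
Qed.

Lemma zv_near n k f m : (1 < k)%N -> (0 < m < k + f)%N -> (k + f.+1 < n)%N ->
  zv (near n (k + f).+2 m) k = f.+2%:R * hv k f m - hv k f.+1 m - hv k f.+1 m.+1.
Proof.
move=> k1 mN Nn; apply: zv_eq; try lia; first by apply: near_irr; lia.
rewrite /near !cfunE Ind_hook_cyc //; try lia.
have -> : ((k + f).+2 - k)%N = f.+2 by lia.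
rewrite hook_cyc ?(ltnW k1) //; last by lia.
rewrite -[(k + f).+2]/((k + f).+1).+1 -(addnS k f) !hook_cyc ?(ltnW k1) //.
by rewrite -!ratr_hv !rmorphB rmorphM rmorph_nat.
Qed.

Lemma zv_near_pred n N m : (0 < m)%N -> (m.+2 < N)%N -> (N <= n)%N ->
  zv (near n N m) N.-1 = (-1) ^+ m.
Proof.
move=> m0 mN Nn; apply: zv_eq; try lia; first by apply: near_irr.
by rewrite near_cyc_pred // rmorphXn rmorphN1.
Qed.

Lemma zv_near1 n N m : (0 < m)%N -> (m.+2 < N)%N -> (N <= n)%N ->
  zv (near n N m) 1 = (near_deg N m)%:~R.
Proof.
case: N => // N m0 mN Nn; apply: zv_eq; try lia; first by apply: near_irr.
by rewrite cyc1 near1 //; [rewrite ratr_int|lia].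
Qed.

Lemma zv_hook1 n N m : (m < N <= n)%N -> zv (hook n N m) 1 = 'C(N.-1, m)%:R.
Proof.
move=> mN; apply: zv_eq; try lia; first by apply: hook_irr.
by rewrite cyc1 hook1 // rmorph_nat.
Qed.

Lemma bin2R (f : nat) : 'C(f, 2)%:R = f%:R * (f%:R - 1) / 2 :> rat.
Proof.
elim: f => [|f IHf]; first by rewrite bin0n !mul0r.
by rewrite binS bin1 natrD IHf -[f.+1%:R]natr1; lra.
Qed.

(* N = k + F throughout: F is the number of fixed points of [cyc n k] in [low n N]. *)
Lemma zv_hook_std n k F : (1 < k)%N -> (0 < F)%N -> (k + F <= n)%N ->
  zv (hook n (k + F) 1) k = F%:R - 1 /\
  zv (hook n (k + F) (k + F - 2)) k = (-1) ^+ k.-1 * (F%:R - 1).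
Proof.
case: F => // f k1 _; rewrite addnS => Nn; rewrite !zv_hook //; try lia.
rewrite /hv bin1 [(k <= 1)%N]leqNgt k1 /= mulr0 addr0 -natr1 addrK; split=> //.
rewrite bin_small ?add0r; last by lia.
congr (_ * _); case: f {Nn} => [|f]; first by rewrite leqNgt (_ : (_ < _)%N) //; lia.
rewrite (_ : (k <= _)%N) ?mul1n; last by lia.
by rewrite (_ : ((k + f.+1).+1 - 2 - k)%N = f) ?binSn //; lia.
Qed.

Lemma zv_hook_sgn n k F : (0 < k)%N -> (k + F <= n)%N ->
  zv (hook n (k + F) (k + F).-1) k = (-1) ^+ k.-1.
Proof.
case: F => [|f] k0 Nn.
  by rewrite addn0 in Nn *; rewrite zv_hook_long //; lia.
rewrite addnS in Nn *; rewrite zv_hook //= /hv.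
by rewrite bin_small ?add0r ?leq_addr ?addKn ?binn ?mulr1 //; lia.
Qed.

Lemma zv_hook2 n k F : (1 < k)%N -> (0 < F)%N -> (2 < k + F <= n)%N ->
  zv (hook n (k + F) 2) k = (F%:R - 1) * (F%:R - 2) / 2 - (k == 2)%:R /\
  zv (hook n (k + F) (k + F - 3)) k = (-1) ^+ k.-1 * ((F%:R - 1) * (F%:R - 2) / 2 - (k == 2)%:R).
Proof.
case: F => // f k1 _; rewrite addnS => /andP[N2 Nn]; rewrite !zv_hook //; try lia.
have E : 'C(f, 2)%:R = (f.+1%:R - 1) * (f.+1%:R - 2) / 2 :> rat.
  by rewrite bin2R -natr1; lra.
rewrite /hv E; split.
  have [->|k2] := eqVneq k 2; first by rewrite subnn bin0 /= expr1; lra.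
  have -> : (k <= 2)%N = false by lia.
  by rewrite mul0n mulr0 -[false%:R]/(0 : rat); lra.
have -> : ((k <= (k + f).+1 - 3) * 'C(f, (k + f).+1 - 3 - k))%N = 'C(f, 2).
  case: f {Nn E N2} => [|[|f]]; try by rewrite leqNgt (_ : (_ < k)%N) //; lia.
  rewrite (_ : (k <= _)%N) ?mul1n; last by lia.
  rewrite (_ : ((k + f.+2).+1 - 3 - k)%N = f); last by lia.
  by rewrite -[RHS]bin_sub // !subSS subn0.
rewrite E; have [->|k2] := eqVneq k 2.
  rewrite (_ : (2 + f).+1 - 3 = f)%N; last by lia.
  by rewrite binn /= expr1; lra.
by rewrite bin_small ?add0r ?subr0 //; lia.
Qed.

(** The general formula [zv_near] covers two or more fixed points; with a single one the value at an
    (N-1)-cycle is used. *)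
Lemma zv_near_ends n k F : (1 < k)%N -> (0 < F)%N -> (3 < k + F <= n)%N ->
  zv (near n (k + F) 1) k = F%:R * (F%:R - 3) / 2 + (k == 2)%:R /\
  zv (near n (k + F) (k + F - 3)) k = (-1) ^+ k.-1 * (F%:R * (F%:R - 3) / 2 + (k == 2)%:R).
Proof.
case: F => [//|[|f]] k1 _ /andP[N3 Nn].
  have -> : (k == 2) = false by lia.
  have H m : (0 < m)%N -> (m.+1 < k)%N -> zv (near n (k + 1) m) k = (-1) ^+ m.
    by move=> m0 mk; rewrite addn1 in Nn *; exact: (@zv_near_pred n k.+1 m).
  rewrite -[false%:R]/(0 : rat) !H; try lia.
  rewrite expr1; split; first lra.
  have -> : k.-1 = (k + 1 - 3).+1 by lia.
  rewrite exprS; lra.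
rewrite !addnS !zv_near //; try lia.
have E : 'C(f.+1, 2)%:R = (f.+2%:R - 1) * (f.+2%:R - 2) / 2 :> rat.
  by rewrite bin2R -[f.+2%:R]natr1; lra.
rewrite /hv !bin1 E -[f.+2%:R]natr1 -[f.+1%:R]natr1; split.
  rewrite [(k <= 1)%N]leqNgt k1 /=; have [->|k2] := eqVneq k 2.
    by rewrite subnn bin0 /= expr1; lra.
  have -> : (k <= 2)%N = false by lia.
  by rewrite mul0n mulr0 -[false%:R]/(0 : rat); lra.
have -> : ((k + f).+2 - 3 = k + f - 1)%N by lia.
have -> : ((k <= k + f - 1) * 'C(f, k + f - 1 - k))%N = f.
  case: f {Nn N3 E} => [|f]; first by rewrite leqNgt (_ : (_ < k)%N) //; lia.
  rewrite (_ : (k <= _)%N) ?mul1n; last by lia.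
  by rewrite (_ : (k + f.+1 - 1 - k)%N = f) ?binSn //; lia.
have -> : ((k <= k + f - 1) * 'C(f.+1, k + f - 1 - k))%N = 'C(f.+1, 2).
  case: f {Nn N3 E} => [|f]; first by rewrite leqNgt (_ : (_ < k)%N) //; lia.
  rewrite (_ : (k <= _)%N) ?mul1n; last by lia.
  rewrite (_ : (k + f.+1 - 1 - k)%N = f); last by lia.
  by rewrite -[RHS]bin_sub // !subSS subn0.
have -> : ((k + f - 1).+1 = k + f)%N by lia.
rewrite leq_addr mul1n addKn binSn E -[f.+2%:R]natr1 -[f.+1%:R]natr1.
rewrite [X in X%:R + (-1) ^+ _ * f%:R]bin_small; last by lia.
rewrite ['C(f.+1, k + f)]bin_small; last by lia.
have [->|k2] := eqVneq k 2.
  by rewrite (_ : (2 + f - 1)%N = f.+1) ?binn /= ?expr1; [lra|lia].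
rewrite bin_small; last by lia.
rewrite -[false%:R]/(0 : rat); lra.
Qed.

Lemma zv1_gt0 n N (phi : 'CF(SN n N)) : (0 < N <= n)%N -> phi \in irr (SN n N) ->
  0 < zv phi 1.
Proof.
move=> Nn /irrP[i ->]; rewrite -(ltr0q algC) ratr_zv ?irr_char ?cyc1 ?irr1_gt0 //; lia.
Qed.

(** * Transfer of inequalities by restriction; inner and deep characters *)

Definition lin (n N : nat) (s : seq nat) (w : nat -> rat) (phi : 'CF(SN n N)) : rat :=
  \sum_(k <- s) w k * zv phi k.

(** On S_M the character is a nonnegative combination of the constituents of its restriction, so a
    linear inequality true for all of them is inherited, strictly as soon as one of them is
    strict. *)
Lemma lin_le0 n N M (s : seq nat) (w : nat -> rat) (phi : 'CF(SN n N)) :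
  (M <= N)%N -> (N <= n)%N -> phi \is a character ->
  {in s, forall k, (0 < k <= M)%N} ->
  (forall i : Iirr (SN n M), '['Res[SN n M] phi, 'chi_i] != 0 -> lin s w 'chi_i <= 0) ->
  lin s w phi <= 0 /\
  ((exists2 i : Iirr (SN n M), '['Res[SN n M] phi, 'chi_i] != 0 & lin s w 'chi_i < 0) ->
   lin s w phi < 0).
Proof.
move=> MN Nn Nphi sM H; have Nr := cfRes_char (SN n M) Nphi.
pose c i : rat := (Num.truncn '['Res[SN n M] phi, 'chi_i])%:R.
have cE i : ratr (c i) = '['Res[SN n M] phi, 'chi_i].
  by rewrite ratr_nat truncnK // Cnat_cfdot_char_irr.
have c0 i : 0 <= c i by exact: ler0n.
have cnz i : (c i != 0) = ('['Res[SN n M] phi, 'chi_i] != 0).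
  by rewrite -(fmorph_eq0 (@ratr algC)) /= cE.
have E : lin s w phi = \sum_i c i * lin s w 'chi_i.
  rewrite /lin; under [RHS]eq_bigr do rewrite mulr_sumr.
  rewrite exchange_big /=; apply: eq_big_seq => k ks; have /andP[k0 kM] := sM k ks.
  under eq_bigr do rewrite mulrCA.
  rewrite -mulr_sumr; congr (_ * _).
  apply: (fmorph_inj (@ratr algC)); rewrite /= ratr_zv ?(leq_trans kM) //.
  rewrite -(cfResE phi (SN_sub n MN)); last by rewrite cyc_SN //; lia.
  rewrite {1}['Res phi]cfun_sum_cfdot sum_cfunE rmorph_sum /=; apply: eq_bigr => i _ /=.
  by rewrite cfunE rmorphM /= cE ratr_zv ?irr_char //; lia.
have le0 i : c i * lin s w 'chi_i <= 0.
  have [->|] := eqVneq (c i) 0; first by rewrite mul0r.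
  by rewrite cnz => /H; exact: mulr_ge0_le0.
rewrite E; split; first by apply: sumr_le0.
case=> i; rewrite -cnz => ci li; rewrite (bigD1 i) //=.
rewrite -[X in _ < X]addr0.
apply: ltr_leD; last by apply: sumr_le0.
by rewrite pmulr_rlt0 // lt_def ci c0.
Qed.

(** The shapes (N), (N-1,1), (2,1^(N-2)) and (1^N). *)
Definition lev1 n N : seq 'CF(SN n N) :=
  [:: hook n N 0; hook n N 1; hook n N (N - 2); hook n N (N - 1)].
(** The shapes (N-2,1,1) and (N-2,2) and their conjugates (3,1^(N-3)) and (2,2,1^(N-4)). *)
Definition lev2 n N : seq 'CF(SN n N) :=
  [:: hook n N 2; near n N 1; hook n N (N - 3); near n N (N - 3)].
Definition inner n N (phi : 'CF(SN n N)) := (phi \in irr (SN n N)) && (phi \notin lev1 n N).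
Definition deep n N (phi : 'CF(SN n N)) := inner phi && (phi \notin lev2 n N).

Lemma irr_neq_dot0 (gT : finGroupType) (G : {group gT}) (phi psi : 'CF(G)) :
  phi \in irr G -> psi \in irr G -> phi != psi -> '[phi, psi] = 0.
Proof.
move=> /irrP[i ->] /irrP[j ->] ij; rewrite cfdot_irr.
by have [E|//] := eqVneq i j; rewrite E eqxx in ij.
Qed.

Lemma dot_Ind_hook n N m (phi : 'CF(SN n N.+1)) :
  '[phi, 'Ind[SN n N.+1] (hook n N m)] =
  '[phi, near n N.+1 m] + '[phi, hook n N.+1 m] + '[phi, hook n N.+1 m.+1].
Proof. by rewrite Ind_hookE -!cfdotDr. Qed.

(** Frobenius reciprocity: inducing a member of [lev1] produces only members of [lev1] and [lev2],
    and a deep character is orthogonal to all of these. *)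
Lemma deep_Res_inner n N (phi : 'CF(SN n N.+1)) (i : Iirr (SN n N)) :
  (3 < N)%N -> (N < n)%N -> deep phi ->
  '['Res[SN n N] phi, 'chi_i] != 0 -> inner 'chi_i.
Proof.
case: N phi i => // N phi i N3 Nn.
have Ea : (N.+2 - 2 = N)%N by lia.
have Eb : (N.+2 - 1 = N.+1)%N by lia.
have Ec : (N.+2 - 3 = N.-1)%N by lia.
have Ed : (N.+1 - 2 = N.-1)%N by lia.
have Ee : (N.+1 - 1 = N)%N by lia.
have E1 : N.-1.+1 = N by lia.
have N0 : (0 < N)%N by lia.
have N1 : (1 < N)%N by lia.
have Np : (0 < N.-1 < N)%N by lia.
move=> /andP[/andP[irrphi l1] l2] nz.
rewrite /inner mem_irr /=; apply: contra nz; rewrite cfdot_Res_l.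
have hk m : (m <= N.+1)%N -> phi != hook n N.+2 m -> '[phi, hook n N.+2 m] = 0.
  by move=> mN; apply: irr_neq_dot0 => //; apply: hook_irr; lia.
have nr m : (0 < m < N)%N -> phi != near n N.+2 m -> '[phi, near n N.+2 m] = 0.
  by move=> mN; apply: irr_neq_dot0 => //; apply: near_irr; lia.
move: l1 l2; rewrite !inE !negb_or => /and4P[p0 p1 pa pb] /and4P[p2 q1 pc qc].
rewrite Ea in pa; rewrite Eb in pb; rewrite Ec in pc qc; rewrite Ed Ee.
have d0 := hk 0%N isT p0; have d1 := hk 1%N isT p1.
have d2 := hk 2%N (ltnW N1 : (1 < N.+1)%N) p2; have da := hk N (leqnSn N) pa.
have db := hk N.+1 (leqnn _) pb; have dc := hk N.-1 (leqW (leq_pred N)) pc.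
have e1 := nr 1%N N1 q1; have ec := nr N.-1 Np qc.
case/or4P=> /eqP->; rewrite dot_Ind_hook ?E1.
- by rewrite near_vanish ?cfdot0r ?d0 ?d1 ?addr0.
- by rewrite e1 d1 d2 !addr0.
- by rewrite ec dc da !addr0.
by rewrite near_vanish ?cfdot0r ?da ?db ?addr0 ?eqxx ?orbT.
Qed.

Lemma avg_le n N k (q : rat) (phi : 'CF(SN n N.+1)) :
  (1 < k <= N)%N -> (N < n)%N -> phi \is a character ->
  (forall i : Iirr (SN n N), '['Res[SN n N] phi, 'chi_i] != 0 ->
     zv 'chi_i k <= q * zv 'chi_i 1) ->
  zv phi k <= q * zv phi 1.
Proof.
move=> /andP[k1 kN] Nn Nphi H; pose w j : rat := if j == 1%N then - q else 1.
have linE M (psi : 'CF(SN n M)) : lin [:: k; 1%N] w psi = zv psi k - q * zv psi 1.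
  by rewrite /lin !big_cons big_nil /w (gtn_eqF k1) eqxx; ring.
have [] := @lin_le0 n N.+1 N [:: k; 1%N] w phi (leqnSn N) Nn Nphi.
- by move=> j; rewrite !inE => /orP[]/eqP->; rewrite ?kN ?(ltnW k1) //; lia.
- by move=> i /H; rewrite linE subr_le0.
by rewrite linE subr_le0.
Qed.

Lemma avg_norm n N k (q : rat) (phi : 'CF(SN n N.+1)) :
  (1 < k <= N)%N -> (N < n)%N -> phi \is a character ->
  (forall i : Iirr (SN n N), '['Res[SN n N] phi, 'chi_i] != 0 ->
     `|zv 'chi_i k| <= q * zv 'chi_i 1) ->
  `|zv phi k| <= q * zv phi 1.
Proof.
move=> /andP[k1 kN] Nn Nphi H; rewrite ler_norml; apply/andP; split; last first.
  apply: avg_le => //; first by rewrite k1.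
  by move=> i /H; rewrite ler_norml => /andP[].
pose w j : rat := if j == 1%N then - q else - 1.
have linE M (psi : 'CF(SN n M)) : lin [:: k; 1%N] w psi = - zv psi k - q * zv psi 1.
  by rewrite /lin !big_cons big_nil /w (gtn_eqF k1) eqxx; ring.
have [] := @lin_le0 n N.+1 N [:: k; 1%N] w phi (leqnSn N) Nn Nphi.
- by move=> j; rewrite !inE => /orP[]/eqP->; rewrite ?kN ?(ltnW k1) //; lia.
- by move=> i /H; rewrite linE ler_norml => /andP[+ _]; lra.
by rewrite linE; lra.
Qed.

Lemma inner_irr n N (psi : 'CF(SN n N)) : inner psi -> psi \in irr (SN n N).
Proof. by case/andP. Qed.

Lemma innerP n N (psi : 'CF(SN n N)) : inner psi ->
  [\/ deep psi, psi = hook n N 2 \/ psi = hook n N (N - 3) |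
      psi = near n N 1 \/ psi = near n N (N - 3)].
Proof.
move=> ip; case dp: (deep psi); first by constructor 1.
move: dp; rewrite /deep ip /= => /negbFE; rewrite !inE.
by case/or4P=> /eqP->; [constructor 2; left|constructor 3; left|constructor 2; right|constructor 3; right].
Qed.

Lemma zv_hook2_deg n N : (2 < N <= n)%N ->
  zv (hook n N 2) 1 = (N%:R - 1) * (N%:R - 2) / 2 /\
  zv (hook n N (N - 3)) 1 = (N%:R - 1) * (N%:R - 2) / 2.
Proof.
move=> N2; have E : 'C(N.-1, 2)%:R = (N%:R - 1) * (N%:R - 2) / 2 :> rat.
  by rewrite bin2R; case: N N2 => // N _; rewrite -[N.+1%:R]natr1; lra.
rewrite !zv_hook1 //; try lia; split=> //; rewrite -E; congr (_%:R).
by rewrite -(bin_sub (_ : 2 <= N.-1)%N); [congr 'C(_, _); lia|lia].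
Qed.

Lemma near_ends_deg N : (3 < N)%N ->
  2 * (near_deg N 1)%:~R = N%:R * (N%:R - 3) :> rat /\
  2 * (near_deg N (N - 3))%:~R = N%:R * (N%:R - 3) :> rat.
Proof.
case: N => [|[|N]] // N1; have E : 2 * (near_deg N.+2 1)%:~R = N.+2%:R * (N.+2%:R - 3) :> rat.
  have := near_deg1 N; move: (near_deg _ _) => d /(congr1 (fun z : int => z%:~R : rat)).
  rewrite !rmorphM rmorphB /= -!pmulrn => ->.
  by rewrite -[N.+2%:R]natr1 -[N.+1%:R]natr1; lra.
by split=> //; rewrite -E -(@near_deg_sym N 1) ?subSS //; lia.
Qed.

Lemma zv_near_ends_deg n N : (3 < N <= n)%N ->
  zv (near n N 1) 1 = N%:R * (N%:R - 3) / 2 /\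
  zv (near n N (N - 3)) 1 = N%:R * (N%:R - 3) / 2.
Proof.
move=> /andP[N3 Nn]; have [E1 E2] := near_ends_deg N3.
by rewrite !zv_near1 //; try lia; split; lra.
Qed.

Lemma zv_near_deg_ge n N m : (0 < m)%N -> (m.+2 < N)%N -> (N <= n)%N ->
  N%:R * (N%:R - 3) <= 2 * zv (near n N m) 1.
Proof.
move=> m0 mN Nn; rewrite (zv_near1 m0 mN Nn).
have [M EN] : exists M, N = M.+2 by exists N.-2; lia.
rewrite {}EN in mN *; move: M mN => {Nn}N mN.
have := @near_deg_ge N m m0 ltac:(lia); move: (near_deg _ _) => d; rewrite -(ler_int rat) !rmorphM rmorphB /= -!pmulrn.
by rewrite -[N.+2%:R]natr1 -[N.+1%:R]natr1; lra.
Qed.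

Lemma zv_near_mid_deg_ge n N m : (1 < m)%N -> (m.+3 < N)%N -> (N <= n)%N ->
  N%:R * (N%:R - 2) * (N%:R - 4) <= 3 * zv (near n N m) 1.
Proof.
move=> m0 mN Nn; rewrite (zv_near1 (ltnW m0) (ltnW mN) Nn).
have [M EN] : exists M, N = M.+2 by exists N.-2; lia.
rewrite {}EN in mN *; move: M mN => {Nn}N mN.
have := @near_deg_mid_ge N m m0 ltac:(lia); move: (near_deg _ _) => d; rewrite -(ler_int rat) !rmorphM rmorphB /= -!pmulrn.
by rewrite -[N.+2%:R]natr1 -[N.+1%:R]natr1; lra.
Qed.

(** * Bounds for inner characters at short cycles *)

Lemma inner_pred_cycP n N (psi : 'CF(SN n N)) : (3 < N <= n)%N -> inner psi ->
  zv psi N.-1 != 0 -> exists2 m, (0 < m)%N && (m.+2 < N)%N & psi = near n N m.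
Proof.
move=> Nn /andP[/irrP[i ->] l1] nz; have nz' : 'chi_i (cyc n N.-1) != 0.
  by rewrite -ratr_zv ?irr_char ?fmorph_eq0 //; lia.
have [H|//] := irr_pred_cyc Nn nz'; exfalso; move: H l1; rewrite !inE !negb_or subn1 => H /and4P[/eqP p0 _ _ /eqP p1].
by case: H.
Qed.

(** At an (N-1)-cycle an inner character either vanishes or is a near hook, with a sign as value and
    degree at least N(N-3)/2. *)
Lemma inner_pred_cyc n N (psi : 'CF(SN n N)) : (3 < N <= n)%N -> inner psi ->
  `|zv psi N.-1| * (N%:R * (N%:R - 3)) <= 2 * zv psi 1.
Proof.
move=> Nn ip; have [->|nz] := eqVneq (zv psi N.-1) 0.
  rewrite normr0 mul0r mulr_ge0 // ltW // zv1_gt0 ?inner_irr //; lia.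
have [m /andP[m0 mN] ->] := inner_pred_cycP Nn ip nz.
rewrite zv_near_pred //; last by lia.
by rewrite normrX normrN1 expr1n mul1r zv_near_deg_ge //; lia.
Qed.

Lemma deep_irr n N (psi : 'CF(SN n N)) : deep psi -> psi \in irr (SN n N).
Proof. by case/andP=> /inner_irr. Qed.

Lemma irr_is_char (gT : finGroupType) (G : {group gT}) (psi : 'CF(G)) :
  psi \in irr G -> psi \is a character.
Proof. by case/irrP=> i ->; exact: irr_char. Qed.

Lemma deep_char n N (psi : 'CF(SN n N)) : deep psi -> psi \is a character.
Proof. by move/deep_irr/irr_is_char. Qed.

Lemma natr_ge (a b : nat) : (a <= b)%N -> a%:R <= b%:R :> rat.
Proof. by rewrite ler_nat. Qed.

Lemma deep_cyc2 n k (q : rat) (phi : 'CF(SN n k.+2)) : (2 < k)%N -> (k.+2 <= n)%N ->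
  2 <= q * ((k%:R + 1) * (k%:R - 2)) -> deep phi -> `|zv phi k| <= q * zv phi 1.
Proof.
move=> k2 kn qk dphi; apply: avg_norm; [lia|lia|exact: deep_char|] => i nz.
have ip : inner 'chi_i by apply: deep_Res_inner dphi nz; lia.
have := @inner_pred_cyc n k.+1 'chi_i ltac:(lia) ip.
have z0 : 0 < zv 'chi_i 1 by apply: zv1_gt0; rewrite ?mem_irr //; lia.
have kR := natr_ge k2; rewrite /= -natr1 => H.
have : `|zv 'chi_i k| * ((k%:R + 1) * (k%:R - 2)) <= q * zv 'chi_i 1 * ((k%:R + 1) * (k%:R - 2)) by nra.
by rewrite ler_pM2r //; nra.
Qed.

(** Induction on the number [F] of fixed points: deep characters inherit the bound from one point
    less, the four others are explicit. The first condition on [q] is [inner_pred_cyc] for S_(k+1),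
    the second the normalised value of (N-2,1,1). *)
Lemma inner_bound n k F (q : rat) (psi : 'CF(SN n (k + F))) :
  (3 < k)%N -> (1 < F)%N -> (k + F <= n)%N ->
  2 <= q * ((k%:R + 1) * (k%:R - 2)) ->
  (F%:R - 1) * (F%:R - 2) <= q * (((k + F)%:R - 1) * ((k + F)%:R - 2)) ->
  inner psi -> `|zv psi k| <= q * zv psi 1.
Proof.
move=> k3; have kR := natr_ge k3; elim: F q psi => // F IHF q psi F1 kF.
have kFn : (k + F <= n)%N by lia.
have kFn' : (k + F < n)%N by lia.
have kF3 : (3 < k + F)%N by lia.
have kkF : (1 < k <= k + F)%N by lia.
have k2n : (2 < k + F.+1 <= n)%N by lia.
have k3n : (3 < k + F.+1 <= n)%N by lia.
have kn2 : (k == 2) = false by lia.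
have k1 : (1 < k)%N by lia.
have F1c : (F <= 1)%N -> F = 1%N by lia.
move=> qk qF ip.
have FR := natr_ge F1.
have Kp : 0 < (k%:R + 1) * (k%:R - 2) :> rat by nra.
have q0 : 0 <= q by rewrite -(pmulr_lge0 _ Kp); lra.
case: (innerP ip) => [dp|h2|x1].
- have [F1'|F1'] := ltnP 1%N F; last first.
    move: psi ip dp kF; rewrite (F1c F1') addn2 => psi ip dp kF.
    by apply: deep_cyc2; rewrite // ltnW.
  move: psi ip dp; rewrite addnS => psi ip dp.
  apply: (avg_norm kkF kFn' (deep_char dp)) => i nz.
  apply: (IHF _ _ F1' kFn qk); last exact: deep_Res_inner kF3 kFn' dp nz.
  have F1R := natr_ge F1'; move: qF; rewrite addnS -!natr1 natrD.
  set f := F%:R in F1R *; set K := k%:R in kR *.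
  move=> qF; have K0 : 0 < (K + f + 1 - 1) * (K + f + 1 - 2) by nra.
  (* The normalised value of (N-2,1,1) grows with the number of fixed points, so the second
     condition on [q] passes from F+1 down to F. *)
  have : ((f - 1) * (f - 2)) * ((K + f + 1 - 1) * (K + f + 1 - 2)) <= (q * ((K + f - 1) * (K + f - 2))) * ((K + f + 1 - 1) * (K + f + 1 - 2)).
    have A : (f - 2) * (K + f) <= f * (K + f - 2) by nra.
    have B : 0 <= (f - 1) * (K + f - 1) by nra.
    have C : 0 <= (K + f - 1) * (K + f - 2) by nra.
    have D : f * (f - 1) <= q * ((K + f) * (K + f - 1)) by lra.
    nra.
  by rewrite ler_pM2r.
- have [E1 E2] := zv_hook2 k1 (ltnW F1) k2n; have [D1 D2] := zv_hook2_deg k2n.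
  have A : 0 <= (F.+1%:R - 1) * (F.+1%:R - 2) :> rat by nra.
  have key : `|(F.+1%:R - 1) * (F.+1%:R - 2) / 2 - false%:R| <=
      q * (((k + F.+1)%:R - 1) * ((k + F.+1)%:R - 2) / 2).
    by rewrite -[false%:R]/(0 : rat) subr0 ger0_norm; lra.
  by case: h2 => ->; rewrite ?E1 ?E2 ?D1 ?D2 kn2 ?normrM ?normrX ?normrN1 ?expr1n ?mul1r.
have [E1 E2] := zv_near_ends k1 (ltnW F1) k3n; have [D1 D2] := zv_near_ends_deg k3n.
have key : `|F.+1%:R * (F.+1%:R - 3) / 2 + false%:R| <= q * ((k + F.+1)%:R * ((k + F.+1)%:R - 3) / 2).
  rewrite -[false%:R]/(0 : rat) addr0; have [F2|F2] := leqP 3 F.+1.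
    have F2R := natr_ge F2; rewrite ger0_norm; last by nra.
    move: qF; rewrite natrD; set f := F.+1%:R in F2R *; set K := k%:R in kR * => qF.
    have K0 : 0 < (K + f - 1) * (K + f - 2) by nra.
    have : f * (f - 3) * ((K + f - 1) * (K + f - 2)) <= q * ((K + f) * (K + f - 3)) * ((K + f - 1) * (K + f - 2)).
      have A : f * (f - 3) * ((K + f - 1) * (K + f - 2)) <= (f - 1) * (f - 2) * ((K + f) * (K + f - 3)).
        have : 0 <= K * (K + 2 * f - 3) by nra.
        lra.
      have B : 0 <= (K + f) * (K + f - 3) by nra.
      nra.
    by rewrite ler_pM2r //; lra.
  (* With two fixed points (N-2,1,1) vanishes but the near hooks have absolute value 1; here the
     first condition on [q] is needed. *)
  have -> : F.+1 = 2%N by lia.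
  rewrite natrD; set K := k%:R in kR qk *.
  rewrite (_ : 2 * (2 - 3) / 2 = - 1 :> rat); last by lra.
  by rewrite normrN1; nra.
by case: x1 => ->; rewrite ?E1 ?E2 ?D1 ?D2 kn2 ?normrM ?normrX ?normrN1 ?expr1n ?mul1r.
Qed.

Lemma sum_sqr_irr_le (gT : finGroupType) (G : {group gT}) (s : seq 'CF(G)) :
  uniq s -> {subset s <= irr G} -> \sum_(phi <- s) phi 1%g ^+ 2 <= #|G|%:R.
Proof.
move=> us sirr; rewrite -irr_sum_square.
have inj : {in s &, injective (@cfIirr _ G)}.
  by move=> a b /sirr/irrP[j ->] /sirr/irrP[j' ->]; rewrite !irrK => ->.
have -> : \sum_(phi <- s) phi 1%g ^+ 2 = \sum_(j <- map (@cfIirr _ G) s) 'chi_j 1%g ^+ 2.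
  by rewrite big_map; apply: eq_big_seq => phi /sirr ps; rewrite cfIirrE.
rewrite big_uniq ?map_inj_in_uniq //= [X in _ <= X](bigID (mem (map (@cfIirr _ G) s))) /=.
by rewrite lerDl; apply: sumr_ge0 => j _; apply: exprn_ge0; apply: ltW; exact: irr1_gt0.
Qed.

(** The squares of the degrees 1, 4, 6, 4, 1, 5, 5 already add up to 5! = 120. This is the base case
    for 2- and 3-cycles. *)
Lemma no_deep5 n (phi : 'CF(SN n 5)) : (5 <= n)%N -> ~~ deep phi.
Proof.
move=> n5; apply/negP=> dp; have ip := deep_irr dp.
have hi m : (m < 5)%N -> hook n 5 m \in irr (SN n 5) by move=> m5; rewrite hook_irr ?m5.
have ni m : (0 < m < 3)%N -> near n 5 m \in irr (SN n 5) by move=> m3; rewrite near_irr //; lia.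
have hn m j : (m < 5)%N -> (0 < j < 3)%N -> hook n 5 m != near n 5 j.
  move=> m5 j3; apply/eqP=> E; have : '[near n 5 j, hook n 5 m] = 0.
    by rewrite (@near_dot_hook n 4) //; lia.
  by rewrite -E hook_dot // eqxx => /eqP; rewrite oner_eq0.
have hh m j : (m < 5)%N -> (j < 5)%N -> m != j -> hook n 5 m != hook n 5 j.
  move=> m5 j5 mj; apply/eqP=> E; have : '[hook n 5 m, hook n 5 j] = 0.
    by rewrite hook_dot // (negPf mj).
  by rewrite E hook_dot // eqxx => /eqP; rewrite oner_eq0.
have nn : near n 5 1 != near n 5 2.
  apply/eqP=> E; have : '[near n 5 1, near n 5 2] = 0 by rewrite (@near_dot n 3).
  by rewrite E (@near_dot n 3) // => /eqP; rewrite oner_eq0.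
pose s := [:: phi; hook n 5 0; hook n 5 1; hook n 5 2; hook n 5 3; hook n 5 4; near n 5 1; near n 5 2].
have us : uniq s.
  move: dp; rewrite /deep /inner !inE !negb_or => /andP[/andP[_ /and4P[? ? ? ?]] /and4P[? ? ? ?]].
  rewrite /s /= !inE !negb_or; do ?[apply/andP; split];
  match goal with
  | |- is_true (hook _ _ ?a != hook _ _ ?b) => exact: (hh a b isT isT isT)
  | |- is_true (hook _ _ ?a != near _ _ ?b) => exact: (hn a b isT isT)
  | |- _ => first [assumption | exact: nn | exact: isT]
  end.
have ss : {subset s <= irr (SN n 5)}.
  by move=> x; rewrite !inE; do ![case/orP]; move/eqP->; rewrite ?hi ?ni.
have := sum_sqr_irr_le us ss; rewrite /s !big_cons big_nil !hook1 // !(@near1 n 4) //.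
rewrite perm.card_Sym card_low // /near_deg /=.
have -> : 5`! = 120%N by [].
have -> : 'C(4, 0) = 1%N by []. have -> : 'C(4, 1) = 4%N by []. have -> : 'C(4, 2) = 6%N by [].
have -> : 'C(4, 3) = 4%N by []. have -> : 'C(4, 4) = 1%N by [].
have -> : (5%:Z * 'C(3, 1)%:Z - 'C(5, 2)%:Z = 5%:Z) by [].
rewrite -!pmulrn -!natrX addr0 -!natrD -lerBrDr -natrB // subnn => le0.
have /irrP[i Ei] := ip; rewrite Ei in le0.
have := irr1_gt0 i; have := le_lt_trans le0; rewrite -[X in X < _ -> _]/(0%:R).
by have := exprn_gt0 2 (irr1_gt0 i) => /lt_geF; rewrite le0.
Qed.

(** At transpositions the extreme inner shape is (N-2,2), with normalised value (F-2)/(F+2). *)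
Lemma inner_cyc_2 n F (q : rat) (psi : 'CF(SN n (2 + F))) :
  (2 < F)%N -> (2 + F <= n)%N -> F%:R - 2 <= q * (F%:R + 2) ->
  inner psi -> `|zv psi 2| <= q * zv psi 1.
Proof.
elim: F q psi => // F IHF q psi F2 Fn.
have k2n : (2 < 2 + F.+1 <= n)%N by lia.
have k3n : (3 < 2 + F.+1 <= n)%N by lia.
have h1 : (1 < 2 <= F.+2)%N by [].
have h2 : (3 < F.+2)%N by lia.
have h3 : (F.+2 <= n)%N by lia.
have h4 : (F <= 2)%N -> F = 2%N by lia.
have FR := natr_ge F2; move=> qF ip; case: (innerP ip) => [dp|h|x].
- have [F2'|/h4 F2'] := ltnP 2 F; last first.
    by move: psi ip dp Fn {IHF}; rewrite F2' => psi _ dp Fn; case/negP: (no_deep5 psi Fn).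
  apply: (avg_norm h1 Fn (deep_char dp)) => i nz.
  apply: (IHF _ _ F2' h3); last exact: deep_Res_inner h2 Fn dp nz.
  have F2R := natr_ge F2'; move: qF; rewrite -[F.+1%:R]natr1; set f := F%:R in F2R * => qF.
  have f0 : 0 < f + 1 + 2 by lra.
  by rewrite -(ler_pM2r f0); nra.
- have [E1 E2] := zv_hook2 (leqnn 2) (ltnW (ltnW F2)) k2n.
  have [D1 D2] := zv_hook2_deg k2n.
  have key : `|(F.+1%:R - 1) * (F.+1%:R - 2) / 2 - true%:R| <=
      q * (((2 + F.+1)%:R - 1) * ((2 + F.+1)%:R - 2) / 2).
    rewrite -[true%:R]/(1 : rat) natrD; set f := F.+1%:R in FR qF * .
    by rewrite ger0_norm; nra.
  by case: h => ->; rewrite ?E1 ?E2 ?D1 ?D2 eqxx ?normrM ?normrX ?normrN1 ?expr1n ?mul1r.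
have [E1 E2] := zv_near_ends (leqnn 2) (ltnW (ltnW F2)) k3n.
have [D1 D2] := zv_near_ends_deg k3n.
have key : `|F.+1%:R * (F.+1%:R - 3) / 2 + true%:R| <=
    q * ((2 + F.+1)%:R * ((2 + F.+1)%:R - 3) / 2).
  rewrite -[true%:R]/(1 : rat) natrD; set f := F.+1%:R in FR qF * .
  by rewrite ger0_norm; nra.
by case: x => ->; rewrite ?E1 ?E2 ?D1 ?D2 eqxx ?normrM ?normrX ?normrN1 ?expr1n ?mul1r.
Qed.

(** One-sided on purpose: for F = 2 the condition admits [q = 0], while the near hooks of S_5 have
    value -1 at 3-cycles. *)
Lemma inner_cyc_3 n F (q : rat) (psi : 'CF(SN n (3 + F))) :
  (1 < F)%N -> (3 + F <= n)%N ->
  (F%:R - 1) * (F%:R - 2) <= q * ((F%:R + 2) * (F%:R + 1)) ->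
  inner psi -> zv psi 3 <= q * zv psi 1.
Proof.
elim: F q psi => // F IHF q psi F2 Fn.
have k2n : (2 < 3 + F.+1 <= n)%N by lia.
have k3n : (3 < 3 + F.+1 <= n)%N by lia.
have h1 : (1 < 3 <= F.+3)%N by [].
have h2 : (3 < F.+3)%N by lia.
have h3 : (F.+3 <= n)%N by lia.
have h4 : (F <= 1)%N -> F = 1%N by lia.
have FR := natr_ge F2; move=> qF ip; case: (innerP ip) => [dp|h|x].
- have [F2'|/h4 F2'] := ltnP 1 F; last first.
    by move: psi ip dp Fn {IHF}; rewrite F2' => psi _ dp Fn; case/negP: (no_deep5 psi Fn).
  apply: (avg_le h1 Fn (deep_char dp)) => i nz.
  apply: (IHF _ _ F2' h3); last exact: deep_Res_inner h2 Fn dp nz.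
  have F2R := natr_ge F2'; move: qF; rewrite -[F.+1%:R]natr1; set f := F%:R in F2R * => qF.
  have f0 : 0 < f + 1 + 2 by lra.
  have A : f * (f - 1) <= q * ((f + 3) * (f + 2)) by lra.
  rewrite -(ler_pM2r f0).
  have B : (f - 1) * (f - 2) * (f + 1 + 2) <= f * (f - 1) * (f + 1) by nra.
  have C : 0 <= (f + 1) by lra.
  nra.
- have [E1 E2] := zv_hook2 (isT : (1 < 3)%N) (ltnW F2) k2n.
  have [D1 D2] := zv_hook2_deg k2n.
  have key : (F.+1%:R - 1) * (F.+1%:R - 2) / 2 - false%:R <=
      q * (((3 + F.+1)%:R - 1) * ((3 + F.+1)%:R - 2) / 2).
    by rewrite -[false%:R]/(0 : rat) natrD; set f := F.+1%:R in FR qF *; lra.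
  by case: h => ->; rewrite ?E1 ?E2 ?D1 ?D2 //= sqrrN expr1n mul1r.
have [E1 E2] := zv_near_ends (isT : (1 < 3)%N) (ltnW F2) k3n.
have [D1 D2] := zv_near_ends_deg k3n.
have key : F.+1%:R * (F.+1%:R - 3) / 2 + false%:R <=
    q * ((3 + F.+1)%:R * ((3 + F.+1)%:R - 3) / 2).
  rewrite -[false%:R]/(0 : rat) natrD; set f := F.+1%:R in FR qF *.
  have f0 : 0 < (f + 2) * (f + 1) by nra.
  rewrite -(ler_pM2r f0); have C : 0 <= f * (f + 3) by nra.
  have B : f * (f - 3) * ((f + 2) * (f + 1)) <= (f - 1) * (f - 2) * (f * (f + 3)) by nra.
  nra.
by case: x => ->; rewrite ?E1 ?E2 ?D1 ?D2 //= sqrrN expr1n mul1r.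
Qed.

(** * Comparison with (n-2,1,1), one length at a time *)

HB.lock Definition ncyc (n k : nat) : rat := ('C(n, k) * (k.-1)`!)%:R.

Lemma ncycE n F k : (0 < k)%N -> n = (k + F)%N ->
  ncyc n k * (k%:R * F`!%:R) = n`!%:R.
Proof.
move=> k0 E; rewrite ncyc.unlock -!natrM; congr (_%:R).
have kn : (k <= n)%N by lia.
rewrite -(bin_fact kn) E addKn; case: k k0 {E kn} => // k _.
by rewrite factS /=; lia.
Qed.

Lemma ncyc_gt0 n k : (0 < k <= n)%N -> 0 < ncyc n k.
Proof. by move=> kn; rewrite ncyc.unlock ltr0n muln_gt0 bin_gt0 fact_gt0; lia. Qed.

(* The normalised character of (n-2,1,1) at a k-cycle, also for k = n. *)
HB.lock Definition beta (n k : nat) : rat :=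
  ((n%:R - k%:R - 1) * (n%:R - k%:R - 2) - 2 * (k == 2)%:R) / ((n%:R - 1) * (n%:R - 2)).

Lemma betaE n F k : (2 < n)%N -> n = (k + F)%N ->
  beta n k * ((n%:R - 1) * (n%:R - 2)) = (F%:R - 1) * (F%:R - 2) - 2 * (k == 2)%:R.
Proof.
move=> n2 E; have nR := natr_ge n2; rewrite beta.unlock divfK; last by apply/eqP; nra.
by rewrite {1 2}E natrD (addrC k%:R) addrK.
Qed.

Lemma beta0E n F k : (2 < n)%N -> n = (k + F)%N -> (2 < k)%N ->
  beta n k * ((n%:R - 1) * (n%:R - 2)) = (F%:R - 1) * (F%:R - 2).
Proof. by move=> n2 E k2; rewrite (betaE n2 E) (gtn_eqF k2) mulr0 subr0. Qed.

(** For N = n, the sum over the lengths in [I] is the degree times the difference of lambda_phi and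
    B. The weights stay those of S_n when [N] is smaller, so that the same functional can be tested
    on restrictions. *)
Definition excess n N (phi : 'CF(SN n N)) (k : nat) : rat :=
  ncyc n k * (zv phi k - beta n k * zv phi 1).

Lemma excess_le0 n N (phi : 'CF(SN n N)) k : (0 < k <= n)%N ->
  zv phi k <= beta n k * zv phi 1 -> excess phi k <= 0.
Proof. by move=> kn le; rewrite /excess pmulr_rle0 ?ncyc_gt0 // subr_le0. Qed.

(** The values of S_(n-1) are compared with those of S_n, which has one more fixed point. At
    transpositions there is no slack: (n-3,2) in S_(n-1) and (n-2,1,1) in S_n have the same
    normalised value. For k >= 4, four fixed points in S_(n-1) bring [beta n k] up to
    2/((k+1)(k-2)). *)
Lemma inner_le_beta n N k (psi : 'CF(SN n N)) : n = N.+1 -> (6 < n)%N ->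
  (2 <= k)%N -> (k + 5 <= n)%N || (k == 3) -> inner psi -> zv psi k <= beta n k * zv psi 1.
Proof.
move=> En n7 k2 kn ip; have nR := natr_ge n7.
have n0 : 0 < (n%:R - 1) * (n%:R - 2) :> rat by nra.
have [Ek|k2'] := eqVneq k 2.
  have [F EF] : exists F, N = (2 + F)%N by exists (N - 2)%N; lia.
  have F3 : (2 < F)%N by lia.
  have Fn : (2 + F <= n)%N by lia.
  have nF : n%:R = F%:R + 3 :> rat by rewrite En EF -natr1 natrD; lra.
  have bE := @betaE n F.+1 2 ltac:(lia) ltac:(lia).
  move: psi ip; rewrite {}EF Ek => psi ip.
  apply: le_trans (ler_norm _) _; apply: inner_cyc_2 => //.
  move: bE; rewrite eqxx -[true%:R]/(1 : rat) -[F.+1%:R]natr1 nF => bE.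
  rewrite -(ler_pM2r n0) nF; have := natr_ge F3; move: bE.
  set f := F%:R; set b := beta n 2 => bE fR.
  have A : b * ((f + 2) * (f + 1)) = (f + 1) * (f - 2) by lra.
  have -> : b * (f + 2) * ((f + 3 - 1) * (f + 3 - 2)) = (f + 2) * ((f + 1) * (f - 2)).
    by rewrite -A; ring.
  by rewrite (_ : (f - 2) * _ = (f + 2) * ((f + 1) * (f - 2))) //; ring.
have [Ek|k3'] := eqVneq k 3.
  have [F EF] : exists F, N = (3 + F)%N by exists (N - 3)%N; lia.
  have F2 : (1 < F)%N by lia.
  have Fn : (3 + F <= n)%N by lia.
  have nF : n%:R = F%:R + 4 :> rat by rewrite En EF -natr1 natrD; lra.
  have bE := @beta0E n F.+1 3 ltac:(lia) ltac:(lia) isT.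
  move: psi ip; rewrite {}EF Ek => psi ip.
  apply: inner_cyc_3 => //; move: bE; rewrite -[F.+1%:R]natr1 nF => bE.
  rewrite -(ler_pM2r n0) nF mulrAC (mulrC (beta n 3)).
  have F2R := natr_ge F2; set f := F%:R in F2R *; set b := beta n 3 in bE *.
  have A : b * ((f + 4 - 1) * (f + 4 - 2)) = f * (f - 1) by lra.
  have -> : (f + 2) * (f + 1) * b * ((f + 4 - 1) * (f + 4 - 2)) = (f + 2) * (f + 1) * (f * (f - 1)).
    by rewrite -A; ring.
  nra.
have [F EF] : exists F, N = (k + F)%N by exists (N - k)%N; lia.
have k3 : (3 < k)%N by lia.
have F4 : (4 <= F)%N by lia.
have Fn : (k + F <= n)%N by lia.
have nF : n%:R = k%:R + F%:R + 1 :> rat by rewrite En EF -natr1 natrD.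
have bE := @beta0E n F.+1 k ltac:(lia) ltac:(lia) ltac:(lia).
have kR := natr_ge k3; have FR := natr_ge F4.
move: psi ip; rewrite {}EF => psi ip.
apply: le_trans (ler_norm _) _; apply: inner_bound => //; first by lia.
- rewrite -(ler_pM2r n0); move: bE; rewrite -[F.+1%:R]natr1 nF; set f := F%:R in FR *; set K := k%:R in kR *.
  set b := beta n k; move=> bE.
  have A : b * ((K + f) * (K + f - 1)) = f * (f - 1) by lra.
  have -> : b * ((K + 1) * (K - 2)) * ((K + f + 1 - 1) * (K + f + 1 - 2)) = (K + 1) * (K - 2) * (f * (f - 1)).
    by rewrite -A; ring.
  have B1 : 4 * (K + f) <= f * (K + 4) by nra.
  have B2 : 3 * (K + f - 1) <= (f - 1) * (K + 3) by nra.
  have B3 : 12 * ((K + f) * (K + f - 1)) <= f * (f - 1) * ((K + 4) * (K + 3)) by nra.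
  have B4 : (K + 4) * (K + 3) <= 6 * ((K + 1) * (K - 2)) by nra.
  have B5 : 0 <= f * (f - 1) by nra.
  nra.
rewrite -(ler_pM2r n0); move: bE; rewrite natrD -[F.+1%:R]natr1 nF; set f := F%:R in FR *; set K := k%:R in kR *.
set b := beta n k; move=> bE.
have A : b * ((K + f) * (K + f - 1)) = f * (f - 1) by lra.
have -> : b * ((K + f - 1) * (K + f - 2)) * ((K + f + 1 - 1) * (K + f + 1 - 2)) = (K + f - 1) * (K + f - 2) * (f * (f - 1)).
  by rewrite -A; ring.
have B1 : (f - 2) * (K + f) <= f * (K + f - 2) by nra.
have B2 : 0 <= (f - 1) * (K + f - 1) by nra.
nra.
Qed.

(** * Restriction of near hooks and the exceptional case n = 8 *)

Lemma Res_Ind_Res n N (psi : 'CF(SN n N.+2)) : (0 < N)%N -> (N.+1 < n)%N ->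
  'Res[SN n N.+1] ('Ind[SN n N.+2] ('Res[SN n N.+1] psi)) =
  'Res psi + 'Ind[SN n N.+1] ('Res[SN n N] ('Res[SN n N.+1] psi)).
Proof.
move=> N0 Nn; have sub M : SN n M \subset SN n M.+1 by exact: SN_sub.
have -> : 'Ind[SN n N.+2] ('Res[SN n N.+1] psi) = ecf (low n N.+2) 1 * psi.
  by rewrite -(Ind_cfun1_SN _ Nn) // -cfIndM // mul1r.
rewrite rmorphM /= ecf_hook linearD /= !Res_hook // ecf0 mulrDl mul1r addrC; congr (_ + _).
by rewrite -(Ind_cfun1_SN N0 (ltnW Nn)) -cfIndM // mul1r.
Qed.

Lemma Res_Ind_hook n N m : (0 < N)%N -> (N.+1 < n)%N ->
  'Res[SN n N.+1] ('Ind[SN n N.+2] (hook n N.+1 m)) =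
  hook n N.+1 m + 'Ind[SN n N.+1] (ecf (low n N) m).
Proof.
move=> N0 Nn; rewrite [in LHS](hook_Res m Nn) Res_Ind_Res // -hook_Res //.
by rewrite Res_hook ?(ltnW Nn).
Qed.

(** The three terms remove a cell from the arm, from the leg and from the inner corner. *)
Lemma Res_near n N m : (0 < N)%N -> (N.+1 < n)%N ->
  'Res[SN n N.+1] (near n N.+2 m.+1) =
  near n N.+1 m.+1 + near n N.+1 m + hook n N.+1 m.+1.
Proof.
move=> N0 Nn; rewrite {1}/near !linearB /= Res_Ind_hook // !Res_hook //.
rewrite !ecf_hook linearD /= !Ind_hookE.
set a := near _ _ _; set b := near _ _ _.
apply/cfunP=> g; rewrite !cfunE; ring.
Qed.

(** Near hooks extend virtually as well, which is what [Ind_dot_Ind] asks for. *)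
Lemma near_Res n N m : (0 < N)%N -> (N.+1 < n)%N ->
  exists psi : 'CF(SN n N.+2), near n N.+1 m = 'Res psi.
Proof.
move=> N0 Nn; have Nn' := ltnW Nn.
pose Y : 'CF(SN n N.+1) := \sum_(i < m.+1) (-1) ^+ (m - i) *: hook n N.+1 i.
have hR j : exists psi : 'CF(SN n N.+2), hook n N.+1 j = 'Res psi.
  by exists (\sum_(i < j.+1) (-1) ^+ (j - i) *: hook n N.+2 i); rewrite -hook_Res.
have [y Ey] : exists y : 'CF(SN n N.+2), Y = 'Res y.
  rewrite /Y; elim/big_ind: _ => [|a b [a' ->] [b' ->]|i _].
  - by exists 0; rewrite linear0.
  - by exists (a' + b'); rewrite linearD.
  by have [p ->] := hR i; exists ((-1) ^+ (m - i) *: p); rewrite linearZ.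
have [p0 E0] := hR 0%N; have [p1 E1] := hR 1%N.
have [pm Em] := hR m; have [pm1 Em1] := hR m.+1.
exists ((p1 + p0) * y - pm - pm1).
rewrite !linearB /= rmorphM rmorphD /= -E0 -E1 -Em -Em1 -Ey -ecf_hook.
rewrite /near; congr (_ - _ - _).
rewrite -(Ind_cfun1_SN N0 Nn') /= -cfIndM ?SN_sub // mul1r.
by rewrite [in LHS](hook_Res m Nn').
Qed.

Lemma Ind_near_norm n N m : (1 < N)%N -> (N.+2 < n)%N ->
  let X := 'Ind[SN n N.+3] (near n N.+2 m.+1) in
  '[X] = '[near n N.+2 m.+1] + '['Res[SN n N.+1] (near n N.+2 m.+1)].
Proof.
move=> N1 Nn; have [psi Epsi] := @near_Res n N.+1 m.+1 isT Nn.
by rewrite /= [in LHS]Epsi Ind_dot_Ind // -!Epsi.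
Qed.

(** Suppose [V] restricts to a multiple of X = (2,2,1,1,1), of degree 14. Then [V] occurs once in
    the induced character of X, which has norm 3 and degree 112 and contains (2,2,1^4), of degree
    20. The third constituent would have degree 112 - 20 - 14 = 78, which does not divide 8!. *)
Lemma deep8_Res n (V : 'CF(SN n 8)) : (8 <= n)%N -> deep V ->
  exists2 i : Iirr (SN n 7), '['Res[SN n 7] V, 'chi_i] != 0 & 'chi_i != near n 7 4.
Proof.
move=> n8 dV; have n7 := ltnW n8; have n6 := ltnW n7; have iV := deep_irr dV; have NV := deep_char dV.
pose X := near n 7 4; have iX : X \in irr (SN n 7) by rewrite near_irr.
case: (boolP [exists i : Iirr (SN n 7), ('['Res[SN n 7] V, 'chi_i] != 0) && ('chi_i != X)]).
  by case/existsP=> i /andP[]; exists i.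
move/existsPn=> allX; exfalso.
have X1 : X 1%g = 14 by rewrite /X (@near1 n 6).
have R : 'Res[SN n 7] V = '['Res[SN n 7] V, X] *: X.
  have /irrP[x Ex] := iX; rewrite {1}['Res V]cfun_sum_cfdot Ex (bigD1 x) //= big1 ?addr0 //.
  move=> j jx; have := allX j; rewrite negb_and !negbK => /orP[/eqP->|]; first by rewrite scale0r.
  by rewrite Ex (inj_eq irr_inj) (negPf jx).
have Na : '['Res[SN n 7] V, X] \in Num.nat.
  have /irrP[x ->] := iX; exact: Cnat_cfdot_char_irr (cfRes_char _ NV).
have /natrP[a Ea] := Na; rewrite {}Ea in R.
pose Z := near n 8 5; have iZ : Z \in irr (SN n 8) by rewrite near_irr.
have VZ : '[V, Z] = 0.
  apply: irr_neq_dot0 => //; move: dV => /andP[_].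
  by rewrite !inE !negb_or => /and4P[].
pose P := 'Ind[SN n 8] X.
have nX : '[X] = 1 by rewrite (@near_dot n 5).
have R4 : 'Res[SN n 6] X = near n 6 3 + hook n 6 4.
  by rewrite /X (@Res_near n 5) // (@near_vanish n 4 4) // add0r.
have nP : '[P] = 3.
  rewrite /P /X (@Ind_near_norm n 5) // -/X nX R4 cfnormDd ?(@near_dot_hook n 5) //.
  by rewrite (@near_dot n 4) // hook_dot //=; ring.
have PZ : '[P, Z] = 1.
  rewrite /P -cfdot_Res_r /Z (@Res_near n 6) // (@near_vanish n 5 5) // add0r cfdotDr nX.
  by rewrite (@near_dot_hook n 6) // addr0.
have PV : '[P, V] = a%:R by rewrite /P -cfdot_Res_r R cfdotZr nX mulr1 conjC_nat.
have nV : '[V] = 1 by have /irrP[v ->] := iV; rewrite cfnorm_irr.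
have nZ : '[Z] = 1 by rewrite (@near_dot n 6).
have ZV : '[Z, V] = 0 by rewrite cfdotC VZ conjC0.
have ZP : '[Z, P] = 1 by rewrite cfdotC PZ conjC1.
have VP : '[V, P] = a%:R by rewrite cfdotC PV conjC_nat.
have V1 : V 1%g = a%:R * 14.
  by rewrite -(cfRes1 (SN n 7)) R cfunE X1.
have P1 : P 1%g = 112%:R.
  by rewrite /P cfInd1 ?SN_sub // index_SN // X1 -natrM.
have Z1 : Z 1%g = 20%:R by rewrite /Z (@near1 n 7).
have ZPv : P \in 'Z[irr (SN n 8)] by rewrite cfInd_vchar ?char_vchar ?irr_is_char.
clearbody P Z.
have a0 : (0 < a)%N.
  have := irr1_gt0 (cfIirr V); rewrite cfIirrE // V1.
  by case: (a) => //; rewrite mul0r ltxx.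
(* The norm of P - Z - a V is 2 - a^2. *)
have a1 : a = 1%N.
  have : 0 <= '[P - Z - a%:R *: V] by exact: cfnorm_ge0.
  rewrite !(cfdotBl, cfdotBr, cfdotZl, cfdotZr) nP PZ PV nV nZ ZV ZP VP VZ conjC_nat.
  rewrite !mulr0 !mulr1 !subr0 (_ : _ - _ = 2 - a%:R * a%:R :> algC); last by ring.
  by rewrite subr_ge0 -natrM ler_nat => ?; nia.
rewrite a1 in PV V1 VP.
pose W := P - Z - V.
have iW : W \in irr (SN n 8).
  apply: irr_norm1.
  - by rewrite /W !rpredB ?ZPv // char_vchar ?irr_is_char.
  - by rewrite /W !(cfdotBl, cfdotBr) nP PZ PV nV nZ ZV ZP VP VZ; ring.
  by rewrite /W !cfunE P1 Z1 V1 mul1r -!natrB // ltr0n.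
have W1 : W 1%g = 78%:R by rewrite /W !cfunE P1 Z1 V1 mul1r -!natrB.
have /irrP[w Ew] := iW; have := dvd_irr1_cardG w; rewrite -Ew W1 perm.card_Sym card_low //.
by rewrite (dvdC_nat 78 (8`!)).
Qed.

(* In this part n = c + 4, and (c+1)! = (n-3)! is the unit of comparison. *)
Definition unit3 (c : nat) : rat := c.+1`!%:R.

Lemma unit3_gt0 c : 0 < unit3 c.
Proof. by rewrite ltr0n fact_gt0. Qed.

Lemma fact4E c : c.+4`!%:R = (c%:R + 4) * (c%:R + 3) * (c%:R + 2) * unit3 c :> rat.
Proof.
have E4 : c.+4%:R = c%:R + 4 :> rat by rewrite -[c.+4]addn4 natrD.
have E3 : c.+3%:R = c%:R + 3 :> rat by rewrite -[c.+3]addn3 natrD.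
have E2 : c.+2%:R = c%:R + 2 :> rat by rewrite -[c.+2]addn2 natrD.
by rewrite /unit3 3!factS !natrM E4 E3 E2 !mulrA.
Qed.

(** [inner_bound] with [N] abstract, since the type of [psi] depends on it. *)
Lemma inner_boundE n N k F (q : rat) (psi : 'CF(SN n N)) : N = (k + F)%N ->
  (3 < k)%N -> (1 < F)%N -> (k + F <= n)%N ->
  2 <= q * ((k%:R + 1) * (k%:R - 2)) ->
  (F%:R - 1) * (F%:R - 2) <= q * ((N%:R - 1) * (N%:R - 2)) ->
  inner psi -> `|zv psi k| <= q * zv psi 1.
Proof. by move=> E; move: psi; rewrite {}E => psi; exact: inner_bound. Qed.

(** * The surplus at lengths close to n, and the deep characters *)

Lemma ncyc_topE c : (0 < c)%N ->
  [/\ ncyc c.+4 c.+4 = (c%:R + 3) * (c%:R + 2) * unit3 c,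
      ncyc c.+4 c.+3 = (c%:R + 4) * (c%:R + 2) * unit3 c,
      2 * ncyc c.+4 c.+2 = (c%:R + 4) * (c%:R + 3) * unit3 c,
      6 * (c%:R + 1) * ncyc c.+4 c.+1 = (c%:R + 4) * (c%:R + 3) * (c%:R + 2) * unit3 c &
      24 * c%:R * ncyc c.+4 c = (c%:R + 4) * (c%:R + 3) * (c%:R + 2) * unit3 c].
Proof.
move=> cp; have c0 : 0 <= c%:R :> rat by rewrite ler0n.
have E4 : c.+4%:R = c%:R + 4 :> rat by rewrite -[c.+4]addn4 natrD.
have E3 : c.+3%:R = c%:R + 3 :> rat by rewrite -[c.+3]addn3 natrD.
have E2 : c.+2%:R = c%:R + 2 :> rat by rewrite -[c.+2]addn2 natrD.
have E1 : c.+1%:R = c%:R + 1 :> rat by rewrite -[c.+1]addn1 natrD.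
have n4 : c%:R + 4 != 0 :> rat by apply/eqP; lra.
have n3 : c%:R + 3 != 0 :> rat by apply/eqP; lra.
have n2 : c%:R + 2 != 0 :> rat by apply/eqP; lra.
split.
- apply: (mulfI n4); have := @ncycE c.+4 0 c.+4 isT; rewrite addn0 (fact4E c) E4 fact0 => /(_ erefl).
  by rewrite mulr1 => H; lra.
- apply: (mulfI n3); have := @ncycE c.+4 1 c.+3 isT; rewrite addn1 (fact4E c) E3 => /(_ erefl).
  by rewrite (_ : 1`! = 1%N) // mulr1 => H; lra.
- apply: (mulfI n2); have := @ncycE c.+4 2 c.+2 isT; rewrite addn2 (fact4E c) E2 => /(_ erefl).
  by rewrite (_ : 2`! = 2%N) // => H; lra.
- have := @ncycE c.+4 3 c.+1 isT; rewrite addn3 (fact4E c) E1 => /(_ erefl).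
  by rewrite (_ : 3`! = 6%N) // => H; lra.
have := @ncycE c.+4 4 c cp; rewrite addn4 (fact4E c) => /(_ erefl).
by rewrite (_ : 4`! = 24%N) // => H; lra.
Qed.

Lemma beta_topE c : (2 < c)%N ->
  [/\ beta c.+4 c.+4 * ((c%:R + 3) * (c%:R + 2)) = 2, beta c.+4 c.+3 = 0, beta c.+4 c.+2 = 0,
      beta c.+4 c.+1 * ((c%:R + 3) * (c%:R + 2)) = 2 &
      beta c.+4 c * ((c%:R + 3) * (c%:R + 2)) = 6].
Proof.
move=> c2; have cR := natr_ge c2.
have E4 : c.+4%:R = c%:R + 4 :> rat by rewrite -[c.+4]addn4 natrD.
have nz : (c%:R + 3) * (c%:R + 2) != 0 :> rat by apply/eqP; nra.
have B F k : (2 < k)%N -> c.+4 = (k + F)%N ->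
    beta c.+4 k * ((c%:R + 3) * (c%:R + 2)) = (F%:R - 1) * (F%:R - 2).
  move=> k2 E; rewrite -(@beta0E c.+4 F k isT E k2) E4; congr (_ * (_ * _)); lra.
have k2 : (2 < c.+2)%N by lia.
have k1 : (2 < c.+1)%N by lia.
split.
- by rewrite (B 0%N) ?addn0 //; lra.
- by apply: (mulIf nz); rewrite (B 1%N) ?addn1 //; lra.
- by apply: (mulIf nz); rewrite (B 2%N) ?addn2 //; lra.
- by rewrite (B 3%N) ?addn3 //; lra.
by rewrite (B 4%N) ?addn4 //; lra.
Qed.

Lemma beta_ge0 n k : (4 < n)%N -> (1 < k <= n)%N -> 0 <= beta n k.
Proof.
move=> n4 kn; have nR := natr_ge n4.
have n0 : 0 < (n%:R - 1) * (n%:R - 2) :> rat by nra.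
rewrite -(pmulr_lge0 _ n0); have [F EF] : exists F, n = (k + F)%N by exists (n - k)%N; lia.
rewrite (betaE _ EF); last by lia.
have [k2|k2] := eqVneq k 2.
  have F3 : (2 < F)%N by lia.
  by have := natr_ge F3; rewrite -[true%:R]/(1 : rat) => FR; nra.
rewrite -[false%:R]/(0 : rat); case: F {EF} => [|[|F]]; [lra|lra|].
by rewrite -[F.+2%:R]natr1 -[F.+1%:R]natr1; have := ler0n rat F; nra.
Qed.

(** In S_(n-1) the (n-3)-cycles have two fixed points, and [inner_bound] gives 2/((c+2)(c-1)). The
    resulting surplus is 7/6 exactly at c = 3 and smaller afterwards. *)
Lemma inner_excess3 c (U : 'CF(SN c.+4 c.+3)) : (2 < c)%N -> inner U ->
  excess U c.+1 <= 7 / 6 * unit3 c * zv U 1.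
Proof.
move=> c2 ip; have cR := natr_ge c2.
have D0 : 0 < zv U 1 by apply: zv1_gt0 (inner_irr ip); lia.
have u0 := unit3_gt0 c; have [_ _ _ wE _] := @ncyc_topE c ltac:(lia).
have [_ _ _ bE _] := beta_topE c2.
have w0 : 0 < ncyc c.+4 c.+1 by apply: ncyc_gt0; lia.
have E1 : c.+1%:R = c%:R + 1 :> rat by rewrite -[c.+1]addn1 natrD.
have x0 : 0 < (c%:R + 2) * (c%:R - 1) :> rat by nra.
have H : `|zv U c.+1| <= 2 / ((c%:R + 2) * (c%:R - 1)) * zv U 1.
  apply: (@inner_boundE c.+4 c.+3 c.+1 2 _ U) => //; [by rewrite addn2 | by rewrite addn2 | |].
    rewrite E1 (_ : (c%:R + 1 + 1) * (c%:R + 1 - 2) = (c%:R + 2) * (c%:R - 1)); last by ring.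
    by rewrite divfK ?gt_eqF.
  rewrite subrr mulr0 mulr_ge0 ?divr_ge0 ?(ltW x0) //.
  by rewrite -[c.+3]addn3 natrD; nra.
have {}H : zv U c.+1 * ((c%:R + 2) * (c%:R - 1)) <= 2 * zv U 1.
  rewrite -ler_pdivlMr // mulrAC; exact: le_trans (ler_norm _) H.
rewrite /excess; set x := c%:R in cR wE bE x0 H *; set w := ncyc _ _ in wE w0 *.
set b := beta _ _ in bE *; set z := zv U _ in H *; set D := zv U 1 in D0 H *; set u := unit3 c in u0 wE *.
have P0 : 0 < 6 * (x + 1) * ((x + 2) * (x - 1)) by nra.
rewrite -(ler_pM2l P0).
have -> : 6 * (x + 1) * ((x + 2) * (x - 1)) * (w * (z - b * D)) =
   6 * (x + 1) * w * (z * ((x + 2) * (x - 1)) - b * D * ((x + 2) * (x - 1))) by ring.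
rewrite wE.
have A0 : 0 < (x + 4) * (x + 3) * (x + 2) * u by rewrite !mulr_gt0 //; lra.
apply: (@le_trans _ _ ((x + 4) * (x + 3) * (x + 2) * u * (2 * D - b * D * ((x + 2) * (x - 1))))).
  by rewrite ler_pM2l // lerB.
have -> : (x + 4) * (x + 3) * (x + 2) * u * (2 * D - b * D * ((x + 2) * (x - 1))) =
  (u * D) * ((x + 4) * (2 * ((x + 3) * (x + 2)) - (b * ((x + 3) * (x + 2))) * ((x + 2) * (x - 1)))) by ring.
rewrite bE.
have -> : 6 * (x + 1) * ((x + 2) * (x - 1)) * (7 / 6 * u * D) =
  (u * D) * (7 * (x + 1) * ((x + 2) * (x - 1))) by field.
by rewrite ler_pM2l ?mulr_gt0 //; nra.
Qed.

(** The constant 1/5 is what [inner_bound] yields at c = 4, whence the factor x - 4 at the end. For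
    c = 3 these are 3-cycles, covered by [inner_le_beta]. *)
Lemma inner_excess4 c (U : 'CF(SN c.+4 c.+3)) : (2 < c)%N -> inner U ->
  excess U c <= 1 / 5 * unit3 c * zv U 1.
Proof.
move=> c2 ip; have cR := natr_ge c2.
have D0 : 0 < zv U 1 by apply: zv1_gt0 (inner_irr ip); lia.
have u0 := unit3_gt0 c; have [_ _ _ _ wE] := @ncyc_topE c ltac:(lia).
have [_ _ _ _ bE] := beta_topE c2.
have w0 : 0 < ncyc c.+4 c by apply: ncyc_gt0; lia.
have [Ec|c3] := eqVneq c 3.
  apply: (@le_trans _ _ 0); last by rewrite !mulr_ge0 ?ltW //; lra.
  apply: excess_le0; first by lia.
  by apply: inner_le_beta ip; rewrite // Ec.
have {}c3 : (3 < c)%N by lia.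
have {}cR := natr_ge c3.
have x0 : 0 < (c%:R + 1) * (c%:R - 2) :> rat by nra.
have H : `|zv U c| <= 2 / ((c%:R + 1) * (c%:R - 2)) * zv U 1.
  apply: (@inner_boundE c.+4 c.+3 c 3 _ U) => //; [by rewrite addn3 | by rewrite addn3 | |].
    by rewrite divfK ?gt_eqF.
  rewrite -(ler_pM2r x0) -[c.+3]addn3 natrD [X in _ <= X]mulrAC divfK; last by rewrite gt_eqF.
  by clear -cR; nra.
have {}H : zv U c * ((c%:R + 1) * (c%:R - 2)) <= 2 * zv U 1.
  rewrite -ler_pdivlMr // mulrAC; exact: le_trans (ler_norm _) H.
rewrite /excess; set x := c%:R in cR wE bE x0 H *; set w := ncyc _ _ in wE w0 *.
set b := beta _ _ in bE *; set z := zv U c in H *; set D := zv U 1 in D0 H *; set u := unit3 c in u0 wE *.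
have P0 : 0 < 24 * x * ((x + 1) * (x - 2)) by rewrite !mulr_gt0 //; lra.
rewrite -(ler_pM2l P0).
have -> : 24 * x * ((x + 1) * (x - 2)) * (w * (z - b * D)) =
   24 * x * w * (z * ((x + 1) * (x - 2)) - b * D * ((x + 1) * (x - 2))) by ring.
rewrite wE.
have A0 : 0 < (x + 4) * (x + 3) * (x + 2) * u by rewrite !mulr_gt0 //; lra.
apply: (@le_trans _ _ ((x + 4) * (x + 3) * (x + 2) * u * (2 * D - b * D * ((x + 1) * (x - 2))))).
  by rewrite ler_pM2l // lerB.
have -> : (x + 4) * (x + 3) * (x + 2) * u * (2 * D - b * D * ((x + 1) * (x - 2))) =
  (u * D) * ((x + 4) * (2 * ((x + 3) * (x + 2)) - (b * ((x + 3) * (x + 2))) * ((x + 1) * (x - 2)))) by ring.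
rewrite bE.
have -> : 24 * x * ((x + 1) * (x - 2)) * (1 / 5 * u * D) =
  (u * D) * (24 / 5 * x * ((x + 1) * (x - 2))) by field.
rewrite ler_pM2l; last by apply: mulr_gt0.
rewrite -subr_ge0.
have -> : 24 / 5 * x * ((x + 1) * (x - 2)) - (x + 4) * (2 * ((x + 3) * (x + 2)) - 6 * ((x + 1) * (x - 2)))
  = (x - 4) * (44 * x ^+ 2 + 152 * x + 120) / 5 by field.
by apply: divr_ge0; [apply: mulr_ge0; [lra | nra] | lra].
Qed.

Definition ksmall (c : nat) (I : {pred nat}) : seq nat := [seq k <- iota 2 c.+1 | k \in I].

Lemma ksmallP c (I : {pred nat}) k : k \in ksmall c I -> (1 < k <= c.+2)%N.
Proof. by rewrite mem_filter mem_iota => /andP[_]; lia. Qed.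

Lemma iota_split c : (2 < c)%N -> iota 2 c.+1 = iota 2 (c - 2) ++ [:: c; c.+1; c.+2].
Proof.
move=> c2; have E : c.+1 = (c - 2 + 3)%N by lia.
have E' : (2 + (c - 2) = c)%N by lia.
by rewrite {1}E iotaD E'.
Qed.

(** [I] may omit any of the three lengths, so their caps have to be nonnegative. *)
Lemma sum_excess_le c N (phi : 'CF(SN c.+4 N)) (I : {pred nat}) (T2 T3 T4 : rat) :
  (2 < c)%N -> (forall k, (1 < k)%N -> (k < c)%N -> excess phi k <= 0) ->
  excess phi c.+2 <= T2 -> 0 <= T2 -> excess phi c.+1 <= T3 -> 0 <= T3 ->
  excess phi c <= T4 -> 0 <= T4 ->
  \sum_(k <- ksmall c I) excess phi k <= T2 + T3 + T4.
Proof.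
move=> c2 H e2 t2 e3 t3 e4 t4; rewrite big_filter (iota_split c2) big_cat /= !big_cons big_nil.
have S0 : \sum_(k <- iota 2 (c - 2) | k \in I) excess phi k <= 0.
  rewrite big_seq_cond; apply: sumr_le0 => k /andP[]; rewrite mem_iota => kc _.
  by apply: H; lia.
have A (b : bool) (x y t r : rat) : x <= t -> 0 <= t -> y <= r -> (if b then x + y else y) <= t + r.
  by case: b; lra.
have B4 := A (c \in I) _ _ _ _ e4 t4 (A (c.+1 \in I) _ _ _ _ e3 t3 (A (c.+2 \in I) _ _ _ _ e2 t2 (lexx 0))).
by apply: le_trans (lerD S0 B4) _; lra.
Qed.

(** For a character of S_n vanishing at n- and (n-1)-cycles this is the total excess: the n-cycles
    cost 2 (n-3)! times the degree, and the (n-1)-cycles contribute nothing because [beta] is 0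
    there. *)
Definition Lfun c N (I : {pred nat}) (phi : 'CF(SN c.+4 N)) : rat :=
  \sum_(k <- ksmall c I) excess phi k - 2 * unit3 c * zv phi 1.

(** The coefficients of [Lfun]; all multiples of the degree are collected at k = 1. *)
Definition Lwt c (I : {pred nat}) (k : nat) : rat :=
  if k == 1%N then - (\sum_(k <- ksmall c I) ncyc c.+4 k * beta c.+4 k) - 2 * unit3 c
  else ncyc c.+4 k.

Lemma Lfun_lin c N (I : {pred nat}) (phi : 'CF(SN c.+4 N)) :
  Lfun I phi = lin (1%N :: ksmall c I) (Lwt c I) phi.
Proof.
rewrite /lin big_cons {1}/Lwt eqxx mulrBl mulNr mulr_suml addrAC /Lfun; congr (_ - _).
rewrite addrC -sumrB; apply: eq_big_seq => k /ksmallP /andP[k1 _].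
by rewrite /Lwt (gtn_eqF k1) /excess; ring.
Qed.

Lemma hv_small k f m : (m < k)%N -> hv k f m = 'C(f, m)%:R.
Proof. by move=> mk; rewrite /hv leqNgt mk mul0n mulr0 addr0. Qed.

Lemma hv0 k f m : (f < m)%N -> (m < k)%N -> hv k f m = 0.
Proof. by move=> fm mk; rewrite hv_small // bin_small. Qed.

(** With so few fixed points, a stable set of the relevant size is too large to consist of fixed
    points and usually too small to contain the cycle. *)
Lemma near_mid_zv n k m : (1 < m)%N -> (m < k)%N -> (k.+3 <= n)%N ->
  zv (near n k.+3 m) k.+1 = 0 /\ zv (near n k.+3 m) k <= 1.
Proof.
move=> m1 mk Nn; split.
  have := @zv_near n k.+1 0 m; rewrite addn0 => ->; try lia.
  have h1 : hv k.+1 0 m = 0 by apply: hv0; lia.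
  have h2 : hv k.+1 1 m = 0 by apply: hv0; lia.
  have h3 : hv k.+1 1 m.+1 = 0 by apply: hv0; lia.
  by rewrite h1 h2 h3 mulr0 !subr0.
have := @zv_near n k 1 m; rewrite addn1 => ->; try lia.
rewrite (hv0 m1 mk) (hv_small _ mk); have b0 : 0 <= 'C(2, m)%:R :> rat by rewrite ler0n.
have [km|km] := ltnP m.+1 k; first by rewrite (@hv0 k 2 m.+1) //; lra.
have -> : m.+1 = k by lia.
rewrite /hv leqnn subnn bin0 (@bin_small 2 k); last by lia.
by rewrite muln1 -[true%:R]/(1 : rat) -signr_odd; case: (odd _); rewrite ?expr0 ?expr1; lra.
Qed.

(** The caps 7/6 and 1/5 sum to less than 2, so a problem arises only if [U] is positive at
    (n-2)-cycles, that is, a near hook with even [m]. Middle ones have large degree. The last one, m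
    = c, has surplus (c+4)/c there but none at (n-3)-cycles. *)
Lemma inner_Lfun c (I : {pred nat}) (U : 'CF(SN c.+4 c.+3)) : (2 < c)%N -> inner U ->
  Lfun I U < 0 \/ [/\ Lfun I U <= 0, c = 4 & U = near c.+4 c.+3 c].
Proof.
move=> c2; have c0 : (0 < c)%N by lia.
have c3n : (3 < c.+3 <= c.+4)%N by lia.
have l2 : (0 < c.+2 <= c.+4)%N by lia.
have l1 : (0 < c.+1 <= c.+4)%N by lia.
have l0 : (0 < c <= c.+4)%N by lia.
have l1' : (1 < c.+1 <= c.+4)%N by lia.
have l0' : (1 < c <= c.+4)%N by lia.
have lk k : (1 < k)%N -> (k < c)%N -> (0 < k <= c.+4)%N by lia.
have lk' k : (k < c)%N -> (k + 5 <= c.+4)%N by lia.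
have k3n : (3 < c.+1 + 2 <= c.+4)%N by lia.
have k3n' : (3 < c + 3 <= c.+4)%N by lia.
have cn1 : (c.+1 == 2) = false by lia.
have cn2 : (c == 2) = false by lia.
have mE m : (c.+3 <= m.+3)%N -> (m.+2 < c.+3)%N -> m = c by lia.
move=> ip; have cR := natr_ge c2.
have D0 : 0 < zv U 1 by apply: zv1_gt0 (inner_irr ip); rewrite /= leqnSn.
have u0 := unit3_gt0 c; have [_ _ w2E _ _] := @ncyc_topE c c0.
have [_ _ b2E b3E _] := beta_topE c2.
have UD : 0 < unit3 c * zv U 1 by rewrite mulr_gt0.
have w20 := ncyc_gt0 l2.
have H k : (1 < k)%N -> (k < c)%N -> excess U k <= 0.
  move=> k1 kc; apply: excess_le0; first exact: lk.
  by apply: inner_le_beta ip => //; rewrite lk'.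
have e3 := inner_excess3 c2 ip; have e4 := inner_excess4 c2 ip.
have E2 : excess U c.+2 = ncyc c.+4 c.+2 * zv U c.+2 by rewrite /excess b2E mul0r subr0.
have t3 : 0 <= 7 / 6 * unit3 c * zv U 1 by lra.
have t4 : 0 <= 1 / 5 * unit3 c * zv U 1 by lra.
have generic : zv U c.+2 <= 0 -> Lfun I U < 0.
  move=> z0; have e2 : excess U c.+2 <= 0 by rewrite E2 pmulr_rle0.
  have := sum_excess_le I c2 H e2 (lexx 0) e3 t3 e4 t4; rewrite /Lfun; lra.
have [|z0] := leP (zv U c.+2) 0; first by left; exact: generic.
have nz : zv U c.+3.-1 != 0 by rewrite gt_eqF.
have [m /andP[m0 mN] EU] := inner_pred_cycP c3n ip nz.
have zm : zv U c.+2 = (-1) ^+ m by rewrite EU (@zv_near_pred c.+4 c.+3).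
have modd : ~~ odd m.
  by apply/negP=> om; move: z0; rewrite zm -signr_odd om expr1; lra.
have zm1 : zv U c.+2 = 1 by rewrite zm -signr_odd (negPf modd).
have m1 : (1 < m)%N by case: (m) m0 modd => [|[|]].
have [mid|mend] := ltnP m.+3 c.+3.
  left; have [Z3 _] := @near_mid_zv c.+4 c m m1 mid (leqnSn _); rewrite -EU in Z3.
  have {}e3 : excess U c.+1 <= 0.
    apply: excess_le0 => //.
    by rewrite Z3 mulr_ge0 ?(ltW D0) // beta_ge0.
  have DE := zv_near_mid_deg_ge m1 mid (leqnSn _); rewrite -EU in DE.
  (* The constant comes from 8(c+4) <= 7(c+1)(c-1), an equality at c = 3, and the cubic lower bound
     on the degree. *)
  have e2 : excess U c.+2 <= 21 / 16 * unit3 c * zv U 1.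
    have E3 : c.+3%:R = c%:R + 3 :> rat by rewrite -[c.+3]addn3 natrD.
    rewrite E2 zm1 mulr1; move: DE w2E; rewrite E3.
    set x := c%:R in cR *; set w := ncyc _ _ in w20 *; set D := zv U 1 in D0 *; set u := unit3 c in u0 *.
    move=> DE w2E; have DE' : (x + 3) * (x + 1) * (x - 1) <= 3 * D by lra.
    have P : (x + 4) * (x + 3) * 8 <= 7 * ((x + 3) * (x + 1) * (x - 1)) by nra.
    have Q : (x + 4) * (x + 3) * 8 <= 21 * D by lra.
    have := ler_wpM2l (ltW u0) Q; lra.
  have t2 : 0 <= 21 / 16 * unit3 c * zv U 1 by lra.
  have := sum_excess_le I c2 H e2 t2 e3 (lexx 0) e4 t4; rewrite /Lfun; lra.
have Em := mE m mend mN.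
have ceven : ~~ odd c by rewrite -Em.
have [_ Z3] := @zv_near_ends c.+4 c.+1 2 c0 isT k3n.
have {}Z3 : zv U c.+1 = -1.
  move: Z3; rewrite addn2 subSS subSS subSS subn0 EU Em => ->.
  by rewrite cn1 /= -signr_odd (negPf ceven) expr0 -[false%:R]/(0 : rat); lra.
have {}e3 : excess U c.+1 <= 0.
  apply: excess_le0 => //.
  have : 0 <= beta c.+4 c.+1 * zv U 1 by rewrite mulr_ge0 ?(ltW D0) // beta_ge0.
  by rewrite Z3; lra.
have [_ DE] := @zv_near_ends_deg c.+4 c.+3 c3n.
have {}DE : zv U 1 = (c%:R + 3) * c%:R / 2.
  move: DE; rewrite !subSS subn0 EU Em => ->; have E3 : c.+3%:R = c%:R + 3 :> rat by rewrite -[c.+3]addn3 natrD.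
  by rewrite E3; ring.
have e2E : excess U c.+2 * c%:R = (c%:R + 4) * (unit3 c * zv U 1).
  rewrite E2 zm1 mulr1 DE; have := congr1 (fun y => y * c%:R) w2E.
  by set w := ncyc _ _; lra.
(* For c = 4 the surplus (c+4)/c is exactly 2. Otherwise c is even and at least 6, and it is at most
   5/3. *)
have [Ec|c4] := eqVneq c 4.
  right; split=> //; last by rewrite EU Em.
  have c4R : c%:R = 4 :> rat by rewrite Ec.
  have e2 : excess U c.+2 <= 2 * unit3 c * zv U 1 by move: e2E; rewrite c4R; lra.
  have t2 : 0 <= 2 * unit3 c * zv U 1 by lra.
  have [_ Z4] := @zv_near_ends c.+4 c 3 (ltnW c2) isT k3n'.
  have {}Z4 : zv U c = 0.
    move: Z4; rewrite addn3 !subSS subn0 EU Em => ->.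
    by rewrite cn2 -[false%:R]/(0 : rat) (_ : 3%:R * (3%:R - 3) / 2 + 0 = 0 :> rat) ?mulr0 //; lra.
  have {}e4 : excess U c <= 0.
    apply: excess_le0 => //.
    by rewrite Z4 mulr_ge0 ?(ltW D0) // beta_ge0.
  have := sum_excess_le I c2 H e2 t2 e3 (lexx 0) e4 (lexx 0); rewrite /Lfun; lra.
left; have c6 : (5 < c)%N.
  by clear -c2 c4 ceven; case: c c2 c4 ceven => [|[|[|[|[|[|c]]]]]].
have c6R := natr_ge c6.
have e2 : excess U c.+2 <= 5 / 3 * unit3 c * zv U 1.
  have x0 : 0 < c%:R :> rat by lra.
  rewrite -(ler_pM2r x0) e2E.
  have : (c%:R + 4) * (unit3 c * zv U 1) <= (5 / 3 * c%:R) * (unit3 c * zv U 1).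
    by rewrite ler_pM2r //; lra.
  lra.
have t2 : 0 <= 5 / 3 * unit3 c * zv U 1 by lra.
have := sum_excess_le I c2 H e2 t2 e3 (lexx 0) e4 t4; rewrite /Lfun; lra.
Qed.

Lemma bin3R M : 6 * 'C(M, 3)%:R = M%:R * (M%:R - 1) * (M%:R - 2) :> rat.
Proof.
elim: M => [|M IH]; first by rewrite bin0n mulr0 !mul0r.
by rewrite binS natrD mulrDr IH bin2R -[M.+1%:R]natr1; lra.
Qed.

Lemma bin_mid_ge M m : (2 < m)%N -> (m + 3 <= M)%N -> ('C(M, 3) <= 'C(M, m))%N.
Proof.
elim: M m => [|M IHM] m m2 mM; first by lia.
have [->//|m3] := eqVneq m 3.
have [E|mM'] := eqVneq (m + 3)%N M.+1.
  have -> : m = (M.+1 - 3)%N by lia.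
  by rewrite bin_sub //; lia.
case: m m2 m3 mM mM' => // m m2 m3 mM mM'; rewrite !binS.
have h1 := IHM m.+1 ltac:(lia) ltac:(lia); have h2 := IHM m ltac:(lia) ltac:(lia).
have h3 : ('C(M, 2) <= 'C(M, 3))%N.
  rewrite -(ler_nat rat); have := bin3R M; rewrite bin2R.
  have M7 : (7 <= M)%N by lia.
  by have := natr_ge M7; nra.
lia.
Qed.

Lemma deep_excess c (V : 'CF(SN c.+4 c.+4)) : (2 < c)%N -> deep V ->
  (forall k, (1 < k)%N -> (k < c)%N -> excess V k <= 0) /\
  excess V c <= 1 / 5 * unit3 c * zv V 1.
Proof.
move=> c2 dV; have c3 : (3 < c.+3)%N by lia.
have NV := deep_char dV; split=> [k k1 kc|].
  apply: excess_le0; first by lia.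
  apply: (avg_le _ (ltnSn _) NV) => [|i nz]; first by lia.
  apply: inner_le_beta => //; first by lia.
  exact: deep_Res_inner c3 (ltnSn _) dV nz.
have w0 : 0 < ncyc c.+4 c by apply: ncyc_gt0; lia.
(* Rephrased as a bound on the value by a multiple of the degree, the form that [avg_le]
   transports. *)
have E (N : nat) (phi : 'CF(SN c.+4 N)) :
    (excess phi c <= 1 / 5 * unit3 c * zv phi 1) =
    (zv phi c <= (beta c.+4 c + 1 / 5 * unit3 c / ncyc c.+4 c) * zv phi 1).
  have wn : ncyc c.+4 c != 0 by rewrite gt_eqF.
  rewrite /excess -[RHS](ler_pM2l w0) mulrBr lerBlDl; congr (_ <= _).
  by field.
rewrite E; apply: (avg_le _ (ltnSn _) NV) => [|i nz]; first by lia.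
by rewrite -E inner_excess4 //; exact: deep_Res_inner c3 (ltnSn _) dV nz.
Qed.

Definition kall (n : nat) (I : {pred nat}) : seq nat := [seq k <- iota 2 n.-1 | k \in I].

Lemma sum_kall c (I : {pred nat}) (f : nat -> rat) : c.+3 \in I -> c.+4 \in I ->
  \sum_(k <- kall c.+4 I) f k = \sum_(k <- ksmall c I) f k + f c.+3 + f c.+4.
Proof.
move=> I3 I4; have E' : c.+3 = (c.+1 + 2)%N by rewrite addn2.
have E : iota 2 c.+3 = iota 2 c.+1 ++ [:: c.+3; c.+4] by rewrite {1}E' iotaD add2n.
by rewrite !big_filter /= -/(iota 2 c.+3) -/(iota 2 c.+1) E big_cat /= !big_cons big_nil I3 I4 addr0 addrA.
Qed.

Lemma Res_has_constt (gT : finGroupType) (G H : {group gT}) (phi : 'CF(G)) :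
  phi \in irr G -> exists i : Iirr H, '['Res[H] phi, 'chi_i] != 0.
Proof.
move=> iphi; apply/existsP; apply: contraT => /existsPn H0.
have /irrP[j Ej] := iphi; have := irr1_gt0 j; rewrite -Ej -(cfRes1 H).
rewrite ['Res phi]cfun_sum_cfdot big1 ?cfunE ?ltxx // => i _.
by have := H0 i; rewrite negbK => /eqP->; rewrite scale0r.
Qed.

Lemma sgn_le1 m : (-1) ^+ m <= 1 :> rat.
Proof. by rewrite -signr_odd; case: (odd m). Qed.

(** If [V] is nonzero at n-cycles it is a middle hook, and if nonzero at (n-1)-cycles a middle near
    hook. In both cases only the cap 1/5 at (n-4)-cycles survives, and the degree outweighs the one
    long cycle. Otherwise the total excess is [Lfun], estimated on the restriction to S_(n-1). *)
Lemma deep_lt c (I : {pred nat}) (V : 'CF(SN c.+4 c.+4)) : (2 < c)%N ->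
  c.+3 \in I -> c.+4 \in I -> deep V -> \sum_(k <- kall c.+4 I) excess V k < 0.
Proof.
move=> c2 I3 I4; have c0 : (0 < c)%N by lia.
have l4 : (0 < c.+4 <= c.+4)%N by lia.
have l1 : (0 < c.+1 <= c.+4)%N by lia.
have l1' : (1 < c.+1 <= c.+4)%N by lia.
have c3n : (3 < c.+4 <= c.+4)%N by lia.
have c3 : (3 < c.+3)%N by lia.
have sub4 : (c.+4 - 3 = c.+1)%N by lia.
have midm m : m != 0%N -> m != 1%N -> m != 2%N -> m != (c.+4 - 3)%N -> m != (c.+4 - 2)%N ->
    m != (c.+4 - 1)%N -> (m < c.+4)%N -> [/\ (2 < m)%N, (m <= c)%N & (m + 3 <= c.+3)%N] by move=> *; split; lia.
have midn m : (0 < m)%N && (m.+2 < c.+4)%N -> m != 1%N -> m != (c.+4 - 3)%N ->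
    [/\ (1 < m)%N, (m < c.+1)%N & (m.+3 < c.+4)%N] by move=> *; split; lia.
have hz3 m : (2 < m)%N -> (m <= c)%N -> [/\ zv (hook c.+4 c.+4 m) c.+3 = 0,
    zv (hook c.+4 c.+4 m) c.+2 = 0 & zv (hook c.+4 c.+4 m) c.+1 = 0].
  move=> m2 mc; have := @zv_hook c.+4 c.+3 0 m; have := @zv_hook c.+4 c.+2 1 m.
  have := @zv_hook c.+4 c.+1 2 m; rewrite addn0 addn1 addn2 => -> //; last by lia.
  by move=> -> //; [move=> -> //; [split; apply: hv0; lia | lia] | lia].
move=> dV; have iV := deep_irr dV; have cR := natr_ge c2.
have D0 : 0 < zv V 1 by exact: zv1_gt0.
have u0 := unit3_gt0 c; have [w4E w3E w2E _ _] := @ncyc_topE c c0.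
have [b4E b3E b2E b1E _] := beta_topE c2.
have UD : 0 < unit3 c * zv V 1 by rewrite mulr_gt0.
have [H e0] := deep_excess c2 dV.
have t0 : 0 <= 1 / 5 * unit3 c * zv V 1 by lra.
have bD : 0 <= beta c.+4 c.+1 * zv V 1 by rewrite mulr_ge0 ?(ltW D0) // beta_ge0.
have E3 : excess V c.+3 = (c%:R + 4) * (c%:R + 2) * unit3 c * zv V c.+3.
  by rewrite /excess b3E mul0r subr0 w3E.
have E4 : excess V c.+4 = (c%:R + 3) * (c%:R + 2) * unit3 c * zv V c.+4 - 2 * unit3 c * zv V 1.
  by rewrite /excess w4E -{3}b4E; ring.
have E2 : excess V c.+2 = ncyc c.+4 c.+2 * zv V c.+2 by rewrite /excess b2E mul0r subr0.
have l1V := dV; case/andP: l1V => /andP[_ l1V] l2V.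
rewrite !inE !negb_or in l1V; rewrite !inE !negb_or in l2V.
case/and4P: l1V => p0 p1 pa pb; case/and4P: l2V => p2 q1 pc qc.
rewrite sum_kall //.
have [z4|z4] := eqVneq (zv V c.+4) 0; last first.
  have /irrP[i Ei] := iV.
  have nz : 'chi_i (cyc c.+4 c.+4) != 0.
    by rewrite -Ei -ratr_zv ?fmorph_eq0 // deep_char.
  have [m mN EV] := irr_long_cyc l4 nz; rewrite -Ei in EV.
  have ne j : V != hook c.+4 c.+4 j -> m != j by apply: contraNneq => <-; rewrite EV.
  have [m2 mc m3] := midm m (ne _ p0) (ne _ p1) (ne _ p2) (ne _ pc) (ne _ pa) (ne _ pb) mN.
  have [Z3 Z2 Z1] := hz3 m m2 mc; rewrite -EV in Z3 Z2 Z1.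
  have e2 : excess V c.+2 <= 0 by rewrite E2 Z2 mulr0.
  have e1 : excess V c.+1 <= 0 by apply: excess_le0; rewrite // Z1.
  have := sum_excess_le I c2 H e2 (lexx 0) e1 (lexx 0) e0 t0; rewrite E3 E4 Z3 mulr0.
  have DE : zv V 1 = 'C(c.+3, m)%:R by rewrite EV zv_hook1 ?mN.
  have DG : 'C(c.+3, 3)%:R <= zv V 1 by rewrite DE ler_nat bin_mid_ge.
  have z4le : zv V c.+4 <= 1.
    by rewrite EV zv_hook_long ?sgn_le1 ?mN ?leqnn.
  have := bin3R c.+3; have -> : c.+3%:R = c%:R + 3 :> rat by rewrite -[c.+3]addn3 natrD.
  move: DG UD u0 D0 z4le; clear -cR.
  set x := c%:R in cR *; set B := 'C(_, _)%:R; set D := zv V 1; set u := unit3 c; set z := zv V _.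
  set S := \sum_(k <- _) _ => DG UD u0 D0 z1 BE SE.
  have P : (x + 3) * (x + 2) * z <= (x + 3) * (x + 2) by nra.
  (* The ratio 18/10 is 2 - 1/5, the budget left after the (n-4)-cycles. *)
  have Q : 10 * ((x + 3) * (x + 2)) < 18 * D by nra.
  have R1 := ler_wpM2l (ltW u0) P; have R2 : u * (10 * ((x + 3) * (x + 2))) < u * (18 * D) by rewrite ltr_pM2l.
  lra.
have [z3|z3] := eqVneq (zv V c.+3) 0; last first.
  have iV' : inner V by case/andP: (dV).
  have [m mN EV] := @inner_pred_cycP c.+4 c.+4 V c3n iV' z3.
  have ne j : V != near c.+4 c.+4 j -> m != j by apply: contraNneq => <-; rewrite EV.
  have [m1 mc m3] := midn m mN (ne _ q1) (ne _ qc).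
  have [Z2 Z1] := @near_mid_zv c.+4 c.+1 m m1 mc (leqnn _); rewrite -EV in Z2 Z1.
  have DG := @zv_near_mid_deg_ge c.+4 c.+4 m m1 m3 (leqnn _); rewrite -EV in DG.
  have C4 : c.+4%:R = c%:R + 4 :> rat by rewrite -[c.+4]addn4 natrD.
  rewrite C4 in DG.
  have e2 : excess V c.+2 <= 0 by rewrite E2 Z2 mulr0.
  have e1 : excess V c.+1 <= 0.
    apply: excess_le0 => //; apply: le_trans Z1 _; move: b1E DG D0 bD; clear -cR.
    set x := c%:R in cR *; set b := beta _ _; set D := zv V 1 => b1E DG D0 bD.
    have K : 0 < (x + 3) * (x + 2) by nra.
    rewrite -(ler_pM2r K) mul1r mulrAC b1E; nra.
  have z3le : zv V c.+3 <= 1.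
    have := @zv_near_pred c.+4 c.+4 m; rewrite -EV /= => ->; rewrite ?(ltnW m1) ?(ltnW m3) //.
    exact: sgn_le1.
  have := sum_excess_le I c2 H e2 (lexx 0) e1 (lexx 0) e0 t0; rewrite E3 E4 z4 mulr0.
  move: DG UD u0 D0 z3le; clear -cR.
  set x := c%:R in cR *; set D := zv V 1; set u := unit3 c; set z := zv V _.
  set S := \sum_(k <- _) _ => DG UD u0 D0 z1 SE.
  have P : (x + 4) * (x + 2) * z <= (x + 4) * (x + 2) by nra.
  have Q : 10 * ((x + 4) * (x + 2)) < 18 * D by nra.
  have R1 := ler_wpM2l (ltW u0) P; have R2 : u * (10 * ((x + 4) * (x + 2))) < u * (18 * D) by rewrite ltr_pM2l.
  lra.
rewrite E3 E4 z3 z4 !mulr0 addr0 add0r -/(Lfun I V) Lfun_lin.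
have [] := @lin_le0 c.+4 c.+4 c.+3 (1%N :: ksmall c I) (Lwt c I) V (leqnSn _) (leqnn _) (deep_char dV).
- by move=> k; rewrite inE => /orP[/eqP->//|/ksmallP/andP[k1 k2]]; rewrite (ltnW k1) leqW.
- move=> i nz; rewrite -Lfun_lin; have ii := deep_Res_inner c3 (ltnSn _) dV nz.
  by have [/ltW|[]] := inner_Lfun I c2 ii.
move=> _; apply.
(* Strictness needs one constituent with negative [Lfun]: any will do unless c = 4, where it must
   differ from the exceptional one. *)
have [Ec|c4] := eqVneq c 4; last first.
  have [i nz] := @Res_has_constt _ _ (SN c.+4 c.+3) V iV; exists i => //.
  rewrite -Lfun_lin; have ii := deep_Res_inner c3 (ltnSn _) dV nz.
  by have [//|[_ Ec]] := inner_Lfun I c2 ii; rewrite Ec in c4.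
have [i nz ne] : exists2 i : Iirr (SN c.+4 c.+3), '['Res[SN c.+4 c.+3] V, 'chi_i] != 0 &
    'chi_i != near c.+4 c.+3 c.
  by clear -Ec dV; move: V dV; rewrite Ec => V dV; exact: deep8_Res.
exists i => //; rewrite -Lfun_lin; have ii := deep_Res_inner c3 (ltnSn _) dV nz.
by have [//|[_ _ E]] := inner_Lfun I c2 ii; rewrite E eqxx in ne.
Qed.

(** * The explicit characters (n-2,2), (3,1^(n-3)) and (2,2,1^(n-4)) *)

Lemma fixpts n k : (k <= n)%N -> exists2 F, n = (k + F)%N & n%:R = k%:R + F%:R :> rat.
Proof. by move=> kn; exists (n - k)%N; rewrite ?subnKC // -natrD subnKC. Qed.

Lemma natr4 c : c.+4%:R = c%:R + 4 :> rat.
Proof. by rewrite -[c.+4]addn4 natrD. Qed.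

Lemma sgn_cases k : (-1) ^+ k = (if odd k then -1 else 1) :> rat.
Proof. by rewrite -signr_odd; case: (odd k). Qed.

Lemma zv_hook2_beta n k : (4 < n)%N -> (1 < k <= n)%N ->
  zv (hook n n 2) k = beta n k * zv (hook n n 2) 1.
Proof.
move=> n4 /andP[k1 kn]; have nR := natr_ge n4.
have n2n : (2 < n <= n)%N by lia.
have [-> _] := zv_hook2_deg n2n.
have [kn'|nk] := ltnP k n; last first.
  have -> : k = n by lia.
  rewrite zv_hook_long; last by lia.
  have := @beta0E n 0 n ltac:(lia) ltac:(lia) ltac:(lia).
  by rewrite expr2 mulrNN mulr1; lra.
have [F EF FR] := fixpts kn; have F0 : (0 < F)%N by lia.
have kFn : (2 < k + F <= n)%N by lia.
have [+ _] := @zv_hook2 n k F k1 F0 kFn; rewrite -EF => ->.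
by have := @betaE n F k ltac:(lia) EF; lra.
Qed.

(** The shape (n-2,2) can gain only at transpositions, namely twice its degree, which the loss 2
    (n-3)! times the degree at n-cycles absorbs. Strictness comes from the value -1 at
    (n-1)-cycles. *)
Lemma near1_lt c (I : {pred nat}) : (2 < c)%N -> c.+3 \in I -> c.+4 \in I ->
  \sum_(k <- kall c.+4 I) excess (near c.+4 c.+4 1) k < 0.
Proof.
move=> c2 I3 I4; have cR := natr_ge c2.
have c3n : (3 < c.+4 <= c.+4)%N by lia.
set phi := near _ _ _; have [DE _] := zv_near_ends_deg c3n.
rewrite -/phi natr4 in DE.
have ip : phi \in irr (SN c.+4 c.+4) by apply: near_irr; lia.
have z4 : zv phi c.+4 = 0.
  apply: (@zv_eq c.+4 c.+4 c.+4) => //; rewrite rmorph0; apply/eqP/negP=> /negP nz.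
  have /irrP[i Ei] := ip; rewrite Ei in nz.
  have [m mN Em] := @irr_long_cyc c.+4 c.+4 i ltac:(lia) nz.
  have := @near_dot_hook c.+4 c.+3 1 m; rewrite -/phi Ei Em hook_dot // eqxx.
  by move=> /(_ ltac:(lia) ltac:(lia) ltac:(lia))/eqP; rewrite oner_eq0.
have [w4E w3E _ _ _] := @ncyc_topE c ltac:(lia).
have [b4E b3E _ _ _] := beta_topE c2.
have u1 : 1 <= unit3 c by rewrite ler1n fact_gt0.
have D0 : 0 < zv phi 1 by rewrite DE; nra.
rewrite sum_kall //; have E4 : excess phi c.+4 = - 2 * unit3 c * zv phi 1.
  by rewrite /excess w4E z4 -{2}b4E; ring.
have w2 : ncyc c.+4 2 = (c%:R + 4) * (c%:R + 3) / 2.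
  by rewrite ncyc.unlock muln1 bin2R natr4; lra.
have S : \sum_(k <- ksmall c I) excess phi k <= 2 * zv phi 1 * 1.
  have H k : (2 < k)%N -> (k <= c.+2)%N -> excess phi k <= 0.
    move=> k2 kc; apply: excess_le0; first by lia.
    have [F EF FR] := @fixpts c.+4 k ltac:(lia).
    have F2 : (1 < F)%N by lia.
    have [+ _] := @zv_near_ends c.+4 k F ltac:(lia) ltac:(lia) ltac:(lia).
    rewrite -EF -/phi (gtn_eqF k2) -[false%:R]/(0 : rat) => ->.
    have := @beta0E c.+4 F k isT EF k2; rewrite DE; have := natr_ge F2; have := natr_ge k2.
    move: FR; rewrite natr4; set x := c%:R in cR *; set f := F%:R; set K := k%:R; set b := beta _ _.
    move=> FR KR fR bE; have K0 : 0 < (x + 4 - 1) * (x + 4 - 2) by nra.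
    rewrite -(ler_pM2r K0) -mulrA mulrC -[X in _ <= X]mulrA.
    have -> : b * ((x + 4) * (x + 4 - 3) / 2 * ((x + 4 - 1) * (x + 4 - 2))) =
       (b * ((x + 4 - 1) * (x + 4 - 2))) * ((x + 4) * (x + 4 - 3) / 2) by ring.
    rewrite bE; have xE : x = K + f - 4 by lra.
    rewrite xE; have : 0 <= K * (K + 2 * f - 3) by nra.
    nra.
  have H2 : excess phi 2 <= 2 * zv phi 1 * 1.
    have [F EF FR] := @fixpts c.+4 2 isT.
    have [+ _] := @zv_near_ends c.+4 2 F isT ltac:(lia) ltac:(lia).
    rewrite -EF -/phi eqxx -[true%:R]/(1 : rat) => Z.
    have := @betaE c.+4 F 2 isT EF; rewrite eqxx -[true%:R]/(1 : rat) natr4 => bE.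
    rewrite /excess w2 Z DE; move: FR bE; rewrite natr4; set x := c%:R in cR *; set f := F%:R; set b := beta _ _.
    move=> FR bE; have fE : f = x + 2 by lra.
    have b1 : b * (x + 3) = x - 1.
      have x2 : 0 < x + 2 by lra.
      by apply: (mulIf (lt0r_neq0 x2)); move: bE; rewrite fE; lra.
    have -> : (x + 4) * (x + 3) / 2 * (f * (f - 3) / 2 + 1 - b * ((x + 4) * (x + 4 - 3) / 2)) =
      (x + 4) / 2 * ((x + 3) * (f * (f - 3) / 2 + 1) - (b * (x + 3)) * ((x + 4) * (x + 4 - 3) / 2)) by ring.
    by rewrite b1 fE; lra.
  rewrite big_filter -[c.+1]/(1 + c)%N iotaD big_cat /= big_cons big_nil.
  have S' : \sum_(k <- iota 3 c | k \in I) excess phi k <= 0.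
    rewrite big_seq_cond; apply: sumr_le0 => k /andP[]; rewrite mem_iota => kc _.
    by apply: H; lia.
  by case: (2%N \in I); lra.
have := @ler_wpM2l _ (zv phi 1) (ltW D0) _ _ u1.
have c3R : 0 < (c%:R + 4) * (c%:R + 2) * unit3 c by rewrite !mulr_gt0 //; lra.
have E3' : excess phi c.+3 = - ((c%:R + 4) * (c%:R + 2) * unit3 c).
  rewrite /excess b3E mul0r subr0 w3E.
  have := @zv_near_pred c.+4 c.+4 1 isT ltac:(lia) ltac:(lia); rewrite -/phi /= => ->.
  by rewrite expr1 mulrN1.
by rewrite E4 E3'; lra.
Qed.

(** Twisting by the sign cannot raise a nonnegative value, and for even n it makes the value at the
    odd n-cycles negative. *)
Lemma hook_twist2_lt c (I : {pred nat}) : (2 < c)%N -> ~~ odd c -> c.+3 \in I -> c.+4 \in I ->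
  \sum_(k <- kall c.+4 I) excess (hook c.+4 c.+4 c.+1) k < 0.
Proof.
move=> c2 ce I3 I4; have cR := natr_ge c2.
have n4 : (4 < c.+4)%N by lia.
have c2n : (2 < c.+4 <= c.+4)%N by lia.
have [D1 D2] := zv_hook2_deg c2n; rewrite !subSS subn0 in D2.
set phi := hook _ _ _.
have D0 : 0 < zv phi 1 by rewrite D2 natr4; nra.
have H k : (1 < k)%N -> (k <= c.+3)%N -> excess phi k <= 0.
  move=> k1 kc; apply: excess_le0; first by lia.
  have [F EF FR] := @fixpts c.+4 k ltac:(lia).
  have [E1 E2] := @zv_hook2 c.+4 k F k1 ltac:(lia) ltac:(lia).
  have Z := @zv_hook2_beta c.+4 k n4 ltac:(lia).
  have B0 := @beta_ge0 c.+4 k n4 ltac:(lia).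
  move: E1 E2; rewrite -EF !subSS subn0 -/phi => E1 ->; rewrite -E1 Z D1 -D2 -/phi.
  have : 0 <= beta c.+4 k * zv phi 1 by rewrite mulr_ge0 // ltW.
  by rewrite sgn_cases; case: odd; lra.
rewrite sum_kall //; have S : \sum_(k <- ksmall c I) excess phi k <= 0.
  rewrite big_seq; apply: sumr_le0 => k /ksmallP/andP[k1 k2].
  by apply: H => //; exact: leqW.
have E3 := H c.+3 isT (leqnn _).
have E4 : excess phi c.+4 < 0.
  have := @zv_hook_long c.+4 c.+4 c.+1 ltac:(lia); rewrite -/phi => Z.
  rewrite /excess pmulr_rlt0; last by apply: ncyc_gt0; lia.
  rewrite Z sgn_cases /= ce.
  have B0 := @beta_ge0 c.+4 c.+4 n4 ltac:(lia).
  have : 0 <= beta c.+4 c.+4 * zv phi 1 by rewrite mulr_ge0 // ltW.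
  lra.
lra.
Qed.

(** A gain occurs only at (n-2)-cycles, odd for even n, where (n-2,2) has value -1. It is
    (c+3)/(c+1), at most 7/5 as c >= 4. *)
Lemma near_twist_lt c (I : {pred nat}) : (2 < c)%N -> ~~ odd c -> c.+3 \in I -> c.+4 \in I ->
  \sum_(k <- kall c.+4 I) excess (near c.+4 c.+4 c.+1) k < 0.
Proof.
move=> c2 ce I3 I4; have c3 : (3 < c)%N by case: c c2 ce {I3 I4} => [|[|[|[|]]]].
have cR := natr_ge c3.
have n4 : (4 < c.+4)%N by lia.
have c3n : (3 < c.+4 <= c.+4)%N by lia.
set phi := near _ _ _; have [_ DE] := zv_near_ends_deg c3n.
rewrite !subSS subn0 -/phi natr4 in DE.
have ip : phi \in irr (SN c.+4 c.+4) by apply: near_irr; lia.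
have D0 : 0 < zv phi 1 by rewrite DE; nra.
have z4 : zv phi c.+4 = 0.
  apply: (@zv_eq c.+4 c.+4 c.+4) => //; rewrite rmorph0; apply/eqP/negP=> /negP nz.
  have /irrP[i Ei] := ip; rewrite Ei in nz.
  have [m mN Em] := @irr_long_cyc c.+4 c.+4 i ltac:(lia) nz.
  have := @near_dot_hook c.+4 c.+3 c.+1 m; rewrite -/phi Ei Em hook_dot // eqxx.
  by move=> /(_ ltac:(lia) ltac:(lia) ltac:(lia))/eqP; rewrite oner_eq0.
have u0 := unit3_gt0 c; have UD : 0 < unit3 c * zv phi 1 by rewrite mulr_gt0.
have [w4E w3E w2E _ _] := @ncyc_topE c ltac:(lia).
have [b4E b3E b2E _ _] := beta_topE c2.
have bD k : (1 < k <= c.+4)%N -> 0 <= beta c.+4 k * zv phi 1.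
  by move=> kc; rewrite mulr_ge0 ?(ltW D0) // beta_ge0.
have ends k F : c.+4 = (k + F)%N -> (1 < k)%N -> (0 < F)%N ->
    zv phi k = (-1) ^+ k.-1 * (F%:R * (F%:R - 3) / 2 + (k == 2)%:R).
  move=> EF k1 F0; have [_ +] := @zv_near_ends c.+4 k F k1 F0 ltac:(lia).
  by rewrite -EF !subSS subn0.
have H k : (1 < k)%N -> (k < c.+2)%N -> excess phi k <= 0.
  move=> k1 kc; apply: excess_le0; first by lia.
  have [F EF FR] := @fixpts c.+4 k ltac:(lia).
  have F3 : (2 < F)%N by lia.
  rewrite (ends k F EF k1 ltac:(lia)); have [k2|k2] := eqVneq k 2.
    have := bD k ltac:(lia); rewrite k2 /= expr1 -[true%:R]/(1 : rat).
    by have := natr_ge F3; nra.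
  have k2' : (2 < k)%N by lia.
  rewrite -[false%:R]/(0 : rat) addr0.
  have B := @beta0E c.+4 F k isT EF k2'; have FR3 := natr_ge F3; have kR := natr_ge k2'.
  have P : 0 <= F%:R * (F%:R - 3) / 2 :> rat by nra.
  have Q : F%:R * (F%:R - 3) / 2 <= beta c.+4 k * zv phi 1.
    move: B FR; rewrite DE natr4; set x := c%:R in cR *; set f := F%:R in FR3 *; set K := k%:R in kR *; set b := beta _ _.
    move=> bE FR; have K0 : 0 < (x + 4 - 1) * (x + 4 - 2) by nra.
    rewrite -(ler_pM2r K0).
    have -> : b * ((x + 4) * (x + 4 - 3) / 2) * ((x + 4 - 1) * (x + 4 - 2)) =
       (b * ((x + 4 - 1) * (x + 4 - 2))) * ((x + 4) * (x + 4 - 3) / 2) by ring.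
    rewrite bE; have xE : x = K + f - 4 by lra.
    rewrite xE; have : 0 <= K * (K + 2 * f - 3) by nra.
    nra.
  by rewrite sgn_cases; case: odd; lra.
have E4 : excess phi c.+4 = - 2 * unit3 c * zv phi 1.
  by rewrite /excess w4E z4 -{2}b4E; ring.
have E3 : excess phi c.+3 <= 0.
  apply: excess_le0; first by lia.
  rewrite b3E mul0r (ends c.+3 1%N) ?addn1 //=.
  by rewrite sgn_cases /= ce /= -[false%:R]/(0 : rat); lra.
have E2 : excess phi c.+2 <= 7 / 5 * unit3 c * zv phi 1.
  rewrite /excess b2E mul0r subr0 (ends c.+2 2) ?addn2 //=.
  have -> : (c.+2 == 2) = false by lia.
  rewrite sgn_cases /= ce -[false%:R]/(0 : rat).
  have -> : - 1 * (2 * (2 - 3) / 2 + 0) = 1 :> rat by lra.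
  rewrite mulr1 DE; move: w2E; set x := c%:R in cR *; set w := ncyc _ _; set u := unit3 c in u0 * => w2E.
  have P : (x + 4) * (x + 3) <= 7 / 5 * ((x + 4) * (x + 4 - 3)) by nra.
  by have := ler_wpM2l (ltW u0) P; lra.
have T20 : 0 <= 7 / 5 * unit3 c * zv phi 1.
  by rewrite -mulrA; apply: mulr_ge0 (ltW UD); rewrite divr_ge0 ?ler0n.
rewrite sum_kall //.
have := sum_excess_le I c2 (fun k k1 kc => H k k1 (leqW (leqW kc))) E2 T20
  (H c.+1 (ltnW (leqW c2)) (ltnSn _)) (lexx 0) (H c (ltnW c2) (leqnSn _)) (lexx 0).
by rewrite E4; lra.
Qed.

(** * The standard character, its twist and the sign, with the ties for I = {2,..,n} *)

Definition Ifull (c : nat) (I : {pred nat}) : bool := all (mem I) (iota 2 c.+1).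

Lemma zv_hook1_val c k F : (2 < c)%N -> c.+4 = (k + F)%N -> (1 < k)%N ->
  zv (hook c.+4 c.+4 1) k = F%:R - 1.
Proof.
move=> c2 EF k1; have [F0|F0] := posnP F.
  have -> : k = c.+4 by lia.
  by rewrite zv_hook_long ?expr1 ?F0 ?sub0r //; lia.
by have [+ _] := @zv_hook_std c.+4 k F k1 F0 ltac:(lia); rewrite -EF.
Qed.

Lemma zv_hook_deg1 c : zv (hook c.+4 c.+4 1) 1 = c%:R + 3 /\
  zv (hook c.+4 c.+4 c.+2) 1 = c%:R + 3 /\ zv (hook c.+4 c.+4 c.+3) 1 = 1.
Proof.
have E : c.+3%:R = c%:R + 3 :> rat by rewrite -[c.+3]addn3 natrD.
rewrite !zv_hook1 ?leqnn ?andbT ?ltnS ?leqnSn //= bin1 binn E; split=> //; split=> //.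
have -> : 'C(c.+3, c.+2) = 'C(c.+3, 1) by rewrite -[in RHS]bin_sub //= subn1.
by rewrite bin1 E.
Qed.

Lemma zv_hook_topc c m : (m < c.+4)%N -> zv (hook c.+4 c.+4 m) c.+4 = (-1) ^+ m.
Proof. by move=> mc; rewrite zv_hook_long // mc leqnn. Qed.

Lemma iotaS_cat m : iota 2 m.+1 = iota 2 m ++ [:: (2 + m)%N].
Proof. by rewrite -[m.+1]addn1 iotaD. Qed.

Lemma excess_hook1 c k F : (2 < c)%N -> c.+4 = (k + F)%N -> (1 < k)%N ->
  excess (hook c.+4 c.+4 1) k * (c%:R + 2) = ncyc c.+4 k * (k%:R * (F%:R - 1) + 2 * (k == 2)%:R).
Proof.
move=> c2 EF k1; have cR := natr_ge c2; have FR : c%:R + 4 = k%:R + F%:R :> rat by rewrite -natr4 EF natrD.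
rewrite /excess (zv_hook1_val c2 EF k1) (zv_hook_deg1 c).1.
have := @betaE c.+4 F k isT EF; rewrite natr4; set d := _%:R; set b := beta _ _ => bE.
rewrite -mulrA; congr (_ * _); move: bE FR; set x := c%:R; set f := F%:R; set K := k%:R => bE FR.
have -> : (f - 1 - b * (x + 3)) * (x + 2) = (f - 1) * (x + 2) - b * ((x + 4 - 1) * (x + 4 - 2)) by ring.
rewrite bE; have -> : x = K + f - 4 by lra.
ring.
Qed.

Lemma excess_hook1_gt0 c k : (2 < c)%N -> (1 < k)%N -> (k <= c.+2)%N ->
  0 < excess (hook c.+4 c.+4 1) k.
Proof.
move=> c2 k1 kc; have cR := natr_ge c2.
have [F EF FR] := @fixpts c.+4 k ltac:(lia); have F2 : (1 < F)%N by lia.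
have x2 : 0 < c%:R + 2 :> rat by lra.
rewrite -(pmulr_lgt0 _ x2) (excess_hook1 c2 EF k1) mulr_gt0 //; first by apply: ncyc_gt0; lia.
have := natr_ge F2; have := natr_ge k1; have : 0 <= (k == 2)%:R :> rat by rewrite ler0n.
nra.
Qed.

Lemma excess_hook1_top c : (2 < c)%N ->
  excess (hook c.+4 c.+4 1) c.+3 = 0 /\
  excess (hook c.+4 c.+4 1) c.+4 * (c%:R + 2) = - c.+4`!%:R.
Proof.
move=> c2; have cR := natr_ge c2; have x2 : c%:R + 2 != 0 :> rat by apply/eqP; lra.
split.
  apply: (mulIf x2); rewrite (@excess_hook1 c c.+3 1) ?addn1 // mul0r.
  have -> : (c.+3 == 2)%:R = 0 :> rat by [].
  by rewrite subrr; ring.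
rewrite (@excess_hook1 c c.+4 0) ?addn0 //.
have := @ncycE c.+4 0 c.+4 isT; rewrite addn0 fact0 => /(_ erefl) <-.
rewrite -[(_ == 2)%:R]/(0 : rat); ring.
Qed.

(** The product of [ncyc c.+4 k] and k(F-1) is n!/(F-1)! - n!/F!, so the sum telescopes; the
    correction at k = 2 supplies the missing n!/(n-2)!. *)
Lemma sum_excess_hook1 c m : (2 < c)%N -> (0 < m)%N -> (m <= c.+1)%N ->
  (\sum_(k <- iota 2 m) excess (hook c.+4 c.+4 1) k) * (c%:R + 2) =
  c.+4`!%:R / (c.+2 - m)`!%:R.
Proof.
move=> c2; have cR := natr_ge c2.
elim: m => // m IH _ mc; have [m0|m0] := posnP m.
  rewrite m0 big_cons big_nil addr0 subn1 /= (@excess_hook1 c 2 c.+2) //.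
  have E := @ncycE c.+4 c.+2 2 isT erefl; rewrite factS natrM in E.
  rewrite eqxx -[true%:R]/(1 : rat) -E.
  have f0 : c.+1`!%:R != 0 :> rat by rewrite pnatr_eq0 -lt0n fact_gt0.
  have -> : c.+2%:R = c%:R + 2 :> rat by rewrite -[c.+2]addn2 natrD.
  by field.
rewrite iotaS_cat big_cat /= big_cons big_nil addr0 mulrDl IH //; last by lia.
have [F EF FR] := @fixpts c.+4 (2 + m) ltac:(lia).
have F2 : (1 < F)%N by lia.
rewrite (excess_hook1 c2 EF) //.
have E := @ncycE c.+4 F (2 + m) isT EF.
have -> : (c.+2 - m)%N = F by lia.
have -> : (c.+2 - m.+1)%N = F.-1 by lia.
have -> : (2 + m == 2)%N = false by lia.
rewrite -[false%:R]/(0 : rat) mulr0 addr0.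
have f1 : F`!%:R = F%:R * F.-1`!%:R :> rat by rewrite -natrM; case: (F) F2.
have f0 : F.-1`!%:R != 0 :> rat by rewrite pnatr_eq0 -lt0n fact_gt0.
have F0 : F%:R != 0 :> rat by rewrite pnatr_eq0 -lt0n ltnW.
rewrite -E f1; field.
by rewrite F0 f0.
Qed.

(** The terms up to n-2 are all positive and together cancel the n-cycle term exactly, so omitting
    any length makes the total negative. *)
Lemma hook1_le c (I : {pred nat}) : (2 < c)%N -> c.+3 \in I -> c.+4 \in I ->
  \sum_(k <- kall c.+4 I) excess (hook c.+4 c.+4 1) k <= 0 /\
  (if Ifull c I then \sum_(k <- kall c.+4 I) excess (hook c.+4 c.+4 1) k = 0
   else \sum_(k <- kall c.+4 I) excess (hook c.+4 c.+4 1) k < 0).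
Proof.
move=> c2 I3 I4; have cR := natr_ge c2; have x2 : 0 < c%:R + 2 :> rat by lra.
have [E3 E4] := excess_hook1_top c2.
have S := @sum_excess_hook1 c c.+1 c2 isT (leqnn _).
rewrite subSnn (_ : 1`! = 1%N) // divr1 in S.
rewrite sum_kall // E3 addr0; set X4 := excess _ c.+4 in E4 *.
set f := excess _ in E3 S X4 E4 *.
have S0 : \sum_(k <- iota 2 c.+1) f k + X4 = 0.
  by apply: (mulIf (lt0r_neq0 x2)); rewrite mulrDl S E4 mul0r subrr.
have pos k : k \in iota 2 c.+1 -> 0 < f k.
  by rewrite mem_iota => kc; apply: excess_hook1_gt0 => //; lia.
rewrite big_filter; move: S0; rewrite (bigID (mem I)) /=.
set A := (X in X + _ + _ = 0); set B := (X in _ + X + _ = 0) => S0; rewrite -/A.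
have B0 : 0 <= B by rewrite /B big_seq_cond sumr_ge0 // => k /andP[/pos/ltW].
case: ifP => [/allP full|/negbT/allPn[k0 k0c nk0]].
  have B00 : B = 0 by rewrite /B big_seq_cond big1 // => k /andP[/full /= ->].
  by split; lra.
have Bp : 0 < B.
  have m0 : k0 \in [seq i <- iota 2 c.+1 | i \notin I] by rewrite mem_filter k0c andbT.
  have u0 : uniq [seq i <- iota 2 c.+1 | i \notin I] by rewrite filter_uniq ?iota_uniq.
  have -> : B = \sum_(i <- [seq i <- iota 2 c.+1 | i \notin I]) f i by rewrite big_filter.
  rewrite (bigD1_seq k0) // ltr_pwDl ?pos // big_seq_cond sumr_ge0 // => k /andP[].
  by rewrite mem_filter => /andP[_ /pos/ltW].
by split; lra.
Qed.

Lemma kall_bounds n (I : {pred nat}) k : (0 < n)%N -> k \in kall n I -> (1 < k <= n)%N.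
Proof. by rewrite mem_filter mem_iota => n0 /andP[_ kc]; lia. Qed.

(** For odd n the twist keeps the value at n-cycles; elsewhere (n-1,1) has the nonnegative value
    F-1, which a sign can only lower. *)
Lemma hook_std_le c (I : {pred nat}) : (2 < c)%N -> odd c -> c.+3 \in I -> c.+4 \in I ->
  \sum_(k <- kall c.+4 I) excess (hook c.+4 c.+4 c.+2) k <=
  \sum_(k <- kall c.+4 I) excess (hook c.+4 c.+4 1) k.
Proof.
move=> c2 co I3 I4; rewrite big_seq [X in _ <= X]big_seq; apply: ler_sum => k /kall_bounds.
move=> /(_ isT) /andP[k1 kc]; rewrite /excess (zv_hook_deg1 c).1 (zv_hook_deg1 c).2.1.
rewrite ler_pM2l; last by apply: ncyc_gt0; lia.
apply: lerB => //.
have [F EF FR] := @fixpts c.+4 k ltac:(lia).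
rewrite (zv_hook1_val c2 EF k1); have [F0|F0] := posnP F.
  have -> : k = c.+4 by lia.
  by rewrite zv_hook_topc ?F0 // sgn_cases /= co /=; lra.
have [_] := @zv_hook_std c.+4 k F k1 F0 ltac:(lia); rewrite -EF !subSS subn0 => ->.
have := natr_ge F0; rewrite sgn_cases; case: odd; lra.
Qed.

(** The right-hand side grows by the factor c+1-m at each step, which outpaces the new term. *)
Lemma even_tail c m : (2 < c)%N -> (m + 3 <= c)%N ->
  \sum_(k <- iota 2 m) (if odd k then 0 else ncyc c.+4 k * ((c.+4 - k)%:R - 1)) <=
  c.+3`!%:R / (c.+1 - m)`!%:R.
Proof.
move=> c2; elim: m => [|m IH] mc.
  by rewrite big_nil divr_ge0.
rewrite iotaS_cat big_cat /= big_cons big_nil addr0.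
have {}IH := IH ltac:(lia).
have [F EF FR] := @fixpts c.+4 (2 + m) ltac:(lia).
have F6 : (5 < F)%N by lia.
have k2 : (1 < 2 + m)%N by lia.
have -> : (c.+4 - (2 + m))%N = F by lia.
have E1 : (c.+1 - m)%N = F.-1 by lia.
have -> : (c.+1 - m.+1)%N = F.-2 by lia.
rewrite E1 in IH; have E := @ncycE c.+4 F (2 + m) isT EF.
set K : rat := (2 + m)%:R in E FR *; have KR : 2 <= K by apply: natr_ge.
have FR6 := natr_ge F6; set f : rat := F%:R in E FR FR6 *.
have f2 : F`!%:R = f * (f - 1) * F.-2`!%:R :> rat.
  rewrite /f; case: (F) F6 => [//|[//|F']] _ /=.
  by rewrite !factS !natrM -[F'.+2%:R]natr1 addrK mulrA.
have f1 : F.-1`!%:R = (f - 1) * F.-2`!%:R :> rat.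
  rewrite /f; case: (F) F6 => [//|[//|F']] _ /=.
  by rewrite !factS !natrM -[F'.+2%:R]natr1 addrK.
have g0 : 0 < F.-2`!%:R :> rat by rewrite ltr0n fact_gt0.
set g : rat := F.-2`!%:R in f1 f2 g0 *; set u : rat := c.+3`!%:R in IH *.
have u0 : 0 < u by rewrite ltr0n fact_gt0.
have nE : c.+4`!%:R = (K + f) * u by rewrite factS natrM FR.
set w := ncyc _ _ in E *.
have w0 : 0 < w by apply: ncyc_gt0; lia.
have T : (if odd (2 + m) then 0 else w * (f - 1)) <= w * (f - 1).
  by case: ifP => // _; nra.
have wE : w = (K + f) * u / (K * (f * (f - 1) * g)).
  rewrite -nE -E f2; field.
  by do ?[apply/andP; split]; apply/eqP; lra.
apply: le_trans (lerD IH T) _; rewrite f1 wE.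
have f10 : 0 < f - 1 by lra.
have ff : 0 < f by lra.
have KK : 0 < K by lra.
have P0 : 0 < K * f * (f - 1) * g by rewrite !mulr_gt0.
rewrite -(ler_pM2r P0).
have -> : (u / ((f - 1) * g) + (K + f) * u / (K * (f * (f - 1) * g)) * (f - 1)) * (K * f * (f - 1) * g) =
   u * (K * f + (K + f) * (f - 1)).
  by field; do ?[apply/andP; split]; apply/eqP; lra.
have -> : u / g * (K * f * (f - 1) * g) = u * (K * f * (f - 1)).
  by field; apply/eqP; lra.
rewrite ler_pM2l //; have : 0 <= (K - 2) * (f * (f - 3) + 1) by rewrite mulr_ge0 //; nra.
nra.
Qed.

(** Compared with (n-1,1), whose total excess is 0, the twist loses 2 [a k] at each even length
    below n and gains 2 for every n-cycle. So the sum of [a] has to stay below the number of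
    n-cycles. *)
Lemma hook_std_full_gt c (I : {pred nat}) : (2 < c)%N -> ~~ odd c -> c.+3 \in I -> c.+4 \in I ->
  Ifull c I -> 0 < \sum_(k <- kall c.+4 I) excess (hook c.+4 c.+4 c.+2) k.
Proof.
move=> c2 ce I3 I4 full; have c4 : (3 < c)%N by case: c c2 ce {I3 I4 full} => [|[|[|[|]]]].
have cR := natr_ge c4; have := (hook1_le c2 I3 I4).2; rewrite full.
pose a k : rat := if odd k then 0 else ncyc c.+4 k * ((c.+4 - k)%:R - 1).
have dif k : (1 < k)%N -> (k <= c.+3)%N ->
    excess (hook c.+4 c.+4 c.+2) k = excess (hook c.+4 c.+4 1) k - 2 * a k.
  move=> k1 kc; rewrite /excess (zv_hook_deg1 c).1 (zv_hook_deg1 c).2.1.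
  have [F EF FR] := @fixpts c.+4 k ltac:(lia).
  have [_] := @zv_hook_std c.+4 k F k1 ltac:(lia) ltac:(lia); rewrite -EF !subSS subn0 => ->.
  rewrite (zv_hook1_val c2 EF k1) /a; have -> : (c.+4 - k)%N = F by lia.
  have ek : odd k.-1 = ~~ odd k by case: (k) k1 => //= k' _; rewrite negbK.
  by rewrite sgn_cases ek; case: (odd k) => /=; ring.
have dif4 : excess (hook c.+4 c.+4 c.+2) c.+4 = excess (hook c.+4 c.+4 1) c.+4 + 2 * ncyc c.+4 c.+4.
  rewrite /excess (zv_hook_deg1 c).1 (zv_hook_deg1 c).2.1 !zv_hook_topc //.
  by rewrite !sgn_cases /= (negbTE ce) /=; ring.
have ksE : ksmall c I = iota 2 c.+1 by apply/all_filterP.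
rewrite !sum_kall // !ksE dif4 (dif c.+3) //.
have -> : \sum_(k <- iota 2 c.+1) excess (hook c.+4 c.+4 c.+2) k =
    \sum_(k <- iota 2 c.+1) excess (hook c.+4 c.+4 1) k - 2 * \sum_(k <- iota 2 c.+1) a k.
  rewrite mulr_sumr -sumrB; apply: eq_big_seq => k; rewrite mem_iota => kc.
  by apply: dif; lia.
move=> S; have a3 : a c.+3 = 0 by rewrite /a /= ce.
(* In units of p = (n-1)!, the number of n-cycles: at most 2/3 for length n-2, 1/4 for n-4 and 1/24
   for the shorter ones, together 23/24. *)
have A : \sum_(k <- iota 2 c.+1) a k < ncyc c.+4 c.+4.
  have [w4E w3E w2E w1E w0E] := @ncyc_topE c ltac:(lia).
  have T := @even_tail c (c - 3) c2 ltac:(lia).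
  have -> : iota 2 c.+1 = iota 2 (c - 3) ++ [:: c.-1; c; c.+1; c.+2].
    have -> : c.+1 = ((c - 3) + 4)%N by lia.
    rewrite iotaD; congr (_ ++ _) => /=.
    by do 4?[congr (_ :: _); first by lia].
  rewrite big_cat /= !big_cons big_nil.
  have -> : a c.-1 = 0 by rewrite /a; case: (c) c4 ce => //= c' _; rewrite negbK => ->.
  have -> : a c.+1 = 0 by rewrite /a /= ce.
  have a2 : a c.+2 = ncyc c.+4 c.+2.
    by rewrite /a /= negbK (negbTE ce) subSS subSS subSn // subSn // subnn; ring.
  have a0 : a c = 3 * ncyc c.+4 c.
    by rewrite /a (negbTE ce) -[c.+4]addn4 addKn; ring.
  rewrite a2 a0 addr0 !add0r; set SS := \sum_(_ <- _) _ in T *.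
  have E3 : (c.+1 - (c - 3))%N = 4 by lia.
  rewrite E3 -[4`!%:R]/(24%:R : rat) in T.
  have u0 := unit3_gt0 c.
  have u3 : c.+3`!%:R = (c%:R + 3) * (c%:R + 2) * unit3 c :> rat.
    rewrite !factS !natrM /unit3 !factS !natrM.
    have -> : c.+3%:R = c%:R + 3 :> rat by rewrite -[c.+3]addn3 natrD.
    have -> : c.+2%:R = c%:R + 2 :> rat by rewrite -[c.+2]addn2 natrD.
    by ring.
  rewrite u3 in T; rewrite w4E; move: T w2E w0E; set x : rat := c%:R in cR *; set u := unit3 c in u0 *.
  set w2 := ncyc _ _; set w0 := ncyc _ _ => T w2E w0E.
  set p := (x + 3) * (x + 2) * u in T *; have p0 : 0 < p by rewrite !mulr_gt0 //; lra.
  have B2 : w2 <= 2 / 3 * p.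
    have : 3 * (x + 4) <= 4 * (x + 2) by lra.
    move/(ler_wpM2l (ltW u0)) => H; have x3 : 0 <= x + 3 by lra.
    by have := ler_wpM2l x3 H; rewrite /p; lra.
  have B0 : 3 * w0 <= p / 4.
    have x0 : 0 < x by lra.
    rewrite -(ler_pM2r x0); have : (x + 4) * p <= 2 * x * p by rewrite ler_wpM2r ?(ltW p0) //; lra.
    by rewrite /p; rewrite /p in T; lra.
  lra.
lra.
Qed.

(** The loss at the even length k is at most twice the number of k-cycles, and the gain at the odd
    length k+1 makes up for it. *)
Lemma sgn_pair c k : (2 < c)%N -> (1 < k)%N -> (k < c)%N -> odd k = false ->
  0 <= excess (hook c.+4 c.+4 c.+3) k + excess (hook c.+4 c.+4 c.+3) k.+1.
Proof.
move=> c2 k1 kc ko; have cR := natr_ge c2.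
have [F EF FR] := @fixpts c.+4 k.+1 ltac:(lia).
have F4 : (3 < F)%N by lia.
have EF' : c.+4 = (k + F.+1)%N by lia.
have ek : odd k.-1 by case: (k) k1 ko => //= k' _ /negbFE.
have Z1 : zv (hook c.+4 c.+4 c.+3) k = -1.
  by have := @zv_hook_sgn c.+4 k F.+1 ltac:(lia) ltac:(lia); rewrite -EF' /= sgn_cases ek.
have Z2 : zv (hook c.+4 c.+4 c.+3) k.+1 = 1.
  by have := @zv_hook_sgn c.+4 k.+1 F ltac:(lia) ltac:(lia); rewrite -EF /= sgn_cases ko.
rewrite /excess Z1 Z2 (zv_hook_deg1 c).2.2 !mulr1.
have E1 := @ncycE c.+4 F.+1 k ltac:(lia) EF'; have E2 := @ncycE c.+4 F k.+1 isT EF.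
have B1 := @betaE c.+4 F.+1 k isT EF'; have B2 := @beta0E c.+4 F k.+1 isT EF k1.
rewrite factS natrM -[F.+1%:R]natr1 in E1; rewrite -[F.+1%:R]natr1 natr4 in B1.
rewrite -[k.+1%:R]natr1 in E2 FR; rewrite natr4 in B2 FR.
have kR := natr_ge k1; have FR4 := natr_ge F4; have d0 : 0 <= (k == 2)%:R :> rat by rewrite ler0n.
have w10 := @ncyc_gt0 c.+4 k ltac:(lia); have w20 := @ncyc_gt0 c.+4 k.+1 ltac:(lia).
have G0 : 0 < F`!%:R :> rat by rewrite ltr0n fact_gt0.
move: E1 E2 B1 B2 w10 w20; set w1 := ncyc _ k; set w2 := ncyc _ k.+1; set b1 := beta _ k; set b2 := beta _ k.+1.
set G : rat := F`!%:R in G0 *; set H : rat := c.+4`!%:R; set x : rat := c%:R in cR FR *; set f : rat := F%:R in FR FR4 *.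
set K : rat := k%:R in kR FR *; set d : rat := _%:R in d0 * => E1 E2 B1 B2 w10 w20.
have N0 : 0 < (x + 4 - 1) * (x + 4 - 2) by nra.
have b1le : b1 <= 1 by rewrite -(ler_pM2r N0) B1 mul1r; nra.
have wr : w1 * (K * (f + 1)) = w2 * (K + 1).
  apply: (mulIf (lt0r_neq0 G0)); have -> : w1 * (K * (f + 1)) * G = H by rewrite -E1; ring.
  by rewrite -E2; ring.
have K1 : 0 < K * (f + 1) by nra.
have NE : (x + 4 - 1) * (x + 4 - 2) * (1 - b2) = (K + 1) * (x + 1 + f).
  have -> : (x + 4 - 1) * (x + 4 - 2) * (1 - b2) = (x + 4 - 1) * (x + 4 - 2) - b2 * ((x + 4 - 1) * (x + 4 - 2)) by ring.
  have xE : x = K + 1 + f - 4 by lra.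
  by rewrite B2 xE; ring.
suff P : 2 * w1 <= w2 * (1 - b2).
  have : w1 * b1 <= w1 by rewrite -[X in _ <= X]mulr1 ler_pM2l.
  by lra.
rewrite -(ler_pM2r N0) -(ler_pM2r K1).
have -> : 2 * w1 * ((x + 4 - 1) * (x + 4 - 2)) * (K * (f + 1)) = (w1 * (K * (f + 1))) * (2 * ((x + 4 - 1) * (x + 4 - 2))) by ring.
have -> : w2 * (1 - b2) * ((x + 4 - 1) * (x + 4 - 2)) * (K * (f + 1)) = ((x + 4 - 1) * (x + 4 - 2) * (1 - b2)) * (w2 * (K * (f + 1))) by ring.
rewrite wr NE.
have -> : (K + 1) * (x + 1 + f) * (w2 * (K * (f + 1))) = w2 * (K + 1) * ((x + 1 + f) * (K * (f + 1))) by ring.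
rewrite ler_pM2l; last by rewrite mulr_gt0 //; lra.
have P1 : 2 * (x + 2) <= K * (f + 1).
  by have -> : x = K + 1 + f - 4 by [lra]; have : 0 <= (K - 2) * (f - 1) by [rewrite mulr_ge0 //; lra]; lra.
have x1 : 0 <= x + 1 + f by lra.
by have := ler_wpM2l x1 P1; nra.
Qed.

Lemma sgn_full_gt c (I : {pred nat}) : (2 < c)%N -> odd c -> c.+3 \in I -> c.+4 \in I ->
  Ifull c I -> 0 < \sum_(k <- kall c.+4 I) excess (hook c.+4 c.+4 c.+3) k.
Proof.
move=> c2 co I3 I4 full; have cR := natr_ge c2.
have ksE : ksmall c I = iota 2 c.+1 by apply/all_filterP.
rewrite sum_kall // ksE; set f := excess _.
have low p : (p.*2 < c)%N -> 0 <= \sum_(k <- iota 2 p.*2) f k.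
  elim: p => [|p IH] pc; first by rewrite big_nil.
  have -> : p.+1.*2 = (p.*2 + 2)%N by lia.
  rewrite iotaD big_cat /= !big_cons big_nil addr0.
  rewrite addr_ge0 ?IH //; first by lia.
  by rewrite -addnS; apply: sgn_pair => //; rewrite ?addnS; try lia; rewrite oddD odd_double.
(* For odd c the lengths 2,..,c fall into such pairs; the four longest lengths are computed. *)
have E : iota 2 c.+1 = iota 2 (c.-1./2).*2 ++ [:: c.+1; c.+2].
  have -> : (c.-1./2).*2 = c.-1 by case: (c) co => //= c' /negbTE co; rewrite -[RHS]odd_double_half co.
  have -> : c.+1 = (c.-1 + 2)%N by lia.
  rewrite iotaD; congr (_ ++ _) => /=.
  by do 2?[congr (_ :: _); first by lia].
have L := low (c.-1./2) ltac:(lia).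
rewrite E big_cat /= !big_cons big_nil addr0.
have [w4E w3E w2E w1E _] := @ncyc_topE c ltac:(lia).
have [b4E b3E b2E b1E _] := beta_topE c2.
have sg k F : c.+4 = (k + F)%N -> (0 < k)%N -> f k = ncyc c.+4 k * ((-1) ^+ k.-1 - beta c.+4 k).
  move=> EF k0; have := @zv_hook_sgn c.+4 k F k0 ltac:(lia); rewrite -EF /= => Z.
  by rewrite /f /excess Z (zv_hook_deg1 c).2.2 mulr1.
rewrite (sg c.+1 3) ?addn3 // (sg c.+2 2) ?addn2 // (sg c.+3 1) ?addn1 // (sg c.+4 0) ?addn0 //.
rewrite b3E b2E !sgn_cases /= !negbK co /= !subr0.
have u0 := unit3_gt0 c.
move: L w4E w3E w2E w1E b4E b1E; set SS := \sum_(_ <- _) _.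
set x : rat := c%:R in cR *; set u := unit3 c in u0 *; set w4 := ncyc _ c.+4; set w3 := ncyc _ c.+3.
set w2 := ncyc _ c.+2; set w1 := ncyc _ c.+1; set b4 := beta _ _; set b1 := beta _ _.
move=> L w4E w3E w2E w1E b4E b1E.
have x1 : 0 < 6 * (x + 1) by lra.
have T4 : w4 * (1 - b4) = ((x + 3) * (x + 2) - 2) * u.
  have -> : w4 * (1 - b4) = w4 - b4 * w4 by ring.
  rewrite w4E; have -> : b4 * ((x + 3) * (x + 2) * u) = (b4 * ((x + 3) * (x + 2))) * u by ring.
  by rewrite b4E; ring.
have T1 : 6 * (x + 1) * (w1 * (-1 - b1)) = - ((x + 4) * ((x + 3) * (x + 2) + 2) * u).
  have -> : 6 * (x + 1) * (w1 * (-1 - b1)) = - (6 * (x + 1) * w1) * (1 + b1) by ring.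
  rewrite w1E.
  have -> : - ((x + 4) * (x + 3) * (x + 2) * u) * (1 + b1) = - ((x + 4) * u * ((x + 3) * (x + 2) + b1 * ((x + 3) * (x + 2)))) by ring.
  by rewrite b1E; ring.
suff : 0 < w1 * (-1 - b1) + w2 - w3 + w4 * (1 - b4) by lra.
rewrite -(pmulr_rgt0 _ x1) mulrDr mulrDr mulrDr T1 T4 w3E.
have -> : w2 = (x + 4) * (x + 3) * u / 2 by lra.
have -> : - ((x + 4) * ((x + 3) * (x + 2) + 2) * u) + 6 * (x + 1) * ((x + 4) * (x + 3) * u / 2) +
  6 * (x + 1) * - ((x + 4) * (x + 2) * u) + 6 * (x + 1) * (((x + 3) * (x + 2) - 2) * u) =
  u * (x + 4) * (2 * x ^+ 2 + x - 5) by field.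
by rewrite !mulr_gt0 //; [lra|rewrite expr2; nra].
Qed.

(** * Every other nontrivial character is strictly dominated *)

Definition nlam c (I : {pred nat}) (phi : 'CF(SN c.+4 c.+4)) : rat :=
  (\sum_(k <- kall c.+4 I) ncyc c.+4 k * zv phi k) / zv phi 1.

Definition blam c (I : {pred nat}) : rat := \sum_(k <- kall c.+4 I) ncyc c.+4 k * beta c.+4 k.

Lemma sum_excessE c (I : {pred nat}) (phi : 'CF(SN c.+4 c.+4)) :
  \sum_(k <- kall c.+4 I) excess phi k =
  \sum_(k <- kall c.+4 I) ncyc c.+4 k * zv phi k - blam c I * zv phi 1.
Proof. by rewrite mulr_suml -sumrB; apply: eq_bigr => k _; rewrite /excess; ring. Qed.

Lemma nlam_lt c (I : {pred nat}) (phi : 'CF(SN c.+4 c.+4)) : phi \in irr (SN c.+4 c.+4) ->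
  \sum_(k <- kall c.+4 I) excess phi k < 0 -> nlam I phi < blam c I.
Proof.
move=> ip; have D0 : 0 < zv phi 1 by apply: zv1_gt0; rewrite ?leqnn.
by rewrite sum_excessE /nlam ltr_pdivrMr // subr_lt0.
Qed.

Lemma nlam_gt c (I : {pred nat}) (phi : 'CF(SN c.+4 c.+4)) : phi \in irr (SN c.+4 c.+4) ->
  0 < \sum_(k <- kall c.+4 I) excess phi k -> blam c I < nlam I phi.
Proof.
move=> ip; have D0 : 0 < zv phi 1 by apply: zv1_gt0; rewrite ?leqnn.
by rewrite sum_excessE /nlam ltr_pdivlMr // subr_gt0.
Qed.

Lemma nlam_le c (I : {pred nat}) (phi : 'CF(SN c.+4 c.+4)) : phi \in irr (SN c.+4 c.+4) ->
  \sum_(k <- kall c.+4 I) excess phi k <= 0 -> nlam I phi <= blam c I.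
Proof.
move=> ip; have D0 : 0 < zv phi 1 by apply: zv1_gt0; rewrite ?leqnn.
by rewrite sum_excessE /nlam ler_pdivrMr // subr_le0.
Qed.

Lemma nlam_hook2 c (I : {pred nat}) : (2 < c)%N -> nlam I (hook c.+4 c.+4 2) = blam c I.
Proof.
move=> c2; have ih : hook c.+4 c.+4 2 \in irr (SN c.+4 c.+4) by apply: hook_irr; rewrite leqnn.
have D0 : 0 < zv (hook c.+4 c.+4 2) 1 by apply: zv1_gt0; rewrite ?leqnn.
rewrite /nlam; apply: (canLR (mulfK (lt0r_neq0 D0))); rewrite mulr_suml.
apply: eq_big_seq => k /(@kall_bounds c.+4 I _ isT) kb.
by rewrite zv_hook2_beta ?mulrA //; lia.
Qed.

Lemma blam_gt0 c (I : {pred nat}) : (2 < c)%N -> c.+3 \in I -> c.+4 \in I -> 0 < blam c I.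
Proof.
move=> c2 I3 I4; have cR := natr_ge c2; rewrite /blam sum_kall //.
have [b4E b3E _ _ _] := beta_topE c2; rewrite b3E mulr0 addr0.
have b4 : 0 < beta c.+4 c.+4.
  have P : 0 < (c%:R + 3) * (c%:R + 2) :> rat by nra.
  by rewrite -(pmulr_lgt0 _ P) b4E.
apply: ltr_wpDl; last by rewrite mulr_gt0 // ncyc_gt0 // leqnn.
rewrite big_seq sumr_ge0 // => k /ksmallP kc; rewrite mulr_ge0 ?beta_ge0 //; try lia.
by apply: ltW; apply: ncyc_gt0; lia.
Qed.

Lemma hook_neq n N m j : (m < N)%N -> (j < N)%N -> (N <= n)%N -> m != j -> hook n N m != hook n N j.
Proof.
move=> mN jN Nn mj; apply/eqP=> E; have := hook_dot mN jN Nn; rewrite -E hook_dot // eqxx (negbTE mj).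
by move/eqP; rewrite oner_eq0.
Qed.

(** The shapes (1^n), (n-2,1,1) and, for odd n, (3,1^(n-3)) and (2,2,1^(n-4)), for even n,
    (2,1^(n-2)); n and c have the same parity. *)
Definition extremal c : seq 'CF(SN c.+4 c.+4) :=
  if odd c then [:: hook c.+4 c.+4 c.+3; hook c.+4 c.+4 2; hook c.+4 c.+4 c.+1; near c.+4 c.+4 c.+1]
  else [:: hook c.+4 c.+4 c.+3; hook c.+4 c.+4 2; hook c.+4 c.+4 c.+2].

Lemma dominated c (I : {pred nat}) (phi : 'CF(SN c.+4 c.+4)) :
  (2 < c)%N -> c.+3 \in I -> c.+4 \in I -> phi \in irr (SN c.+4 c.+4) ->
  phi != hook c.+4 c.+4 0 -> phi \notin extremal c ->
  exists2 psi, psi \in irr (SN c.+4 c.+4) & psi != hook c.+4 c.+4 0 /\ nlam I phi < nlam I psi.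
Proof.
move=> c2 I3 I4 ip p0 pe.
have Hi m : (m < c.+4)%N -> hook c.+4 c.+4 m \in irr (SN c.+4 c.+4).
  by move=> mc; apply: hook_irr; rewrite mc leqnn.
have Hn m : (0 < m < c.+4)%N -> hook c.+4 c.+4 m != hook c.+4 c.+4 0.
  by case/andP=> m0 mc; apply: hook_neq; rewrite // -lt0n.
have viaB : \sum_(k <- kall c.+4 I) excess phi k < 0 ->
    exists2 psi, psi \in irr (SN c.+4 c.+4) & psi != hook c.+4 c.+4 0 /\ nlam I phi < nlam I psi.
  move=> lt; exists (hook c.+4 c.+4 2); first exact: Hi.
  by rewrite Hn // nlam_hook2 //; split=> //; apply: nlam_lt.
have viaF m : (0 < m < c.+4)%N -> nlam I phi <= blam c I ->
    0 < \sum_(k <- kall c.+4 I) excess (hook c.+4 c.+4 m) k ->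
    exists2 psi, psi \in irr (SN c.+4 c.+4) & psi != hook c.+4 c.+4 0 /\ nlam I phi < nlam I psi.
  move=> mc le gt; have mc' : (m < c.+4)%N by case/andP: mc.
  exists (hook c.+4 c.+4 m); first exact: Hi.
  by rewrite Hn //; split=> //; apply: le_lt_trans le _; apply: nlam_gt => //; apply: Hi.
have [l1|l1] := boolP (phi \in lev1 c.+4 c.+4); last first.
  have [l2|l2] := boolP (phi \in lev2 c.+4 c.+4); last first.
    by apply: viaB; apply: deep_lt => //; rewrite /deep /inner ip l1.
  move: l2 pe; rewrite /lev2 /extremal !subSS subn0 !inE.
  case/or4P=> /eqP Ep; rewrite Ep in viaB *.
  - by case: ifP; rewrite !inE eqxx ?orbT.
  - by move=> _; apply: viaB; apply: near1_lt.
  - case: ifP => [_|/negbT co]; first by rewrite !inE eqxx ?orbT.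
    by move=> _; apply: viaB; apply: hook_twist2_lt.
  case: ifP => [_|/negbT co]; first by rewrite !inE eqxx ?orbT.
  by move=> _; apply: viaB; apply: near_twist_lt.
have [le1 st1] := hook1_le c2 I3 I4.
have tie : nlam I phi <= blam c I -> Ifull c I -> 
    exists2 psi, psi \in irr (SN c.+4 c.+4) & psi != hook c.+4 c.+4 0 /\ nlam I phi < nlam I psi.
  move=> le full; have [co|co] := boolP (odd c).
    exact: (viaF c.+3 (ltnSn _ : (0 < c.+3 < c.+4)%N) le (sgn_full_gt c2 co I3 I4 full)).
  exact: (viaF c.+2 (leqnSn _ : (0 < c.+2 < c.+4)%N) le (hook_std_full_gt c2 co I3 I4 full)).
move: l1 pe p0; rewrite /lev1 /extremal !subSS !subn0 !inE.
case/or4P=> /eqP Ep; rewrite Ep in viaB tie *.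
- by rewrite eqxx.
- move=> _ _; move: st1; case: ifP => [full _|_ lt]; last exact: viaB.
  by apply: tie => //; apply: nlam_le => //; apply: Hi.
- case: ifP => [co|_]; last by rewrite !inE eqxx ?orbT.
  move=> _ _; have le := hook_std_le c2 co I3 I4.
  move: st1; case: ifP => [full _|_ lt]; last by apply: viaB; apply: le_lt_trans le lt.
  by apply: tie => //; apply: nlam_le; [apply: Hi|apply: le_trans le le1].
by case: ifP; rewrite !inE eqxx ?orbT.
Qed.

(** * Spectrum of a Cayley graph with conjugation-invariant connection set *)

(** Schur's lemma: the sum of [S] acts as a scalar in an irreducible representation, and the trace
    at the identity determines that scalar. *)
Lemma irr_sum_normal (gT : finGroupType) (G : {group gT}) (S : {set gT})
    (i : Iirr G) x :
  S \subset G -> (forall s y, s \in S -> y \in G -> (s ^ y)%g \in S) -> x \in G ->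
  \sum_(s in S) 'chi_i (s * x)%g =
  (\sum_(s in S) 'chi_i s) / 'chi_i 1%g * 'chi_i x.
Proof.
move=> sSG nS Gx; have sG := subsetP sSG; pose rG := 'Chi_i.
pose M := \sum_(s in S) rG s.
have /is_scalar_mxP[a Ma] : is_scalar_mx M.
  apply: (mx_abs_irr_cent_scalar (rG := rG)).
    by apply: groupC; apply: socle_irr.
  apply/centgmxP=> y Gy; rewrite mulmx_suml mulmx_sumr.
  rewrite [RHS](reindex_inj (conjg_inj y)) /=; apply: eq_big => [s|s Ss].
    apply/idP/idP=> [Ss|Ss]; first exact: nS.
    by rewrite -[s](conjgK y); apply: nS; rewrite ?groupV.
  by have Gs := sG s Ss; rewrite -!repr_mxM ?groupJ // -conjgC.
have chiE y : y \in G -> 'chi_i y = \tr (rG y).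
  by move=> Gy; rewrite -irrRepr cfunE Gy.
have E0 y : y \in G -> \sum_(s in S) 'chi_i (s * y)%g = a * 'chi_i y.
  move=> Gy; rewrite (chiE y) // -mxtraceZ -mul_scalar_mx -Ma mulmx_suml raddf_sum.
  apply: eq_bigr => s Ss; have Gs := sG s Ss.
  by rewrite (chiE _ (groupM Gs Gy)) (repr_mxM rG Gs Gy).
rewrite (E0 x Gx); congr (_ * _).
have := E0 1%g (group1 G); under eq_bigr do rewrite mulg1.
by move=> ->; rewrite mulfK ?irr1_neq0.
Qed.

Lemma char_poly_similar_diag (F : fieldType) m (P : 'M[F]_m) (d : 'rV[F]_m) :
  P \in unitmx -> char_poly (invmx P *m diag_mx d *m P) = \prod_(i < m) ('X - (d 0 i)%:P).
Proof.
move=> uP; rewrite /char_poly /char_poly_mx.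
have uP' : map_mx polyC P \in unitmx by rewrite map_unitmx.
have -> : 'X%:M - map_mx polyC (invmx P *m diag_mx d *m P) =
   invmx (map_mx polyC P) *m ('X%:M - map_mx polyC (diag_mx d)) *m map_mx polyC P.
  rewrite mulmxBr mulmxBl !map_mxM map_invmx -!mulmxA; congr (_ - _).
  by rewrite mul_scalar_mx -scalemxAr mulVmx // scalemx1.
rewrite !det_mulmx mulrAC -det_mulmx mulVmx // det1 mul1r.
have := @char_poly_trig _ _ (diag_mx d) (diag_mx_is_trig d).
by rewrite /char_poly /char_poly_mx => ->; apply: eq_bigr => i _; rewrite mxE eqxx mulr1n.
Qed.

Section CayleySpectrum.

Variables (gT : finGroupType) (G : {group gT}) (S : {set gT}).
Hypothesis GT : forall x, x \in G.
Hypothesis invS : forall s, s \in S -> (s^-1)%g \in S.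
Hypothesis conjS : forall s y, s \in S -> (s ^ y)%g \in S.

Definition cayley_eigenvalue (i : Iirr G) : algC :=
  (\sum_(s in S) 'chi_i s) / 'chi_i 1%g.

Let A := adjacency_mx (cayley S).

Let AE i j : A i j = ((enum_val i)^-1 * enum_val j \in S)%g%:R.
Proof.
rewrite mxE /= /cayley /=; congr ((nat_of_bool _)%:R).
apply/exists_inP/idP=> [[s Ss /orP[/eqP->|/eqP->]]|Ss].
- by rewrite mulKg.
- by rewrite invMg mulgKV invS.
by exists ((enum_val i)^-1 * enum_val j)%g => //; rewrite mulKVg eqxx.
Qed.

(** A central idempotent of the group algebra in matrix form, the projection onto an isotypic
    component of the regular representation. *)
Let E (i : Iirr G) : 'M[algC]_#|gT| :=
  \matrix_(g, h) ('chi_i 1%g / #|G|%:R * 'chi_i ((enum_val g)^-1 * enum_val h)%g).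

Let SG : S \subset G. Proof. by apply/subsetP=> s _. Qed.

Let sum_S (i : Iirr G) x : \sum_(s in S) 'chi_i (s * x)%g = cayley_eigenvalue i * 'chi_i x.
Proof. by rewrite irr_sum_normal // => s y Ss _; apply: conjS. Qed.

Let sum_enum (f : gT -> algC) : \sum_(k < #|gT|) f (enum_val k) = \sum_x f x.
Proof. by rewrite [RHS]big_enum_val. Qed.

Let AEi i : A *m E i = cayley_eigenvalue i *: E i.
Proof.
apply/matrixP=> g h; rewrite !mxE; set c := _ / _.
under eq_bigr => k _ do rewrite AE [E i k h]mxE.
rewrite (sum_enum (fun y => ((enum_val g)^-1 * y \in S)%g%:R *
   (c * 'chi_i (y^-1 * enum_val h)%g))).
rewrite mulrCA -sum_S mulr_sumr [RHS]big_mkcond /=.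
rewrite (reindex_inj (mulgI (enum_val g))) (reindex_inj invg_inj) /=.
apply: eq_bigr => s _; rewrite mulKg invMg invgK.
have -> : ((s^-1)%g \in S) = (s \in S) by apply/idP/idP=> /invS; rewrite ?invgK.
by case: (s \in S); rewrite ?mul1r ?mul0r // mulgA.
Qed.

Let EiA i : E i *m A = cayley_eigenvalue i *: E i.
Proof.
apply/matrixP=> g h; rewrite !mxE; set c := _ / _.
under eq_bigr => k _ do rewrite AE [E i g k]mxE.
rewrite (sum_enum (fun y => (c * 'chi_i ((enum_val g)^-1 * y)%g) * ((y^-1 * enum_val h)%g \in S)%:R)).
rewrite mulrCA -sum_S mulr_sumr [RHS]big_mkcond /=.
rewrite (reindex_inj (mulgI (enum_val h))) /=.
apply: eq_bigr => s _; rewrite invMg mulgKV.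
have -> : ((s^-1)%g \in S) = (s \in S) by apply/idP/idP=> /invS; rewrite ?invgK.
case: (s \in S); rewrite ?mulr1 ?mulr0 //; congr (_ * _).
set w := ((enum_val g)^-1 * enum_val h)%g.
rewrite mulgA -/w -[RHS](cfunJ _ (s * w)%g (GT s)); congr ('chi_i _).
by rewrite conjgE !mulgA mulVg mul1g.
Qed.

Let sumE : \sum_i E i = 1%:M.
Proof.
apply/matrixP=> g h; rewrite summxE !mxE.
under eq_bigr do rewrite mxE mulrAC.
rewrite -mulr_suml; set x := (_^-1 * _)%g.
have -> : \sum_(i : Iirr G) 'chi_i 1%g * 'chi_i x = cfReg G x.
  by rewrite cfReg_sum sum_cfunE; apply: eq_bigr => i _; rewrite cfunE.
rewrite cfRegE; have -> : (x == 1%g) = (g == h).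
  by rewrite /x -eq_invg_mul invgK (inj_eq enum_val_inj).
case: (g == h); last by rewrite mul0r.
by rewrite mulfV // pnatr_eq0 -lt0n cardG_gt0.
Qed.

Let eigen_proj (v : 'rV[algC]_#|gT|) mu i :
  v *m A = mu *: v -> cayley_eigenvalue i != mu -> v *m E i = 0.
Proof.
move=> vA ne; have := congr1 (mulmx^~ (E i)) vA.
rewrite -mulmxA AEi -scalemxAl -scalemxAr => /eqP; rewrite -subr_eq0 -scalerBl.
by rewrite scaler_eq0 subr_eq0 (negbTE ne) => /eqP.
Qed.

Let A_eigenvalue i : eigenvalue A (cayley_eigenvalue i).
Proof.
apply/eigenvalueP; pose r := enum_rank (1%g : gT).
exists (row r (E i)); first by rewrite -row_mul EiA linearZ.
apply/eqP=> /rowP/(_ r); rewrite !mxE enum_rankK mulVg => /eqP.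
by rewrite !mulf_eq0 invr_eq0 pnatr_eq0 (negbTE (irr1_neq0 i)) (gtn_eqF (cardG_gt0 G)).
Qed.

Let A_herm : A \is hermsymmx.
Proof.
apply: realsym_hermsym; last by apply/mxOverP=> i j; rewrite AE realn.
apply/is_hermitianmxP; rewrite expr0 scale1r; apply/matrixP=> i j.
transitivity (A j i); last by rewrite !mxE.
rewrite !AE; congr ((nat_of_bool _)%:R).
by apply/idP/idP=> /invS; rewrite invMg invgK.
Qed.

Let const_eigenvector (v : 'rV[algC]_#|gT|) :
  (forall i : Iirr G, i != 0 -> cayley_eigenvalue i != cayley_eigenvalue 0) ->
  v *m A = cayley_eigenvalue 0 *: v -> exists a, v = a *: const_mx 1.
Proof.
move=> ne vA; have : v *m 1%:M = v by rewrite mulmx1.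
rewrite -sumE mulmx_sumr (bigD1 0) //= big1 => [|i i0]; last by apply: eigen_proj vA (ne i i0).
rewrite addr0 => <-; exists (\sum_k v 0 k / #|G|%:R); apply/rowP=> h.
rewrite !mxE mulr1; apply: eq_bigr => k _.
by rewrite mxE irr0 !cfun1E !GT mul1r mulr1.
Qed.

(** Eigenvalues are listed with multiplicity, so the point is that the top eigenspace is a line. If
    the second entry equalled the first, two rows of the invertible [P] would both be multiples of
    the constant vector. *)
Theorem cayley_second_largest : (1 < #|gT|)%N ->
  (forall i : Iirr G, i != 0 -> cayley_eigenvalue i < cayley_eigenvalue 0) ->
  second_largest_eigenvalue (cayley S) != cayley_eigenvalue 0 /\
  (forall i : Iirr G, i != 0 -> cayley_eigenvalue i <= second_largest_eigenvalue (cayley S)).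
Proof.
move=> gT1 lt0; have ne i : i != 0 -> cayley_eigenvalue i != cayley_eigenvalue 0.
  by move=> i0; rewrite lt_eqF ?lt0.
pose P := spectralmx A; pose d := spectral_diag A.
have uP : P \in unitmx by apply: spectral_unit.
have AP : A = invmx P *m diag_mx d *m P by apply/orthomx_spectralP/hermitian_normalmx/A_herm.
have dreal i : d 0 i \is Num.real by apply: (mxOverP (hermitian_spectral_diag_real A_herm)).
pose L := [seq d 0 i | i <- enum 'I_#|gT|].
have cpE : char_poly A = \prod_(x <- L) ('X - x%:P).
  by rewrite AP char_poly_similar_diag // big_map big_enum.
rewrite /second_largest_eigenvalue /eigenvalues -/A.
case: closed_field_poly_normal => s0 /= s0E.
rewrite (monicP (char_poly_monic A)) scale1r in s0E.
have s0L : perm_eq s0 L by apply: prod_XsubC_eq; rewrite -s0E.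
set e := sort _ _; have eL : perm_eq e L by rewrite perm_sort.
have mem_e x : (x \in e) = eigenvalue A x.
  by rewrite (perm_mem eL) eigenvalue_root_char cpE root_prod_XsubC.
have e_real : all (mem Num.real) s0.
  by apply/allP=> x; rewrite (perm_mem s0L) => /mapP[i _ ->]; apply: dreal.
have e_sorted : sorted >=%R e.
  apply: (sort_sorted_in (P := mem Num.real)) => // x y xr yr.
  by rewrite /= orbC; apply: real_leVge.
have sz : size e = #|gT| by rewrite (perm_size eL) size_map size_enum_ord.
case: e e_sorted sz mem_e eL => [|a [|b e']]; [by move=> _ /= sz0; rewrite -sz0 in gT1|by move=> _ /= sz0; rewrite -sz0 in gT1|].
move=> /= /andP[ba be] _ mem_e eL.
have e'b x : x \in e' -> x <= b.
  move=> xe; have /allP := order_path_min (rev_trans le_trans) be.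
  exact.
have lea x : x \in [:: a, b & e'] -> x <= a.
  by rewrite !inE => /or3P[/eqP->|/eqP->|/e'b xb] //; apply: le_trans ba.
split=> [|i i0]; last first.
  have := A_eigenvalue i; rewrite -mem_e !inE => /or3P[/eqP E1|/eqP->|/e'b] //.
  have := lea (cayley_eigenvalue 0); rewrite mem_e A_eigenvalue => /(_ isT).
  by rewrite -E1 => /(lt_le_trans (lt0 i i0)); rewrite ltxx.
apply/eqP=> b0.
have /eigenvalueP[v vA v0] : eigenvalue A a by rewrite -mem_e inE eqxx.
have [i /eqP Ei] : exists i, cayley_eigenvalue i == a.
  apply/existsP; apply: contraT => /existsPn nE; case/negP: v0; apply/eqP.
  rewrite -[v]mulmx1 -sumE mulmx_sumr big1 // => i _; apply: eigen_proj vA (nE i).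
have ab : a = b.
  apply/le_anti; rewrite ba andbT b0 -Ei.
  by have [->|/lt0/ltW] := eqVneq i 0.
pose Q := fun i : 'I_#|gT| => d 0 i == b.
have : (1 < size (filter Q (enum 'I_#|gT|)))%N.
  have : (1 < count (fun x => x == b) [:: a, b & e'])%N by rewrite /= ab !eqxx.
  by rewrite (seq.permP eL) count_map size_filter.
have memQ l : l \in filter Q (enum 'I_#|gT|) -> Q l by rewrite mem_filter => /andP[].
have := filter_uniq Q (enum_uniq 'I_#|gT|); move: memQ.
case: (filter _ _) => [|j [|k s']] //= memQ /andP[+ _] _.
rewrite inE negb_or => /andP[jk _].
have dj : Q j by rewrite memQ // inE eqxx.
have dk : Q k by rewrite memQ // !inE eqxx orbT.
have rowP_eig l : d 0 l = b -> exists x, row l P = x *: const_mx 1.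
  move=> dl; apply: (const_eigenvector ne); rewrite -b0 -dl AP.
  by rewrite !mulmxA -row_mul mulmxV // row1 -rowE row_diag_mx -scalemxAl -rowE.
have [x xE] := rowP_eig j (eqP dj); have [y yE] := rowP_eig k (eqP dk).
have z0 (w : 'rV_#|gT|) : w *m P = 0 -> w = 0.
  by move=> wP; rewrite -[w](mulmxK uP) wP mul0mx.
have wE : y *: delta_mx 0 j - x *: delta_mx 0 k = 0 :> 'rV[algC]_#|gT|.
  apply: z0; rewrite mulmxBl -!scalemxAl -!rowE xE yE !scalerA mulrC.
  by rewrite subrr.
have y0 : y = 0.
  have := congr1 (fun M : 'rV_#|gT| => M 0 j) wE; rewrite !mxE !eqxx (negbTE jk) mulr1 mulr0 subr0.
  by [].
have := z0 (delta_mx 0 k); rewrite -rowE yE y0 scale0r => /(_ erefl).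
move=> /(congr1 (fun M : 'rV_#|gT| => M 0 k))/eqP.
by rewrite !mxE !eqxx oner_eq0.
Qed.

End CayleySpectrum.

(** * Conjugacy classes of cycles *)

Lemma cyc_order_card n k : (0 < k <= n)%N -> forall i0 : 'I_n, i0 = 0%N :> nat ->
  forall j, (j < k)%N -> (cyc n k ^+ j)%g i0 = j :> nat.
Proof.
move=> /andP[k0 kn] i0 Ei0; elim=> [|j IH] jk; first by rewrite expg0 perm1.
have IHj := IH (ltnW jk); by rewrite expgSr permM cycE // IHj jk.
Qed.

Lemma iter_cyc n k (i0 : 'I_n) : (0 < k <= n)%N -> i0 = 0%N :> nat ->
  (cyc n k ^+ k)%g i0 = i0.
Proof.
move=> kn Ei0; apply: val_inj => /=; case: k kn => // k /andP[k0 kn].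
rewrite expgSr permM cycE // (cyc_order_card _ Ei0) ?k0 //.
by rewrite ltnn eqxx.
Qed.

Lemma cyc_fix n k (i : 'I_n) : (k <= n)%N -> (k <= i)%N -> cyc n k i = i.
Proof.
move=> kn ki; apply: val_inj; rewrite /= cycE //.
by rewrite ltnNge (leq_trans ki) //= eqn_leq [(_ < _)%N]ltnNge ki.
Qed.

Lemma cyc_low n k (i0 i : 'I_n) : (0 < k <= n)%N -> i0 = 0%N :> nat -> (i < k)%N ->
  i = (cyc n k ^+ i)%g i0.
Proof. by move=> kn Ei0 ik; apply: val_inj; rewrite /= (cyc_order_card kn Ei0). Qed.

Lemma cyc_pow_fix n k (i : 'I_n) j : (k <= n)%N -> (k <= i)%N -> (cyc n k ^+ j)%g i = i.
Proof.
by move=> kn ki; elim: j => [|j IH]; rewrite ?expg0 ?perm1 // expgSr permM IH cyc_fix.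
Qed.

Lemma order_cyc n k : (0 < k <= n)%N -> #[cyc n k]%g = k.
Proof.
move=> /[dup] kn /andP[k0 kn']; have n0 : (0 < n)%N by apply: leq_trans kn'.
pose i0 := Ordinal n0; have Ei0 : i0 = 0%N :> nat by [].
apply/eqP; rewrite eqn_leq; apply/andP; split.
  apply: dvdn_leq => //; rewrite order_dvdn; apply/eqP/permP=> i; rewrite perm1.
  have [ik|ki] := ltnP i k; last by rewrite cyc_pow_fix.
  rewrite {1}(cyc_low kn Ei0 ik) -permM -expgD addnC expgD permM iter_cyc //.
  by rewrite -(cyc_low kn Ei0 ik).
rewrite leqNgt; apply/negP=> lt; have := cyc_order_card kn Ei0 lt.
by rewrite expg_order perm1 Ei0 => E; have := order_gt0 (cyc n k); rewrite -E.
Qed.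

(** Divide a commuting [h] by the power of the cycle with the same image of 0: the quotient fixes 0,
    hence the whole support. *)
Lemma cent_cyc n k : (1 < k <= n)%N ->
  'C[cyc n k] = (<[cyc n k]> * perm.Sym_group (~: low n k))%g.
Proof.
move=> /andP[k1 kn']; have kn : (0 < k <= n)%N by rewrite kn' ltnW.
have n0 : (0 < n)%N by apply: leq_trans kn'; apply: ltnW.
pose i0 := Ordinal n0; have Ei0 : i0 = 0%N :> nat by [].
have comm_fix h : h \in 'C[cyc n k] -> h i0 = i0 -> h \in perm.Sym_group (~: low n k).
  move=> /cent1P hc h0; rewrite inE; apply/subsetP=> x; rewrite !inE.
  apply: contraR; rewrite negbK => xk; apply/eqP.
  rewrite (cyc_low kn Ei0 xk) -permM.
  have -> : (cyc n k ^+ x * h = h * cyc n k ^+ x)%g by apply: commute_sym; apply: commuteX.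
  by rewrite permM h0.
have sub2 : perm.Sym_group (~: low n k) \subset 'C[cyc n k].
  apply/subsetP=> h; rewrite inE => hS; apply/cent1P.
  have fixl (x : 'I_n) : (x < k)%N -> h x = x.
    by move=> xk; apply: (out_perm hS); rewrite !inE negbK.
  apply/permP=> x; rewrite !permM; have [xk|kx] := ltnP x k.
    rewrite fixl // fixl // cycE //.
    by case: ifP => // _; case: ifP => // _; rewrite ltnW.
  rewrite [cyc n k x]cyc_fix // cyc_fix //.
  by have := perm_closed x hS; rewrite !inE -!leqNgt kx.
apply/setP=> h; apply/idP/mulsgP=> [hc|[a b Ca Sb ->]]; last first.
  rewrite groupM //; last by apply: (subsetP sub2).
  by apply: (subsetP _ _ Ca); rewrite cycle_subG cent1id.
have hk : (h i0 < k)%N.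
  rewrite ltnNge; apply/negP=> kh; have := cyc_fix kn' kh.
  rewrite -permM (cent1P hc) permM => /perm_inj E.
  by have := congr1 val E; rewrite /= cycE //= k1.
exists (cyc n k ^+ (h i0))%g ((cyc n k ^- (h i0)) * h)%g.
- by rewrite mem_cycle.
- apply: comm_fix; first by rewrite groupM // groupV groupX // cent1id.
  rewrite permM.
  have -> : (cyc n k ^- (h i0))%g i0 = ((h^-1)%g i0).
    apply: (canLR (permK _)).
    have hc' : (h^-1)%g \in 'C[cyc n k] by rewrite groupV.
    rewrite -permM.
    have -> : (h^-1 * cyc n k ^+ (h i0) = cyc n k ^+ (h i0) * h^-1)%g.
      by apply: commuteX; apply/cent1P.
    by rewrite permM -(cyc_low kn Ei0 hk) permK.
  by rewrite permKV.
by rewrite mulKVg.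
Qed.

Lemma card_class_cyc n k : (1 < k <= n)%N ->
  #|(cyc n k ^: [set: 'S_n])%g| = ('C(n, k) * (k.-1)`!)%N.
Proof.
move=> /[dup] kn /andP[k1 kn']; have k0n : (0 < k <= n)%N by rewrite kn' ltnW.
have n0 : (0 < n)%N by lia.
pose i0 := Ordinal n0; have Ei0 : i0 = 0%N :> nat by [].
have cardC : #|'C[cyc n k]| = (k * (n - k)`!)%N.
  rewrite cent_cyc // TI_cardMg.
    rewrite -orderE order_cyc //; congr (_ * _)%N.
    transitivity #|perm_on (~: low n k)|; first by apply: eq_card => s; rewrite !inE.
    by rewrite card_perm cardsCs setCK card_low // card_ord.
  apply/trivgP/subsetP=> h; rewrite !inE => /andP[/cyclePmin[j]].
  rewrite order_cyc // => jk -> hS.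
  have := out_perm hS (x := i0); rewrite !inE negbK -/(low n k) => /(_ ltac:(lia)) E.
  have := cyc_order_card k0n Ei0 jk; rewrite E Ei0 => <-.
  by rewrite expg0.
have := index_cent1 [set: 'S_n]%G (cyc n k); rewrite setTI => <-.
have := Lagrange (subsetT 'C[cyc n k]); rewrite cardC cardsT card_Sn.
rewrite -(bin_fact kn') => L.
have kE : k`! = (k * k.-1`!)%N by case: (k) k1.
have {}L : (k * (n - k)`! * #|[set: {perm 'I_n}]%G : 'C[cyc n k]%g| = 'C(n, k) * (k`! * (n - k)`!))%N := L.
have P0 : (0 < k * (n - k)`!)%N by rewrite muln_gt0 fact_gt0 andbT ltnW.
by apply/eqP; rewrite -(eqn_pmul2l P0) L kE; apply/eqP; lia.
Qed.

Lemma porbitJ (T : finType) (s g : {perm T}) x : porbit (s ^ g)%g (g x) = g @: porbit s x.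
Proof.
apply/setP=> y; apply/porbitP/imsetP=> [[i ->]|[z /porbitP[i ->] ->]].
  by exists ((s ^+ i)%g x); rewrite ?mem_porbit // -conjXg permJ.
by exists i; rewrite -conjXg permJ.
Qed.

Lemma is_cycleJ n k (s g : 'S_n) : is_cycle k s -> is_cycle k (s ^ g)%g.
Proof.
case/existsP=> x /andP[Ek Hs]; apply/existsP; exists (g x); rewrite porbitJ card_imset ?Ek //=;
  last exact: perm_inj.
apply/subsetP=> y; have Ey : (s ^ g)%g y = g (s ((g^-1)%g y)) by rewrite -{1}[y](permKV g) permJ.
rewrite inE Ey => sy; apply/imsetP; exists ((g^-1)%g y); last by rewrite permKV.
by apply: (subsetP Hs); rewrite inE; apply: contra sy => /eqP->; rewrite permKV.
Qed.

Lemma is_cycle_cyc n k : (0 < k <= n)%N -> is_cycle k (cyc n k).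
Proof.
move=> /[dup] kn /andP[k0 kn']; have n0 : (0 < n)%N by apply: leq_trans kn'.
pose i0 := Ordinal n0; have Ei0 : i0 = 0%N :> nat by [].
have E : porbit (cyc n k) i0 = low n k.
  apply/setP=> y; rewrite inE; apply/porbitP/idP=> [[i ->]|yk].
    rewrite -(expg_mod_order (cyc n k) i).
    by rewrite (cyc_order_card kn Ei0) // order_cyc ?ltn_pmod.
  by exists y; apply: cyc_low.
apply/existsP; exists i0; rewrite E card_low // eqxx /=.
by apply/subsetP=> y; rewrite !inE; apply: contraR; rewrite -leqNgt => ky; rewrite cyc_fix.
Qed.

Lemma mem_cycles n k (s : 'S_n) : (1 < k <= n)%N ->
  is_cycle k s = (s \in (cyc n k ^: [set: 'S_n])%g).
Proof.
move=> /[dup] kn /andP[k1 kn']; have k0n : (0 < k <= n)%N by rewrite kn' ltnW.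
apply/idP/imsetP=> [|[g _ ->]]; last by rewrite is_cycleJ ?is_cycle_cyc.
case/existsP=> x /andP[/eqP Ek Hs].
(* A permutation carrying 0,..,k-1 to the trajectory of [x] under [s] conjugates [cyc n k] to
   [s]. *)
pose l : seq 'I_n := [seq widen_ord kn' i | i <- enum 'I_k].
have szl : size l = k by rewrite size_map size_enum_ord.
have ul : uniq l.
  rewrite map_inj_uniq ?enum_uniq // => i j /(congr1 val) /= E; exact: val_inj.
have [] := @perm_extends _ [set: 'I_n] l (traject s x k) ul.
- by rewrite -Ek uniq_traject_porbit.
- by rewrite szl size_traject.
- by move=> ? _; rewrite inE.
- by move=> ? _; rewrite inE.
move=> g _ gl; exists g; rewrite ?inE //.
have gE (i : 'I_n) : (i < k)%N -> g i = iter i s x.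
  move=> ik; have : nth x (map g l) i = nth x (traject s x k) i by rewrite gl.
  rewrite nth_traject // (nth_map i) ?szl // (nth_map (Ordinal ik)) ?size_enum_ord //.
  move=> <-; congr (g _); apply: val_inj => /=.
  by rewrite nth_enum_ord.
apply/permP=> y; rewrite -{1 2}[y](permKV g); set z := (g^-1)%g y; rewrite permJ.
have [zk|kz] := ltnP z k; last first.
  rewrite cyc_fix //; apply: (out_perm Hs).
  rewrite porbit_traject Ek -gl; apply/negP=> /mapP[w /mapP[u _ ->]] /perm_inj E.
  by have := ltn_ord u; rewrite ltnNge; move: kz; rewrite E /= => ->.
rewrite gE // -iterS; have := cycE z kn'; case: ifP => [zk' E|zk'].
  by rewrite gE E.
have -> : z.+1 == k by rewrite eqn_leq zk leqNgt zk'.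
move=> E; rewrite gE E; last by lia.
have -> : z.+1 = k by lia.
by rewrite -{1}Ek iter_porbit.
Qed.

Lemma sum_nat_kall n (I : {pred nat}) (F : nat -> algC) :
  (forall k, k \in I -> (2 <= k <= n)%N) ->
  \sum_(0 <= k < n.+1 | k \in I) F k = \sum_(k <- kall n I) F k.
Proof.
move=> Isub; rewrite big_filter; have [n1|n1] := leqP n 0.
  by rewrite !big1_seq // => k /andP[/Isub kn _]; exfalso; lia.
have E : n.+1 = (2 + n.-1)%N by lia.
rewrite /index_iota subn0 E iotaD big_cat /= [X in X + _]big1_seq ?add0r // => k /andP[/Isub kn].
by rewrite !inE => k01; exfalso; lia.
Qed.

(** The length of a cycle is its order, so the classes for different lengths are disjoint and
    partition the set. *)
Lemma sum_cycles_in n (I : {pred nat}) (f : 'S_n -> algC) :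
  (forall k, k \in I -> (2 <= k <= n)%N) -> (forall s g, f (s ^ g)%g = f s) ->
  \sum_(s in cycles_in n I) f s =
  \sum_(k <- kall n I) ('C(n, k) * (k.-1)`!)%:R * f (cyc n k).
Proof.
move=> Isub fJ.
have ordE (s : 'S_n) k : k \in I -> is_cycle k s -> #[s]%g = k.
  move=> /Isub kn; rewrite mem_cycles // => /imsetP[g _ ->].
  by rewrite orderJ order_cyc //; lia.
have -> : \sum_(k <- kall n I) ('C(n, k) * (k.-1)`!)%:R * f (cyc n k) =
    \sum_(k < n.+1 | (k : nat) \in I) ('C(n, k) * (k.-1)`!)%:R * f (cyc n k).
  rewrite -(big_mkord (fun k => k \in I) (fun k => ('C(n, k) * (k.-1)`!)%:R * f (cyc n k))).
  by rewrite sum_nat_kall.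
rewrite (partition_big (fun s : 'S_n => inord #[s]%g : 'I_n.+1) (fun k => (k : nat) \in I)) /=.
  apply: eq_bigr => k kI; have kn := Isub _ kI.
  rewrite (eq_bigl (mem (cyc n k ^: [set: 'S_n])%g)).
    rewrite (eq_bigr (fun _ => f (cyc n k))) => [|s /imsetP[g _ ->]]; last exact: fJ.
    by rewrite sumr_const card_class_cyc // mulr_natl.
  move=> s; rewrite /= -mem_cycles // inE; apply/andP/idP=> [[/existsP[j /andP[jI js]]]|ks].
    by rewrite (ordE s j) // inord_val => /eqP <-.
  split; first by apply/existsP; exists k; rewrite kI.
  by rewrite (ordE s k) // inord_val.
move=> s; rewrite inE => /existsP[k /andP[kI ks]].
by rewrite (ordE s k) // inord_val.
Qed.

Lemma cycles_inJ n (I : {pred nat}) (s g : 'S_n) : s \in cycles_in n I -> (s ^ g)%g \in cycles_in n I.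
Proof.
by rewrite !inE => /existsP[k /andP[kI ks]]; apply/existsP; exists k; rewrite kI is_cycleJ.
Qed.

Lemma cycles_inV n (I : {pred nat}) (s : 'S_n) : s \in cycles_in n I -> (s^-1)%g \in cycles_in n I.
Proof.
rewrite !inE => /existsP[k /andP[kI /existsP[x /andP[xk xs]]]]; apply/existsP; exists k.
rewrite kI; apply/existsP; exists x; rewrite porbitV xk /=.
apply/subsetP=> y; rewrite inE => sy; apply: (subsetP xs); rewrite inE.
by apply: contra sy => /eqP {1}<-; rewrite permK.
Qed.

(** * Symmetrisers annihilating Specht modules *)

(** A group algebra element that kills the spanning polytabloids acts as zero on the Specht module,
    so its trace is 0. *)
Lemma specht_char_kill n (z : seq nat) (a : 'S_n -> algC) :
  (forall t, \sum_g a g *: polytabloid z (t * g)%g = 0) ->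
  \sum_g a g * specht_char n z g = 0.
Proof.
move=> kill; pose B := \sum_g a g *: @set_mx n g; pose U := specht_mx n z.
have UB : U *m B = 0.
  apply/eqP; rewrite -submx0 sumsmxMr; apply/sumsmx_subP=> t _.
  rewrite (eqmxMr _ (genmxE _)) submx0 mulmx_sumr; apply/eqP; rewrite -[RHS](kill t).
  by apply: eq_bigr => g _; rewrite -scalemxAr polytabloidM.
have VB : val_submod (1%:M : 'M_(\rank U)) *m B = 0.
  by apply/eqP; rewrite -submx0 -UB submxMr // val_submod1.
have E g : specht_char n z g = \tr (specht_repr n z g) by rewrite cfunE inE.
under eq_bigr do rewrite E -mxtraceZ.
rewrite -raddf_sum /=; set M := (X in \tr X).
have -> : M = in_submod U (val_submod (1%:M : 'M_(\rank U)) *m B).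
  rewrite mulmx_sumr linear_sum; apply: eq_bigr => g _ /=.
  by rewrite -scalemxAr linearZ.
by rewrite VB linear0 mxtrace0.
Qed.

Lemma entry_col_stab n (z : seq nat) (t s : 'S_n) : s \in col_stab z t ->
  forall x, entry_col z (t * s)%g x = entry_col z t x.
Proof.
rewrite inE => /forallP H x; rewrite -{1}[x](permKV s) entry_colM.
by have /eqP := H ((s^-1)%g x); rewrite permKV.
Qed.

Lemma polytabloid_col n (z : seq nat) (t s : 'S_n) : s \in col_stab z t ->
  polytabloid z (t * s)%g = (-1) ^+ s *: polytabloid z t.
Proof.
move=> Cs; rewrite /polytabloid scaler_sumr [RHS](reindex_inj (mulgI s)) /=.
have Ec := entry_col_stab Cs; move: (Cs); rewrite inE => /forallP H.
apply: eq_big => [u|u _].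
  rewrite !inE; apply/forallP/forallP=> Hu i.
    rewrite permM; have := Hu (s i); rewrite !Ec => /eqP ->; exact: H.
  have := Hu ((s^-1)%g i); rewrite permM permKV !Ec => /eqP ->.
  by have := H ((s^-1)%g i); rewrite permKV eq_sym.
by rewrite scalerA odd_permM signr_addb mulrA -expr2 sqrr_sign mul1r mulgA.
Qed.

Lemma tabloid_row n (z : seq nat) (t s : 'S_n) : s \in row_stab z t ->
  tabloid z (t * s)%g = tabloid z t.
Proof.
rewrite inE => /forallP H; rewrite tabloidM; apply/setP=> u.
rewrite mem_rcoset !mem_lcoset mulgA; set w := (_^-1 * u)%g.
have E i : entry_row z t ((w * s^-1)%g i) = entry_row z t (w i).
  by rewrite permM; have /eqP := H ((s^-1)%g (w i)); rewrite permKV.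
by rewrite !inE; apply: eq_forallb => i; rewrite E.
Qed.

Lemma pigeonhole_in n (C : {set 'I_n}) (f : 'I_n -> nat) m :
  (forall i, f i < m)%N -> (m < #|C|)%N ->
  exists i j, [/\ i \in C, j \in C, i != j & f i = f j].
Proof.
move=> fm mC; pose h i := Ordinal (fm i).
have : ~~ dinjectiveb h C.
  apply/negP=> /dinjectiveP/leq_card_in; rewrite card_ord.
  by rewrite leqNgt mC.
case/dinjectivePn=> i iC [j]; rewrite !inE => /andP[ji jC] /(congr1 val) /= E.
by exists i, j; rewrite eq_sym.
Qed.

Lemma entry_row_lt n (z : seq nat) (t : 'S_n) i : is_partition n z ->
  (entry_row z t i < size z)%N.
Proof.
by case/and3P=> _ _ /eqP sz; apply: reshape_indexP; rewrite sz.
Qed.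

Lemma entry_col_lt n (z : seq nat) (t : 'S_n) i : is_partition n z ->
  (entry_col z t i < head 0%N z)%N.
Proof.
case/and3P=> srt _ /eqP sz; have lt : ((t^-1)%g i < sumn z)%N by rewrite sz.
apply: leq_trans (reshape_offsetP lt) _; have := reshape_indexP lt.
move: (reshape_index z ((t^-1)%g i)) => r; case: z srt {sz lt} => //= x w xw rw.
have gt : transitive geq by move=> a b c ab bc; apply: leq_trans bc ab.
have /allP al := order_path_min gt xw.
have : nth 0%N (x :: w) r \in x :: w by rewrite mem_nth.
by rewrite inE => /orP[/eqP->|/al].
Qed.

Lemma eq_opp_0 m (v : 'rV[algC]_m) : v = - v -> v = 0.
Proof.
move=> E; apply/rowP=> j; rewrite mxE; have /eqP := congr1 (fun M : 'rV_m => M 0 j) E.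
by rewrite mxE -addr_eq0 -mulr2n mulrn_eq0 => /eqP.
Qed.

(** With more points than rows, two points of [C] share a row of any tableau; their transposition
    fixes the tabloid and reverses the sign. *)
Lemma kill_sgn n (z : seq nat) (C : {set 'I_n}) : is_partition n z -> (size z < #|C|)%N ->
  forall t, \sum_(g in perm.Sym C) (-1) ^+ g *: polytabloid z (t * g)%g = 0.
Proof.
move=> pz zC t.
have K u : \sum_(g in perm.Sym C) (-1) ^+ g *: set_vec (tabloid z (u * g)%g) = 0.
  have [i [j [iC jC ij E]]] := pigeonhole_in (fun i => entry_row_lt u i pz) zC.
  pose tau := tperm i j; have tC : tau \in perm.Sym_group C by apply: tperm_Sym.
  have tR : tau \in row_stab z u.
    by rewrite inE; apply/forallP=> x; rewrite /tau; case: tpermP => [->|->|_ _]; rewrite ?E.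
  apply: eq_opp_0; rewrite {1}(reindex_inj (mulgI tau)) -sumrN /=.
  apply: eq_big => [g|g _]; first exact: (groupMl _ tC).
  rewrite odd_permM odd_tperm ij addTb signrN scaleNr; congr (- (_ *: set_vec _)).
  by rewrite mulgA tabloidM tabloid_row // -tabloidM.
under eq_bigr do rewrite -polytabloidM /polytabloid mulmx_suml scaler_sumr.
rewrite exchange_big big1 //= => s _.
under eq_bigr do rewrite -scalemxAl set_vecM -tabloidM scalerA mulrC -scalerA.
by rewrite -scaler_sumr K scaler0.
Qed.

(** Dually, two points of [C] share a column, and their transposition negates the polytabloid. *)
Lemma kill_triv n (z : seq nat) (C : {set 'I_n}) : is_partition n z -> (head 0 z < #|C|)%N ->
  forall t, \sum_(g in perm.Sym C) polytabloid z (t * g)%g = 0.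
Proof.
move=> pz zC t.
have [i [j [iC jC ij E]]] := pigeonhole_in (fun i => entry_col_lt t i pz) zC.
pose tau := tperm i j; have tC : tau \in perm.Sym_group C by apply: tperm_Sym.
have tR : tau \in col_stab z t.
  by rewrite inE; apply/forallP=> x; rewrite /tau; case: tpermP => [->|->|_ _]; rewrite ?E.
apply: eq_opp_0; rewrite {1}(reindex_inj (mulgI tau)) -sumrN /=.
apply: eq_big => [g|g _]; first exact: (groupMl _ tC).
rewrite mulgA -polytabloidM polytabloid_col // odd_tperm ij expr1 scaleN1r mulNmx.
by rewrite polytabloidM.
Qed.

Lemma ecf_top (T : finType) (A : {set T}) g : g \in perm.Sym A -> ecf A #|A| g = (-1) ^+ g.
Proof.
move=> gA; rewrite ecfE // (big_pred1 A) => [|C]; last first.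
  by rewrite /= eqEcard; case: (boolP (C \subset A)) => //= /subset_leq_card le; rewrite eqn_leq le.
by have [E1 E2] := restr_perm_Sym gA; rewrite /sgnset E1 E2.
Qed.

(** Inner products of characters are nonnegative, so no constituent can contribute to a zero
    total. *)
Lemma dot_constt0 (gT : finGroupType) (G K : {group gT}) (V chi : 'CF(G)) (eps : 'CF(K)) :
  V \is a character -> chi \in irr G -> eps \is a character ->
  '['Res[K] V, eps] = 0 -> '[V, chi] != 0 -> '['Res[K] chi, eps] = 0.
Proof.
move=> NV ichi Ne V0 Vchi; have Nd := char_subr_irr NV ichi Vchi.
have Nc : chi \is a character by have /irrP[i ->] := ichi; apply: irr_char.
have c0 : 0 <= '['Res[K] chi, eps] by rewrite natr_ge0 // Cnat_cfdot_char ?cfRes_char.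
have d0 : 0 <= '['Res[K] (V - chi), eps] by rewrite natr_ge0 // Cnat_cfdot_char ?cfRes_char.
move: V0; rewrite -[V](subrK chi) raddfD /= cfdotDl => /eqP.
by rewrite paddr_eq0 // => /andP[_ /eqP].
Qed.

Definition specht_SN n (z : seq nat) : 'CF(SN n n) := 'Res[SN n n] (specht_char n z).

Lemma specht_SN_char n z : specht_SN n z \is a character.
Proof. by rewrite cfRes_char // cfRepr_char. Qed.

Lemma specht_SNE n z g : specht_SN n z g = specht_char n z g.
Proof. by rewrite cfResE ?subsetT // SNT inE. Qed.

Lemma sgn_not_constt n z j (chi : 'CF(SN n n)) : is_partition n z -> (size z < j <= n)%N ->
  chi \in irr (SN n n) -> '[specht_SN n z, chi] != 0 ->
  '['Res[SN n j] chi, ecf (low n j) j] = 0.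
Proof.
move=> pz /andP[zj jn] ichi; apply: dot_constt0 => //; first exact: specht_SN_char.
  exact: ecf_char.
have sub := SN_sub n jn; rewrite cfdotE; apply/eqP; rewrite mulf_eq0; apply/orP; right; apply/eqP.
pose a (g : 'S_n) : algC := if g \in SN n j then (-1) ^+ g else 0.
rewrite -[RHS](@specht_char_kill n z a) => [|t].
  rewrite [RHS](bigID (mem (SN n j))) /= [X in _ + X]big1 ?addr0 => [|g /negbTE ng]; last first.
    by rewrite /a ng mul0r.
  apply: eq_bigr => g gj; rewrite cfResE // specht_SNE /a gj mulrC; congr (_ * _).
  have := @ecf_top _ (low n j) g gj; rewrite card_low // => ->; exact: rmorph_sign.
rewrite (bigID (mem (SN n j))) /= [X in _ + X]big1 ?addr0 => [|g /negbTE ng]; last first.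
  by rewrite /a ng scale0r.
rewrite -[RHS](@kill_sgn n z (low n j) pz _ t) ?card_low //.
by apply: eq_bigr => g gj; rewrite /a gj.
Qed.

Lemma triv_not_constt n z j (chi : 'CF(SN n n)) : is_partition n z -> (head 0%N z < j <= n)%N ->
  chi \in irr (SN n n) -> '[specht_SN n z, chi] != 0 ->
  '['Res[SN n j] chi, 1] = 0.
Proof.
move=> pz /andP[zj jn] ichi; apply: dot_constt0 => //; first exact: specht_SN_char.
  exact: cfun1_char.
have sub := SN_sub n jn; rewrite cfdotE; apply/eqP; rewrite mulf_eq0; apply/orP; right; apply/eqP.
pose a (g : 'S_n) : algC := (g \in SN n j)%:R.
rewrite -[RHS](@specht_char_kill n z a) => [|t].
  rewrite [RHS](bigID (mem (SN n j))) /= [X in _ + X]big1 ?addr0 => [|g /negbTE ng]; last first.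
    by rewrite /a ng mul0r.
  by apply: eq_bigr => g gj; rewrite cfResE // specht_SNE /a gj cfun1E gj rmorph1 mulr1 mul1r.
rewrite (bigID (mem (SN n j))) /= [X in _ + X]big1 ?addr0 => [|g /negbTE ng]; last first.
  by rewrite /a ng scale0r.
rewrite -[RHS](@kill_triv n z (low n j) pz _ t) ?card_low //.
by apply: eq_bigr => g gj; rewrite /a gj scale1r.
Qed.

Lemma Res_constt_trans n N M j (chi : 'CF(SN n N)) (psi : 'CF(SN n M)) (th : 'CF(SN n j)) :
  (j <= M)%N -> (M <= N)%N -> chi \is a character -> psi \in irr (SN n M) -> th \is a character ->
  '['Res[SN n M] chi, psi] != 0 -> '['Res[SN n j] psi, th] != 0 ->
  '['Res[SN n j] chi, th] != 0.
Proof.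
move=> jM MN Nc ip Nt cp; apply: contraNneq => E.
have := @dot_constt0 _ _ _ ('Res[SN n M] chi) psi th _ ip Nt _ cp => -> //.
  exact: cfRes_char.
by rewrite cfResRes ?SN_sub.
Qed.

(** * Which extremal characters a Specht module may contain *)

Lemma Res_hook_dot n N m j : (j < N)%N -> (m <= N)%N -> (N < n)%N ->
  '['Res[SN n N] (hook n N.+1 m), hook n N j] = ((m == j) + (m == j.+1))%N%:R.
Proof.
move=> jN mN Nn; rewrite Res_hook // cfdotC hook_cf_dot_ecf ?card_low //; last exact: ltnW.
  by rewrite conjC_nat.
exact: ltnW.
Qed.

Lemma hook_char n N m : (m < N <= n)%N -> hook n N m \is a character.
Proof. by move=> mN; have /irrP[i ->] := hook_irr mN; apply: irr_char. Qed.

Lemma hook_top_sgn n N : (0 < N <= n)%N -> '[hook n N N.-1, ecf (low n N) N] != 0.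
Proof.
move=> /andP[N0 Nn]; rewrite hook_cf_dot_ecf ?card_low //; last by rewrite prednK.
by rewrite prednK // eqxx pnatr_eq0 addn1.
Qed.

Lemma hook2_sgn3 n N : (3 <= N <= n)%N -> '['Res[SN n 3] (hook n N 2), ecf (low n 3) 3] != 0.
Proof.
elim: N => // N IH /andP[N2 Nn]; have [E|N3] := eqVneq N 2%N.
  move: Nn; rewrite E => n3; rewrite cfRes_id; exact: (@hook_top_sgn n 3).
have N3' : (3 <= N <= n)%N by lia.
apply: (Res_constt_trans (M := N) (psi := hook n N 2)) (IH N3') => //; try lia.
- by apply: hook_char; lia.
- by apply: hook_irr; lia.
- exact: ecf_char.
by rewrite Res_hook_dot ?eqxx ?pnatr_eq0 //; lia.
Qed.

Lemma hook_triv3 n N : (3 <= N <= n)%N -> '['Res[SN n 3] (hook n N (N - 3)), 1] != 0.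
Proof.
elim: N => // N IH /andP[N2 Nn]; have [E|N3] := eqVneq N 2%N.
  by rewrite E subnn hook0 cfRes_id cfnorm1 oner_eq0.
have N3' : (3 <= N <= n)%N by lia.
apply: (Res_constt_trans (M := N) (psi := hook n N (N - 3))) (IH N3') => //; try lia.
- by apply: hook_char; lia.
- by apply: hook_irr; lia.
- exact: cfun1_char.
have -> : (N.+1 - 3 = (N - 3).+1)%N by lia.
by rewrite Res_hook_dot ?eqxx ?pnatr_eq0 ?addn1 //; lia.
Qed.

Lemma hook2_triv c : '['Res[SN c.+4 c.+2] (hook c.+4 c.+4 2), 1] != 0.
Proof.
apply: (Res_constt_trans (M := c.+3) (psi := hook c.+4 c.+3 1)) => //; try lia.
- by apply: hook_char; lia.
- by apply: hook_irr; lia.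
- exact: cfun1_char.
- by rewrite Res_hook_dot ?eqxx ?pnatr_eq0 ?addn1 //; lia.
by rewrite -(hook0 c.+4 c.+2) Res_hook_dot ?eqxx ?pnatr_eq0 ?addn1 //; lia.
Qed.

Lemma hook_sgn_step n N : (0 < N < n)%N ->
  '['Res[SN n N] (hook n N.+1 N.-1), ecf (low n N) N] != 0.
Proof.
move=> /andP[N0 Nn]; rewrite Res_hook //.
have lt : (N.-1 < #|low n N|)%N by rewrite (card_low (ltnW Nn)) prednK.
by have := ecf_dot_succ lt; rewrite prednK // => ->; exact: oner_neq0.
Qed.

(** Removing one suitable cell from either shape gives (2,1^(n-3)), and removing the second cell of
    its first row leaves the column of length n-2. *)
Lemma hook_near_sgn c : (0 < c)%N ->
  '['Res[SN c.+4 c.+2] (hook c.+4 c.+4 c.+1), ecf (low c.+4 c.+2) c.+2] != 0 /\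
  '['Res[SN c.+4 c.+2] (near c.+4 c.+4 c.+1), ecf (low c.+4 c.+2) c.+2] != 0.
Proof.
move=> c0; have H := @hook_sgn_step c.+4 c.+2 ltac:(lia).
have ih : hook c.+4 c.+3 c.+1 \in irr (SN c.+4 c.+3) by apply: hook_irr; lia.
split.
  apply: (Res_constt_trans (M := c.+3) (psi := hook c.+4 c.+3 c.+1)) H => //; try lia.
  - by apply: hook_char; lia.
  - exact: ecf_char.
  by rewrite Res_hook_dot ?eqxx ?pnatr_eq0 ?addn1 //; lia.
apply: (Res_constt_trans (M := c.+3) (psi := hook c.+4 c.+3 c.+1)) H => //; try lia.
- have /irrP[i ->] : near c.+4 c.+4 c.+1 \in irr (SN c.+4 c.+4) by apply: near_irr; lia.
  exact: irr_char.
- exact: ecf_char.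
have Z1 := @near_dot_hook c.+4 c.+2 c.+1 c.+1 ltac:(lia) ltac:(lia) ltac:(lia).
have Z2 := @near_dot_hook c.+4 c.+2 c c.+1 ltac:(lia) ltac:(lia) ltac:(lia).
have Z3 := @hook_dot c.+4 c.+3 c.+1 c.+1 ltac:(lia) ltac:(lia) ltac:(lia).
have -> : 'Res[SN c.+4 c.+3] (near c.+4 c.+4 c.+1) =
    near c.+4 c.+3 c.+1 + near c.+4 c.+3 c + hook c.+4 c.+3 c.+1 by apply: Res_near.
by rewrite 2!cfdotDl Z1 Z2 Z3 eqxx !add0r oner_eq0.
Qed.

Lemma specht_trivial n g : (0 < n)%N -> specht_char n [:: n] g = specht_char n [:: n] 1%g.
Proof.
move=> n0; have pz : is_partition n [:: n] by rewrite /is_partition /= inE addn0 eqxx andbT eq_sym -lt0n.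
have rT (t s : 'S_n) : s \in row_stab [:: n] t.
  rewrite inE; apply/forallP=> i.
  have := entry_row_lt t i pz; have := entry_row_lt t (s i) pz.
  by rewrite !ltnS !leqn0 => /eqP-> /eqP->.
have inv (t : 'S_n) h : polytabloid [:: n] (t * h)%g = polytabloid [:: n] t.
  rewrite -polytabloidM /polytabloid mulmx_suml; apply: eq_bigr => s _.
  by rewrite -scalemxAl set_vecM -tabloidM tabloid_row.
pose a (h : 'S_n) : algC := (h == g)%:R - (h == 1%g)%:R.
have sel (f : 'S_n -> algC) h0 : \sum_h (h == h0)%:R * f h = f h0.
  rewrite (bigD1 h0) //= eqxx mul1r big1 ?addr0 // => h /negbTE->; exact: mul0r.
have : \sum_h a h * specht_char n [:: n] h = 0.
  apply: specht_char_kill => t; under eq_bigr do rewrite inv.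
  rewrite -scaler_suml sumrB.
  have s1 h0 : \sum_(h : 'S_n) (h == h0)%:R = 1 :> algC.
    by rewrite -[RHS](sel (fun _ => 1) h0); apply: eq_bigr => h _; rewrite mulr1.
  by rewrite !s1 subrr scale0r.
under eq_bigr do rewrite mulrBl.
by rewrite sumrB !sel => /eqP; rewrite subr_eq0 => /eqP.
Qed.

(** Up to sign, a polytabloid of this shape depends only on the entry in the single cell [p] outside
    the first column. The bound serves to exclude (2,2,1^(n-4)), which the row and column tests
    cannot separate from (2,1^(n-2)). *)
Lemma rank_specht_two c : (\rank (specht_mx c.+4 (2 :: nseq c.+2 1%N)) <= c.+4)%N.
Proof.
set z := 2%N :: _; pose p : 'I_c.+4 := Ordinal (isT : (1 < c.+4)%N).
have zs : sumn z = c.+4 by rewrite /z /= sumn_nseq mul1n.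
have off (q : 'I_c.+4) : q != p -> reshape_offset z q = 0%N.
  move=> qp; have qz : (q < sumn z)%N by rewrite zs.
  have := reshape_offsetP qz.
  case E: (reshape_index z q) => [|r].
    rewrite /reshape_offset E /= subn0 => q2; case: ltngtP q2 => //.
    have : (q : nat) != 1%N by rewrite -[1%N]/(val p) (inj_eq val_inj).
    by case: (nat_of_ord q) => [|[|]].
  have nz : (nth 0%N z r.+1 <= 1)%N by rewrite /z -[nth _ _ _]/(nth 0%N (nseq c.+2 1%N) r) nth_nseq; case: ifP.
  by move=> lt; apply/eqP; rewrite -leqn0 -ltnS; apply: leq_trans lt nz.
have gen t : exists2 a : 'I_c.+4, True & (polytabloid z t <= polytabloid z (tperm p a))%MS.
  pose a := t p; pose s := ((tperm p a)^-1 * t)%g; exists a => //.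
  have Et : t = (tperm p a * s)%g by rewrite mulKVg.
  have sa : s a = a by rewrite /s permM tpermV tpermR.
  have cs : s \in col_stab z (tperm p a).
    rewrite inE; apply/forallP=> x; rewrite /entry_col.
    have [->|xa] := eqVneq x a; first by rewrite sa.
    rewrite !off //; apply/eqP=> E; have := congr1 (tperm p a) E; rewrite permKV tpermL.
      by move/eqP: xa.
    by rewrite -{1}sa => /perm_inj/eqP; apply/negP.
  by rewrite {1}Et polytabloid_col // scalemx_sub.
have sub : (specht_mx c.+4 z <= \sum_(a : 'I_c.+4) <<polytabloid z (tperm p a)>>)%MS.
  apply/sumsmx_subP=> t _; have [a _ le] := gen t.
  by rewrite genmxE; apply: submx_trans le _; rewrite (sumsmx_sup a) // genmxE.
apply: leq_trans (mxrankS sub) _.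
apply: leq_trans (mxrank_sum_leqif _).1 _ => /=.
apply: (@leq_trans (\sum_(j < c.+4) 1)%N); last by rewrite sum1_card card_ord.
apply: leq_sum => a _.
by rewrite mxrank_gen rank_leq_row.
Qed.

Lemma all_pos_sumn (w : seq nat) : 0%N \notin w ->
  (size w <= sumn w)%N /\ (sumn w = size w -> w = nseq (size w) 1%N).
Proof.
elim: w => //= x w IH; rewrite inE negb_or => /andP[x0 /IH[le E]].
have x1 : (0 < x)%N by rewrite lt0n eq_sym.
split=> [|H]; first by lia.
by rewrite {1}E; [congr (_ :: _); lia|lia].
Qed.

Lemma path_geq_one (w : seq nat) : path geq 1%N w -> (sumn w <= size w)%N.
Proof.
have gt : transitive geq by move=> a b d ab bc; apply: leq_trans bc ab.
move=> /(order_path_min gt); elim: w => //= x w IH /andP[x1 /IH]; lia.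
Qed.

Lemma partition_long c z : is_partition c.+4 z ->
  [/\ (c.+4 <= size z)%N -> z = nseq c.+4 1%N,
      size z = c.+3 -> z = 2%N :: nseq c.+2 1%N &
      size z = c.+2 -> z = 3%N :: nseq c.+1 1%N \/ z = 2%N :: 2%N :: nseq c 1%N].
Proof.
case/and3P=> srt pos /eqP sz; split=> [le|E|E].
- have [le' E] := all_pos_sumn pos; have e : size z = c.+4 by lia.
  by rewrite {1}E ?e //; lia.
- case: z srt pos sz E => // x w /= xw; rewrite inE negb_or => /andP[x0 pos] sz [E].
  have [le H] := all_pos_sumn pos.
  have x2 : x = 2%N.
    have [x1|x1] := eqVneq x 1%N; last by lia.
    by move: xw; rewrite x1 => /path_geq_one; lia.
  by rewrite H ?E ?x2 //; lia.
case: z srt pos sz E => // x w /= xw; rewrite inE negb_or => /andP[x0 pos] sz [E].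
have [le H] := all_pos_sumn pos.
have [x1|x1] := eqVneq x 1%N; first by move: xw; rewrite x1 => /path_geq_one; lia.
have [x3|x3] := eqVneq x 3%N; first by left; rewrite H ?E ?x3 //; lia.
have x2 : x = 2%N by lia.
right; case: w xw pos sz E {le H} => // y w /= /andP[yx yw]; rewrite inE negb_or => /andP[y0 pos] sz [E].
have [le H] := all_pos_sumn pos.
have y2 : y = 2%N.
  have [y1|y1] := eqVneq y 1%N; last by rewrite /geq /= in yx; lia.
  by move: yw; rewrite y1 => /path_geq_one; lia.
by rewrite H ?E ?x2 ?y2 //; lia.
Qed.

Lemma partition_wide c z : is_partition c.+4 z ->
  ((c.+4 <= head 0 z)%N -> z = [:: c.+4]) /\
  ((c.+2 <= head 0 z)%N -> (size z < 3)%N \/ z = [:: c.+2; 1%N; 1%N]).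
Proof.
case/and3P=> srt pos /eqP sz; case: z srt pos sz => //= x w xw; rewrite inE negb_or => /andP[x0 pos] sz.
have [le H] := all_pos_sumn pos; split=> cx.
  have : size w = 0%N by lia.
  by move/size0nil=> w0; rewrite w0 /= addn0 in sz *; rewrite sz.
have [w2|w2] := ltnP (size w) 2; first by left; lia.
right; have E : size w = 2%N by lia.
by rewrite H ?E /=; [congr (_ :: _); lia|lia].
Qed.

(** The degree n(n-3)/2 exceeds the rank bound n. *)
Lemma near_not_constt_two c : (2 < c)%N ->
  '[specht_SN c.+4 (2 :: nseq c.+2 1%N), near c.+4 c.+4 c.+1] = 0.
Proof.
move=> c2; apply/eqP; apply: contraT => ne; set V := specht_SN _ _ in ne.
have ip : near c.+4 c.+4 c.+1 \in irr (SN c.+4 c.+4) by apply: near_irr; lia.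
have sub1 (a b : 'CF(SN c.+4 c.+4)) : (a - b) 1%g = a 1%g - b 1%g by rewrite !cfunE.
have NV : V \is a character by apply: specht_SN_char.
have := char1_ge0 (char_subr_irr NV ip ne); rewrite sub1 subr_ge0 /V specht_SNE cfRepr1.
have Np : near c.+4 c.+4 c.+1 \is a character by have /irrP[i ->] := ip; apply: irr_char.
have c3n : (3 < c.+4 <= c.+4)%N by lia.
have [_ DE] := zv_near_ends_deg c3n; rewrite !subSS subn0 in DE.
have := @ratr_zv c.+4 c.+4 1 _ isT isT (leqnn _) Np; rewrite cyc1 DE => <-.
have r : (\rank (specht_mx c.+4 (2 :: nseq c.+2 1%N)))%:R <= c.+4%:R :> algC.
  by rewrite ler_nat rank_specht_two.
have rE : c.+4%:R = ratr (c.+4%:R : rat) :> algC by rewrite ratr_nat.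
rewrite rE in r; move=> /le_trans/(_ r); rewrite ler_rat.
have cR := natr_ge c2; have -> : c.+4%:R = c%:R + 4 :> rat by rewrite -[c.+4]addn4 natrD.
by nra.
Qed.

Lemma specht_constt c z (phi : 'CF(SN c.+4 c.+4)) : (2 < c)%N -> is_partition c.+4 z ->
  z != [:: c.+4] -> z != nseq c.+4 1%N -> z != [:: c.+2; 1%N; 1%N] ->
  (if odd c then (z != 3%N :: nseq c.+1 1%N) && (z != 2%N :: 2%N :: nseq c 1%N)
   else z != 2%N :: nseq c.+2 1%N) ->
  phi \in irr (SN c.+4 c.+4) -> '[specht_SN c.+4 z, phi] != 0 ->
  phi != hook c.+4 c.+4 0 /\ phi \notin extremal c.
Proof.
move=> c2 pz z0 z1 z2 zc ip zp.
have [L4 L3 L2] := partition_long pz; have [W4 W2] := partition_wide pz.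
have le24 : (c.+2 <= c.+4)%N := leqW (leqnSn _).
have hd : (head 0 z < c.+4)%N by rewrite ltnNge; apply/negP=> /W4/eqP; apply/negP.
have s4 : (size z < c.+4)%N by rewrite ltnNge; apply/negP=> /L4/eqP; apply/negP.
have p0 : phi != hook c.+4 c.+4 0.
  apply/eqP=> E; have := @triv_not_constt c.+4 z c.+4 phi pz; rewrite hd leqnn => /(_ isT ip zp).
  by rewrite E hook0 cfRes_id cfnorm1 => /eqP; rewrite oner_eq0.
have psgn : phi != hook c.+4 c.+4 c.+3.
  apply/eqP=> E; have := @sgn_not_constt c.+4 z c.+4 phi pz; rewrite s4 leqnn => /(_ isT ip zp).
  by rewrite E cfRes_id => /eqP; apply/negP; apply: (@hook_top_sgn c.+4 c.+4); rewrite leqnn.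
have p2 : phi != hook c.+4 c.+4 2.
  (* As z is not (n-2,1,1), either its first row is shorter than n-2 or it has at most two rows;
     (n-2,1,1) fails the corresponding test in both cases. *)
  apply/eqP=> E; have [h2|h2] := ltnP (head 0 z) c.+2.
    have := @triv_not_constt c.+4 z c.+2 phi pz; rewrite h2 le24 => /(_ isT ip zp).
    by rewrite E => /eqP; apply/negP; apply: hook2_triv.
  have [s3|/eqP] := W2 h2; last by rewrite (negbTE z2).
  have := @sgn_not_constt c.+4 z 3 phi pz; rewrite s3 => /(_ isT ip zp).
  by rewrite E => /eqP; apply/negP; apply: hook2_sgn3; rewrite leqnn.
split=> //; rewrite /extremal; move: zc; case: ifP => co zc; rewrite !inE !negb_or psgn p2 /=.
  case/andP: zc => z3 z22.
  have c0 : (0 < c)%N by apply: leq_trans c2.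
  have [H1 H2] := hook_near_sgn c0.
  have [s2|s2] := ltnP (size z) c.+2.
    have := @sgn_not_constt c.+4 z c.+2 phi pz; rewrite s2 le24 => /(_ isT ip zp) S.
    apply/andP; split; apply/eqP=> E; move: S; rewrite E => /eqP; apply/negP; [exact: H1|exact: H2].
  have [s3|s3] := eqVneq (size z) c.+2.
    by case: (L2 s3) => /eqP; rewrite ?(negbTE z3) ?(negbTE z22).
  (* The sign test fails for this shape: the trivial character of S_3 excludes (3,1^(n-3)), and the
     dimension excludes (2,2,1^(n-4)). *)
  have Ez : z = 2%N :: nseq c.+2 1%N.
    apply: L3; apply/eqP; rewrite eqn_leq; apply/andP; split; first by rewrite -ltnS.
    by rewrite ltn_neqAle eq_sym s3.
  apply/andP; split; apply/eqP=> E.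
    have := @triv_not_constt c.+4 z 3 phi pz; rewrite {1}Ez => /(_ isT ip zp).
    rewrite E => /eqP; apply/negP; have := @hook_triv3 c.+4 c.+4; rewrite leqnn !subSS subn0.
    exact.
  by move: zp; rewrite Ez E near_not_constt_two // eqxx.
apply/eqP=> E; have s3 : (size z < c.+3)%N.
  rewrite ltnNge; apply/negP=> s3; move/eqP: zc; apply; apply: L3; apply/eqP.
  by rewrite eqn_leq s3 andbT -ltnS.
have := @sgn_not_constt c.+4 z c.+3 phi pz; rewrite s3 leqnSn => /(_ isT ip zp).
rewrite E => /eqP; apply/negP; apply: (@hook_sgn_step c.+4 c.+3); exact: ltnSn.
Qed.

(** * The second largest eigenvalue *)

Lemma zv_le1 n N k (phi : 'CF(SN n N)) : (0 < k)%N -> (k <= N)%N -> (N <= n)%N ->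
  phi \in irr (SN n N) -> zv phi k <= zv phi 1.
Proof.
move=> k0 kN Nn ip; have Np := irr_is_char ip.
apply: le_trans (ler_norm _) _; rewrite -(ler_rat algC) ratr_norm !ratr_zv //; last by lia.
by rewrite cyc1; apply: char1_ge_norm.
Qed.

(** Equality would need full values at both n- and (n-1)-cycles. Only the trivial character and the
    sign are nonzero at both, and the sign takes opposite values there. *)
Lemma nlam_lt_trivial c (I : {pred nat}) (phi : 'CF(SN c.+4 c.+4)) : (2 < c)%N ->
  c.+3 \in I -> c.+4 \in I -> phi \in irr (SN c.+4 c.+4) -> phi != hook c.+4 c.+4 0 ->
  nlam I phi < nlam I (hook c.+4 c.+4 0).
Proof.
move=> c2 I3 I4 ip p0; have D0 : 0 < zv phi 1 by apply: zv1_gt0; rewrite ?leqnn.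
have Z0 k : (1 <= k)%N -> (k <= c.+4)%N -> zv (hook c.+4 c.+4 0) k = 1.
  move=> k1 kc; apply: zv_eq => //; first by apply: hook_irr; rewrite leqnn.
  have H : cyc c.+4 k \in SN c.+4 c.+4 := cyc_SN kc kc.
  transitivity (1 : algC); last by rewrite rmorph1.
  by rewrite hook0 cfun1E H.
have -> : nlam I (hook c.+4 c.+4 0) = \sum_(k <- kall c.+4 I) ncyc c.+4 k.
  rewrite /nlam Z0 // divr1; apply: eq_big_seq => k /(@kall_bounds c.+4 I _ isT)/andP[k1 kc].
  by rewrite Z0 ?mulr1 // ltnW.
rewrite /nlam ltr_pdivrMr // mulr_suml !sum_kall //.
have w k : (0 < k <= c.+4)%N -> ncyc c.+4 k * zv phi k <= ncyc c.+4 k * zv phi 1.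
  by move=> /andP[k0 kc]; rewrite ler_pM2l ?zv_le1 // ncyc_gt0 // k0.
have S : \sum_(k <- ksmall c I) ncyc c.+4 k * zv phi k <= \sum_(k <- ksmall c I) ncyc c.+4 k * zv phi 1.
  rewrite big_seq [X in _ <= X]big_seq; apply: ler_sum => k /ksmallP/andP[k1 kc].
  by apply: w; rewrite ltnW //= ltnW // ltnW.
have w3 := w c.+3 (leqnSn _ : (0 < c.+3 <= c.+4)%N); have w4 := w c.+4 (leqnn _ : (0 < c.+4 <= c.+4)%N).
have st : (zv phi c.+3 < zv phi 1) || (zv phi c.+4 < zv phi 1).
  apply: contraT; rewrite negb_or -!leNgt => /andP[g3 g4].
  have /irrP[i Ei] := ip; have Np := irr_is_char ip.
  have n3 : 'chi_i (cyc c.+4 c.+4.-1) != 0.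
    rewrite -Ei -(ratr_zv _ _ _ Np) ?fmorph_eq0 ?leqnSn //.
    by rewrite (lt0r_neq0 (lt_le_trans D0 g3)).
  have n4 : 'chi_i (cyc c.+4 c.+4) != 0.
    rewrite -Ei -(ratr_zv _ _ _ Np) ?fmorph_eq0 ?leqnn //.
    by rewrite (lt0r_neq0 (lt_le_trans D0 g4)).
  have [m mc Em] := @irr_long_cyc c.+4 c.+4 i (leqnn _ : (0 < c.+4 <= c.+4)%N) n4.
  have [] := @irr_pred_cyc c.+4 c.+4 i (leqnn _ : (3 < c.+4 <= c.+4)%N) n3.
    case=> E; first by move: p0; rewrite Ei E eqxx.
    rewrite Ei E /= in g3 g4; move: g3 g4.
    rewrite (zv_hook_deg1 c).2.2 zv_hook_topc //.
    have := @zv_hook_sgn c.+4 c.+3 1 isT; rewrite addn1 leqnn => /(_ isT) /= ->.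
    by rewrite !sgn_cases /= negbK; case: (odd c) => /=; lra.
  case=> m' /andP[m0 mc'] E.
  have := @near_dot_hook c.+4 c.+3 m' m (leqW (mc' : (m' < c.+2)%N)) (mc : (m <= c.+3)%N) (ltnSn _).
  rewrite -E Em hook_dot ?leqnn // eqxx.
  by move/eqP; rewrite oner_eq0.
have W3 : 0 < ncyc c.+4 c.+3 by apply: ncyc_gt0; rewrite leqnSn.
have W4 : 0 < ncyc c.+4 c.+4 by apply: ncyc_gt0; rewrite leqnn.
case/orP: st => lt.
  by have := lt; rewrite -(ltr_pM2l W3); lra.
by have := lt; rewrite -(ltr_pM2l W4); lra.
Qed.

Section Spectrum.

Variables (c : nat) (I : {pred nat}).
Hypotheses (c2 : (2 < c)%N) (I3 : c.+3 \in I) (I4 : c.+4 \in I).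
Hypothesis Isub : forall k, k \in I -> (2 <= k <= c.+4)%N.

Let S := cycles_in c.+4 I.
Let G := SN c.+4 c.+4.
Let GT (x : 'S_c.+4) : x \in G. Proof. by rewrite /G SNT inE. Qed.

Lemma cayley_eigenvalueE (i : Iirr G) : cayley_eigenvalue S i = ratr (nlam I 'chi_i).
Proof.
rewrite /cayley_eigenvalue sum_cycles_in // => [|s g]; last exact: (cfunJ _ _ (GT g)).
rewrite /nlam fmorph_div /= ratr_zv ?leqnn ?irr_char // cyc1 rmorph_sum; congr (_ / _).
apply: eq_big_seq => k /(@kall_bounds c.+4 I _ isT)/andP[k1 kc].
by rewrite rmorphM /= (ratr_zv (ltnW k1) kc (leqnn _) (irr_char i)) ncyc.unlock ratr_nat.
Qed.

Lemma irr_neq0_hook (i : Iirr G) : (i != 0) = ('chi_i != hook c.+4 c.+4 0).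
Proof. by rewrite hook0 irr_eq1. Qed.

Lemma second_largest_spec :
  second_largest_eigenvalue (cayley S) != cayley_eigenvalue S (0 : Iirr G) /\
  (forall i : Iirr G, i != 0 -> cayley_eigenvalue S i <= second_largest_eigenvalue (cayley S)).
Proof.
apply: cayley_second_largest => //.
- exact: cycles_inV.
- exact: cycles_inJ.
- apply: (@leq_trans c.+4`!); last exact: (eq_leq (esym (card_Sn c.+4))).
  by apply: (@leq_trans c.+4) => //; rewrite factS leq_pmulr // fact_gt0.
move=> i i0; rewrite !cayley_eigenvalueE ltr_rat irr0 -hook0.
by apply: nlam_lt_trivial; rewrite ?mem_irr // -irr_neq0_hook.
Qed.

Lemma lambdaE z : lambda c.+4 I z =
  (\sum_(k <- kall c.+4 I) ('C(c.+4, k) * (k.-1)`!)%:R * specht_SN c.+4 z (cyc c.+4 k)) /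
  specht_SN c.+4 z 1%g.
Proof.
rewrite /lambda sum_nat_kall // mulr_suml; apply: eq_big_seq => k /(@kall_bounds c.+4 I _ isT) kb.
rewrite -mulrA /normalized_char_cycle !specht_SNE; congr (_ * (_ / _)).
have kb' : (0 < k <= c.+4)%N by case/andP: kb => /ltnW -> ->.
have : repr (cycles c.+4 k) \in cycles c.+4 k.
  by apply: (@mem_repr _ (cycles c.+4 k) (cyc c.+4 k)); rewrite inE is_cycle_cyc.
rewrite inE mem_cycles // => /imsetP[g _ ->].
by rewrite cfunJ ?inE.
Qed.

Lemma second_largest_gt0 : 0 < second_largest_eigenvalue (cayley S).
Proof.
have ih : hook c.+4 c.+4 2 \in irr G by apply: hook_irr; rewrite leqnn.
have /irrP[i Ei] := ih.
have i0 : i != 0 by rewrite irr_neq0_hook -Ei; apply: hook_neq; rewrite ?leqnn.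
apply: lt_le_trans (second_largest_spec.2 i i0).
by rewrite cayley_eigenvalueE -Ei nlam_hook2 // ltr0q blam_gt0.
Qed.

Lemma lambda_neq_second z : is_partition c.+4 z ->
  z != nseq c.+4 1%N -> z != [:: c.+2; 1%N; 1%N] ->
  (if odd c then (z != 3%N :: nseq c.+1 1%N) && (z != 2%N :: 2%N :: nseq c 1%N)
   else z != 2%N :: nseq c.+2 1%N) ->
  second_largest_eigenvalue (cayley S) <> lambda c.+4 I z.
Proof.
move=> pz z1 z2 zc; set Lam := second_largest_eigenvalue _.
have [Lam0 Lami] := second_largest_spec; rewrite -/Lam in Lam0 Lami.
rewrite lambdaE; set V := specht_SN _ _; have NV : V \is a character by apply: specht_SN_char.
(* If the Specht module had rank 0, division by zero would make [lambda] equal to 0, whereas the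
   second largest eigenvalue is positive. *)
have [V1|V1] := eqVneq (V 1%g) 0.
  by rewrite V1 invr0 mulr0 => E; have := second_largest_gt0; rewrite -/Lam E ltxx.
(* For the one-row shape the character is constant, so its [lambda] is the largest eigenvalue, which
   is not the second. *)
have [Ez|z0] := eqVneq z [:: c.+4].
  move=> E; case/eqP: Lam0; rewrite E /cayley_eigenvalue irr0 sum_cycles_in // => [|s g].
    have Vc g : V g = V 1%g by rewrite /V Ez !specht_SNE specht_trivial.
    under eq_bigr do rewrite Vc.
    rewrite -mulr_suml mulfK // cfun1E GT divr1; apply: eq_bigr => k _.
    by rewrite cfun1E GT mulr1.
  by rewrite !cfun1E !GT.
pose m i := '[V, 'chi_i].
have m0 i : 0 <= m i by rewrite natr_ge0 // Cnat_cfdot_char_irr.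
have VE g : V g = \sum_i m i * 'chi_i g.
  by rewrite {1}[V]cfun_sum_cfdot sum_cfunE; apply: eq_bigr => i _; rewrite cfunE.
have lt i : m i != 0 -> cayley_eigenvalue S i < Lam.
  move=> mi; have [p0 pe] := specht_constt c2 pz z0 z1 z2 zc (mem_irr i) mi.
  have [psi /irrP[j ->] [j0 lt]] := dominated c2 I3 I4 (mem_irr i) p0 pe.
  rewrite -irr_neq0_hook in j0; apply: lt_le_trans (Lami j j0).
  by rewrite !cayley_eigenvalueE ltr_rat.
have V0 : 0 < V 1%g by rewrite lt_def V1 char1_ge0.
(* The differences to [Lam], weighted by multiplicity times degree, add up to 0, yet every
   constituent contributes a positive term; so there would be no constituent. *)
move=> E; have : \sum_i m i * 'chi_i 1%g * (Lam - cayley_eigenvalue S i) = 0.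
  under eq_bigr do rewrite mulrBr.
  rewrite sumrB -mulr_suml -VE E [V 1%g * _]mulrC divfK //; apply/eqP; rewrite subr_eq0; apply/eqP.
  under eq_bigr do rewrite VE mulr_sumr.
  rewrite exchange_big /=; apply: eq_bigr => i _.
  rewrite /cayley_eigenvalue sum_cycles_in // => [|s g]; last exact: (cfunJ _ _ (GT g)).
  rewrite -mulrA [X in _ = _ * X]mulrC divfK ?irr1_neq0 // mulr_sumr.
  by apply: eq_bigr => k _; rewrite mulrCA.
have t0 i : 0 <= m i * 'chi_i 1%g * (Lam - cayley_eigenvalue S i).
  have [->|mi] := eqVneq (m i) 0; first by rewrite !mul0r.
  apply: mulr_ge0; last by rewrite subr_ge0 ltW // lt.
  by apply: mulr_ge0 => //; apply: ltW; apply: irr1_gt0.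
move=> /eqP; rewrite psumr_eq0 // => /allP al.
case/eqP: V1; rewrite VE big1 // => i _; have := al i (mem_index_enum i).
rewrite /= mulf_eq0 mulf_eq0; have [->|mi] := eqVneq (m i) 0; first by rewrite mul0r.
by rewrite (negbTE (irr1_neq0 i)) subr_eq0 gt_eqF // lt.
Qed.

End Spectrum.

Theorem theorem6p3 (n : nat) (I : {pred nat}) (n_ge7 : (7 <= n)%N)
    (I_n1 : n.-1 \in I) (I_n : n \in I)
    (I_sub : forall k : nat, k \in I -> (2 <= k <= n)%N) :
  (~~ odd n ->
     forall z : seq nat, is_partition n z ->
       second_largest_eigenvalue (cayley (cycles_in n I)) = lambda n I z ->
       z \in [:: nseq n 1%N; [:: (n - 2)%N; 1%N; 1%N];
                 2%N :: nseq (n - 2) 1%N])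
  /\
  (odd n ->
     forall z : seq nat, is_partition n z ->
       second_largest_eigenvalue (cayley (cycles_in n I)) = lambda n I z ->
       z \in [:: nseq n 1%N; [:: (n - 2)%N; 1%N; 1%N];
                 3%N :: nseq (n - 3) 1%N; 2%N :: 2%N :: nseq (n - 4) 1%N]).
Proof.
case: n n_ge7 I_n1 I_n I_sub => [|[|[|[|c]]]] // c2 I3 I4 Isub.
rewrite !subSS !subn0 [odd _]/= !negbK; split=> co z pz E; apply: contraT; rewrite !inE !negb_or.
  case/and3P=> z1 z2 z3; case: (lambda_neq_second c2 I3 I4 Isub pz z1 z2 _ E).
  by rewrite (negbTE co).
case/and4P=> z1 z2 z3 z4; case: (lambda_neq_second c2 I3 I4 Isub pz z1 z2 _ E).
by rewrite co z3.
Qed.
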